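(* Let $u_0\in\mathcal{S}([0,\infty))$ and $g_0\in C^\infty([0,\infty))$, and let $u(x,t)$ be defined for $(x,t)\in Q=\{(x,t)\in\mathbb{R}^2:x>0,\ t>0\}$ by $$u(x,t)=\frac{1}{2\pi}\int_{-\infty}^{\infty}e^{i\lambda x-\lambda^2t}\,\hat u_0(\lambda)\,d\lambda-\frac{1}{2\pi}\int_{\Gamma}e^{i\lambda x-\lambda^2t}\,\hat u_0(-\lambda)\,d\lambda-\frac{i}{\pi}\int_{\Gamma}e^{i\lambda x-\lambda^2t}\,\lambda\,\tilde g_0(\lambda,t)\,d\lambda .$$ Let $u$, $\partial u/\partial x$, $\partial^2u/\partial x^2$, $\partial^3u/\partial x^3$ also denote the continuous extensions of these functions from $Q$ to $\overline{Q}\setminus\{(0,0)\}$. Then the following hold. (1) If $u_0(0)=g_0(0)$, then $$\lim_{\overline{Q}\ni(x,t)\to(0,0)}u(x,t)=u_0(0)\quad\text{and}\quad\lim_{\overline{Q}\ni(x,t)\to(0,0)}\frac{\partial u(x,t)}{\partial x}=\frac{du_0(x)}{dx}\bigg|_{x=0}.$$ (2) If $u_0(0)=g_0(0)$ and $\frac{d^2u_0(x)}{dx^2}\Big|_{x=0}=\frac{dg_0(t)}{dt}\Big|_{t=0}$, then $$\lim_{\overline{Q}\ni(x,t)\to(0,0)}\frac{\partial^2u(x,t)}{\partial x^2}=\frac{d^2u_0(x)}{dx^2}\bigg|_{x=0}\quad\text{and}\quad\lim_{\overline{Q}\ni(x,t)\to(0,0)}\frac{\partial^3u(x,t)}{\partial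 x^3}=\frac{d^3u_0(x)}{dx^3}\bigg|_{x=0}.$$
   Context: Function spaces: a $C^\infty$ function $f:(0,\infty)\to\mathbb{C}$ belongs to $C^\infty([0,\infty))$ if $\lim_{x\to0^+}\frac{d^Nf(x)}{dx^N}$ exists for every integer $N\ge0$ (equivalently, $f$ extends to a $C^\infty$ function on $\mathbb{R}$); values of $f$ and its derivatives at $0$ denote these limits. $f\in\mathcal{S}([0,\infty))$ means $f\in C^\infty([0,\infty))$ and $\sup_{x\ge0}\left|x^M\frac{d^Nf(x)}{dx^N}\right|<\infty$ for all integers $M,N\ge0$. Transforms: $\hat u_0(\lambda)=\int_0^\infty u_0(x)e^{-i\lambda x}\,dx$ for $\lambda\in\mathbb{C}$ with $\operatorname{Im}\lambda\le0$; $\tilde g_0(\lambda,t)=\int_0^te^{\lambda^2\tau}g_0(\tau)\,d\tau$ for $\lambda\in\mathbb{C}$. Contour: $\Gamma=\{\lambda\in\mathbb{C}:\operatorname{Im}\lambda\ge0,\ \operatorname{Re}(\lambda^2)=0\}$ is the positively oriented boundary of $\Omega^-=\{\lambda\in\mathbb{C}:\operatorname{Im}\lambda\ge0,\ \operatorname{Re}(\lambda^2)\le0\}$, i.e. it comes in from infinity along the ray $\arg\lambda=3\pi/4$ to $0$ and then goes out to infinity along the ray $\arg\lambda=\pi/4$. For any such $u_0,g_0$, the function $u$ is $C^\infty$ on $Q$ and all its partial derivatives extend continuously to $\overline{Q}\setminus\{(0,0)\}$, where $\overline{Q}=\{x\ge0,\ t\ge0\}$; the limits are taken over $(x,t)\in\overline{Q}\setminus\{(0,0)\}$.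 *)

(* Defs.v *)
From Stdlib Require Import Reals.
From Coquelicot Require Import Coquelicot.
Open Scope R_scope.

Definition Cexp (z : C) : C := (exp (Re z) * cos (Im z), exp (Re z) * sin (Im z)).

(** [n]-th derivative of a complex-valued function of a real variable,
    taken on the real and imaginary parts. *)
Definition Cderive_n (f : R -> C) (n : nat) (x : R) : C :=
  (Derive_n (fun y => Re (f y)) n x, Derive_n (fun y => Im (f y)) n x).

Definition ex_Cderive_n (f : R -> C) (n : nat) (x : R) : Prop :=
  ex_derive_n (fun y => Re (f y)) n x /\ ex_derive_n (fun y => Im (f y)) n x.

(** An element of C^oo([0,oo)) is a function on (0,oo).  It is represented by a
    function on [R] whose values on (-oo,0] are irrelevant: no definition below
    depends on them, except through integrals, where [f 0] is negligible. *)
Definition smooth_halfline (f : R -> C) : Prop :=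
  (forall (n : nat) (x : R), 0 < x -> ex_Cderive_n f n x) /\
  (forall n : nat, exists l : C,
     filterlim (Cderive_n f n) (at_right 0) (locally (l : C_R_NormedModule))).

(** The limit at [0+] of the [n]-th derivative; [iota] picks the unique limit
    when there is one. *)
Definition derive_n_at0 (f : R -> C) (n : nat) : C :=
  iota (T := C_R_CompleteNormedModule)
    (fun l : C_R_CompleteNormedModule =>
       filterlim (Cderive_n f n) (at_right 0) (locally l)).

Definition derive_n_halfline (f : R -> C) (n : nat) (x : R) : C :=
  if Rlt_dec 0 x then Cderive_n f n x else derive_n_at0 f n.

Definition schwartz_halfline (f : R -> C) : Prop :=
  smooth_halfline f /\
  forall M N : nat, exists B : R, forall x : R, 0 <= x ->
    Cmod (RtoC (x ^ M) * derive_n_halfline f N x)%C <= B.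

Definition int_halfline (f : R -> C) : C :=
  RInt_gen (V := C_R_CompleteNormedModule) f (at_point 0) (Rbar_locally p_infty).

Definition int_line (f : R -> C) : C :=
  RInt_gen (V := C_R_CompleteNormedModule) f
    (Rbar_locally m_infty) (Rbar_locally p_infty).

(** Outgoing integral along the ray [arg lambda = theta]. *)
Definition int_ray (theta : R) (F : C -> C) : C :=
  int_halfline (fun r => F (RtoC r * Cexp (Ci * RtoC theta)) * Cexp (Ci * RtoC theta))%C.

(** Gamma comes in from infinity along [arg lambda = 3 pi / 4] and goes out to
    infinity along [arg lambda = pi / 4]. *)
Definition int_Gamma (F : C -> C) : C :=
  (int_ray (PI / 4) F - int_ray (3 * PI / 4) F)%C.

Definition u0_hat (u0 : R -> C) (lambda : C) : C :=
  int_halfline (fun x => u0 x * Cexp (- (Ci * lambda * RtoC x)))%C.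

Definition g0_tilde (g0 : R -> C) (lambda : C) (t : R) : C :=
  RInt (V := C_R_CompleteNormedModule)
    (fun tau => Cexp (lambda ^ 2 * RtoC tau) * g0 tau)%C 0 t.

Definition utm_kernel (lambda : C) (x t : R) : C :=
  Cexp (Ci * lambda * RtoC x - lambda ^ 2 * RtoC t)%C.

Definition utm_solution (u0 g0 : R -> C) (x t : R) : C :=
  (RtoC (/ (2 * PI)) *
     int_line (fun l => utm_kernel (RtoC l) x t * u0_hat u0 (RtoC l))
   - RtoC (/ (2 * PI)) *
     int_Gamma (fun l => utm_kernel l x t * u0_hat u0 (- l))
   - Ci * RtoC (/ PI) *
     int_Gamma (fun l => utm_kernel l x t * l * g0_tilde g0 l t))%C.

Definition partial_x (k : nat) (v : R -> R -> C) (x t : R) : C :=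
  Cderive_n (fun y => v y t) k x.

Definition punctured_quadrant (p : R * R) : Prop :=
  0 <= fst p /\ 0 <= snd p /\ p <> (0, 0).

Definition lim_in_quadrant (U : R * R -> C) (p : R * R) (l : C) : Prop :=
  filterlim U (within punctured_quadrant (locally p))
    (locally (l : C_R_NormedModule)).

(** [U] is the continuous extension of [v] from the open quadrant to the
    closed quadrant minus the origin. *)
Definition continuous_extension (v : R -> R -> C) (U : R * R -> C) : Prop :=
  (forall x t : R, 0 < x -> 0 < t -> U (x, t) = v x t) /\
  (forall p : R * R, punctured_quadrant p -> lim_in_quadrant U p (U p)).

(* Main.v *)
Require Import Defs.
From Stdlib Require Import Reals Lra FunctionalExtensionality.
From Coquelicot Require Import Coquelicot.
Open Scope R_scope.

(** For [x, t > 0] the solution is the classical heat potential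
      [D(u0) + B(g0)], with
      [D(u) = int_0^oo (K(x - y, t) - K(x + y, t)) u(y) dy] and
      [B(g) = int_0^t x / s * K(x, s) g(t - s) ds], [K] the heat kernel:
    after exchanging the integrals, all that remains of the contours is the
    Gaussian [int exp(i l z - l^2 t) dl] over the real line and over [Gamma]
    (the second one is rotated to the first by a straight homotopy of rays).
    Integrating by parts,
      [d/dx (D(u) + B(g)) = 2 K(x, t) (u(0) - g(0)) + N(u') - 2 S(g')] and
      [d/dx (N(v) - 2 S(h)) = D(v') + B(h)],
    where [N(v) = int_0^oo (K(x - y, t) + K(x + y, t)) v(y) dy] and
    [S(h) = int_0^t K(x, s) h(t - s) ds]: a compatibility condition is exactly
    what removes the singular term [K(x, t)], and two derivatives of the solution
    for [(u, g)] give the solution for [(u'', g')].  At the corner, [N] is an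
    average with total mass one, [S] is [O(sqrt t)], and the total masses of the
    kernels of [D] and [B] add up to one. *)

(** * Integrals over the half-line *)

(** The difficulty at the corner is that the masses of the separate kernels depend on x / (2 sqrt
    t), which has no limit there, so D(u) and B(g) do not converge separately in general. Each
    potential is therefore compared with the boundary value of its datum times its own mass, up to
    an error O(x + sqrt t) that is uniform in the ratio of x to sqrt t, and the masses are cancelled
    afterwards. Lipschitz bounds on the data give these errors, so every limit of order k uses the
    derivative of order k + 1 of the initial datum. On Gamma the factor exp(- l^2 t) has modulus
    one, and integrability comes from exp(i l x) alone. All formulas are thus proved in the open
    quadrant, and boundary points are reached at the very end through continuity of the extensions.
    Limits and integrals are exchanged by means of the single majorant C / (1 + x^2), whose tail
    beyond b is at most C / b. The data are replaced by functions that are C^N on the whole line, so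
    that calculus at 0 is two-sided. *)

Notation is_RInt_0oo f l :=
  (is_RInt_gen f (at_point 0) (Rbar_locally p_infty) l).

Ltac rring := apply Rminus_diag_uniq; ring.

Lemma is_RInt_0oo_of_lim {V : NormedModule R_AbsRing} (f I : R -> V) (l : V) :
  (forall b, 0 < b -> is_RInt f 0 b (I b)) ->
  filterlim I (Rbar_locally p_infty) (locally l) -> is_RInt_0oo f l.
Proof.
  intros HI Hl P HP.
  exists (fun a => a = 0) (fun b => 0 < b /\ P (I b)).
  - reflexivity.
  - apply filter_and; [exists 0; auto | exact (Hl P HP)].
  - simpl. intros a b -> [Hb HPb]. exists (I b). auto.
Qed.

Lemma is_RInt_0oo_lim (f : R -> R) (l : R) :
  is_RInt_0oo f l -> is_lim (RInt f 0) p_infty l.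
Proof.
  intros H P HP. destruct (H P HP) as [Q S HQ [M HM] HQS].
  exists M. intros b Hb.
  destruct (HQS 0 b HQ (HM b Hb)) as [y [Hy Py]]. simpl in Hy.
  rewrite (is_RInt_unique _ _ _ _ Hy). exact Py.
Qed.

Lemma is_RInt_0oo_unique (f : R -> R) (l l' : R) :
  is_RInt_0oo f l -> is_RInt_0oo f l' -> l = l'.
Proof.
  intros H H'. rewrite <- (is_RInt_gen_unique f l H).
  apply is_RInt_gen_unique. exact H'.
Qed.

Lemma ex_RInt_cont (f : R -> R) (a b : R) :
  (forall x, continuous f x) -> ex_RInt f a b.
Proof. intros H. apply (ex_RInt_continuous (V := R_CompleteNormedModule)). intros; apply H. Qed.

Lemma is_RInt_cont (f : R -> R) (a b : R) :
  (forall x, continuous f x) -> is_RInt f a b (RInt f a b).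
Proof. intros H. apply (RInt_correct (V := R_CompleteNormedModule)), ex_RInt_cont, H. Qed.

Lemma RInt_Chasles_R (f : R -> R) (a b c : R) :
  (forall x, continuous f x) -> RInt f a c = RInt f a b + RInt f b c.
Proof.
  intros H. symmetry.
  apply (RInt_Chasles (V := R_CompleteNormedModule) f a b c); apply ex_RInt_cont, H.
Qed.

Lemma is_derive_RInt_cont (f : R -> R) (a x : R) :
  (forall x, continuous f x) -> is_derive (RInt f a) x (f x).
Proof.
  intros H. apply (is_derive_RInt f (RInt f a) a).
  - exists (mkposreal 1 Rlt_0_1). intros y _. apply is_RInt_cont, H.
  - apply H.
Qed.

Lemma continuous_of_ex_derive (f : R -> R) (x : R) : ex_derive f x -> continuous f x.
Proof. apply (ex_derive_continuous f). Qed.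

Lemma continuous_of_derive (f : R -> R) (x l : R) : is_derive f x l -> continuous f x.
Proof. intros H. apply continuous_of_ex_derive. exists l; exact H. Qed.

Lemma is_lim_const_div (C : R) : is_lim (fun b => C / b) p_infty 0.
Proof.
  replace (Finite 0) with (Rbar_mult C 0) by (simpl; f_equal; ring).
  apply (is_lim_scal_l (fun b => / b) C p_infty 0).
  apply (is_lim_inv (fun b => b) p_infty p_infty); [apply is_lim_id | discriminate].
Qed.

(** The majorant is weakened to C / x^2, which has the elementary primitive - C / x. *)
Lemma abs_RInt_le_inv_sqr (f : R -> R) (C a b : R) :
  0 < a -> a <= b -> (forall x, continuous f x) ->
  (forall x, 0 <= x -> Rabs (f x) <= C / (1 + x ^ 2)) ->
  Rabs (RInt f a b) <= C / a.
Proof.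
  intros Ha Hab Hf HC.
  assert (HC0 : 0 <= C).
  { generalize (HC 0 (Rle_refl 0)) (Rabs_pos (f 0)).
    replace (C / (1 + 0 ^ 2)) with C by field. lra. }
  apply Rle_trans with (C / a - C / b).
  2:{ assert (0 <= C / b) by (apply Rdiv_le_0_compat; lra). lra. }
  apply (norm_RInt_le (V := R_CompleteNormedModule) f (fun x => C / x ^ 2) a b); [exact Hab | | | ].
  - intros x Hx. change (Rabs (f x) <= C / x ^ 2).
    apply Rle_trans with (1 := HC x ltac:(lra)).
    apply Rmult_le_compat_l; [exact HC0|].
    apply Rinv_le_contravar; [apply pow_lt; lra | lra].
  - apply is_RInt_cont, Hf.
  - replace (C / a - C / b) with (minus (- C / b) (- C / a)).
    2:{ unfold minus, plus, opp; simpl; field; lra. }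
    apply (is_RInt_derive (V := R_CompleteNormedModule) (fun x => - C / x) (fun x => C / x ^ 2)).
    + intros x. rewrite Rmin_left, Rmax_right by lra. intros Hx.
      auto_derive; [lra | field; lra].
    + intros x. rewrite Rmin_left, Rmax_right by lra. intros Hx.
      apply continuous_of_ex_derive. auto_derive. apply Rgt_not_eq.
      assert (0 < x) by lra. nra.
Qed.

(** Besides convergence, by the Cauchy criterion, this records an explicit rate. The rate depends on
    [C] alone, so it is uniform in any parameter of [f]; continuity in a parameter and Fubini's
    theorem rest on it. *)
Lemma RInt_0oo_dominated (f : R -> R) (C : R) :
  (forall x, continuous f x) ->
  (forall x, 0 <= x -> Rabs (f x) <= C / (1 + x ^ 2)) ->
  exists l, is_RInt_0oo f l /\ forall b, 0 < b -> Rabs (l - RInt f 0 b) <= C / b.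
Proof.
  intros Hf HC.
  assert (Hd : forall a b, 0 < a -> a <= b -> Rabs (RInt f 0 b - RInt f 0 a) <= C / a).
  { intros a b Ha Hb.
    replace (RInt f 0 b - RInt f 0 a) with (RInt f a b).
    - apply abs_RInt_le_inv_sqr; auto.
    - rewrite (RInt_Chasles_R f 0 a b Hf). rring. }
  assert (H : exists l : R, is_lim (RInt f 0) p_infty l).
  { apply (filterlim_locally_cauchy (U := R_CompleteNormedModule)
      (F := Rbar_locally p_infty) (RInt f 0)).
    intros eps.
    destruct (is_lim_const_div C (ball 0 eps) (locally_ball 0 eps)) as [M HM].
    exists (fun b => Rmax M 0 < b). split.
    { exists (Rmax M 0). auto. }
    assert (Hw : forall u v, Rmax M 0 < u -> Rmax M 0 < v -> u <= v ->
                   Rabs (RInt f 0 v - RInt f 0 u) < eps).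
    { intros u v Hu Hv Huv.
      assert (0 < u /\ M < u) as [Hu0 HuM].
      { generalize (Rmax_l M 0) (Rmax_r M 0). lra. }
      apply Rle_lt_trans with (1 := Hd u v Hu0 Huv).
      generalize (HM u HuM). intros Hb. change (Rabs (C / u - 0) < eps) in Hb.
      apply Rabs_def2 in Hb. lra. }
    intros u v Hu Hv. change (Rabs (RInt f 0 v - RInt f 0 u) < eps).
    destruct (Rle_lt_dec u v) as [Huv | Huv].
    - apply Hw; auto.
    - rewrite Rabs_minus_sym. apply Hw; auto; lra. }
  destruct H as [l Hl]. exists l. split.
  - apply is_RInt_0oo_of_lim with (I := RInt f 0); [|exact Hl].
    intros b _. apply is_RInt_cont, Hf.
  (* The tail bound is read off at a point beyond both [b] and the threshold [M], up to [eps]. *)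
  - intros b Hb.
    apply le_epsilon. intros eps Heps.
    destruct (Hl (ball l (mkposreal eps Heps)) (locally_ball l _)) as [M HM].
    assert (HM' := HM (Rmax M b + 1)). assert (Hd' := Hd b (Rmax M b + 1) Hb).
    generalize (Rmax_l M b) (Rmax_r M b). intros H1 H2.
    specialize (HM' ltac:(lra)). specialize (Hd' ltac:(lra)).
    change (Rabs (RInt f 0 (Rmax M b + 1) - l) < eps) in HM'.
    apply Rabs_def2 in HM'. apply Rabs_le_between in Hd'. apply Rabs_le. lra.
Qed.

(** * Continuity in a parameter and Fubini's theorem *)

Lemma continuity_2d_l (f : R -> R -> R) (x y : R) :
  continuity_2d_pt f x y -> continuous (fun u => f u y) x.
Proof.
  intros H. apply continuity_pt_filterlim. apply continuity_pt_locally.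
  intros eps. destruct (H eps) as [d Hd]. exists d. intros u Hu.
  apply Hd; [exact Hu|]. rewrite Rminus_diag, Rabs_R0. apply cond_pos.
Qed.

Lemma continuity_2d_r (f : R -> R -> R) (x y : R) :
  continuity_2d_pt f x y -> continuous (fun v => f x v) y.
Proof.
  intros H. apply continuity_pt_filterlim. apply continuity_pt_locally.
  intros eps. destruct (H eps) as [d Hd]. exists d. intros u Hu.
  apply Hd; [|exact Hu]. rewrite Rminus_diag, Rabs_R0. apply cond_pos.
Qed.

Lemma continuity_2d_swap (f : R -> R -> R) :
  (forall x y, continuity_2d_pt f x y) -> forall x y, continuity_2d_pt (fun u v => f v u) x y.
Proof.
  intros H x y eps. destruct (H y x eps) as [d Hd]. exists d. intros u v Hu Hv. apply Hd; assumption.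
Qed.

Lemma continuous_RInt_param (f : R -> R -> R) (a b y : R) :
  (forall x y, continuity_2d_pt f x y) ->
  continuous (fun y => RInt (fun x => f x y) a b) y.
Proof.
  intros H.
  assert (Hw : forall a b, a <= b -> continuous (fun y => RInt (fun x => f x y) a b) y).
  2:{ destruct (Rle_lt_dec a b) as [Hab | Hab].
    - apply Hw; exact Hab.
    - apply (continuous_ext (fun y => opp (RInt (fun x => f x y) b a))).
      { intros z. apply opp_RInt_swap. apply ex_RInt_cont.
        intros x. apply (continuity_2d_l f), H. }
      apply (continuous_opp (V := R_NormedModule)), Hw. lra. }
  clear a b. intros a b Hab. apply continuity_pt_filterlim. apply continuity_pt_locally. intros eps.
  (* The [+ 1] keeps the quotient meaningful when a = b. *)
  assert (He : 0 < eps / (b - a + 1)) by (apply Rdiv_lt_0_compat; [apply cond_pos | lra]).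
  destruct (uniform_continuity_2d_1d f a b y (fun x _ => H x y) (mkposreal _ He)) as [d Hd].
  exists d. intros z Hz.
  assert (Hc : forall z x, continuous (fun x => f x z) x).
  { intros z' x. apply (continuity_2d_l f), H. }
  change (Rabs (z - y) < d) in Hz. apply Rabs_def2 in Hz.
  replace (RInt (fun x => f x z) a b - RInt (fun x => f x y) a b)
    with (RInt (fun x => f x z - f x y) a b).
  2:{ apply (RInt_minus (V := R_CompleteNormedModule)); apply ex_RInt_cont; apply Hc. }
  apply Rle_lt_trans with ((b - a) * (eps / (b - a + 1))).
  - apply abs_RInt_le_const; [exact Hab | |].
    + apply ex_RInt_cont. intros x. apply (continuous_minus (V := R_NormedModule)); apply Hc.
    + intros x Hx. apply Rlt_le. apply (Hd x y x z); try lra.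
      rewrite Rminus_diag, Rabs_R0. apply cond_pos.
  - generalize (cond_pos eps). intros Hp.
    apply Rmult_lt_reg_r with (b - a + 1); [lra|].
    field_simplify; [nra | lra].
Qed.

(** As functions of the upper end of the x-interval, both iterated integrals vanish at [a] and have
    the same derivative, so their difference is constant. *)
Lemma RInt_swap_rectangle (f : R -> R -> R) (a b c d : R) :
  (forall x y, continuity_2d_pt f x y) ->
  RInt (fun y => RInt (fun x => f x y) a b) c d =
  RInt (fun x => RInt (fun y => f x y) c d) a b.
Proof.
  intros H.
  assert (Hc : forall z x, continuous (fun x => f x z) x).
  { intros z' x. apply (continuity_2d_l f), H. }
  assert (H' := continuity_2d_swap f H).
  assert (HD : forall X, is_derive (fun X => RInt (fun y => RInt (fun x => f x y) a X) c d
       - RInt (fun x => RInt (fun y => f x y) c d) a X) X 0).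
  { intros X.
    replace 0 with (RInt (fun y => Derive (fun X => RInt (fun x => f x y) a X) X) c d
      - RInt (fun y => f X y) c d).
    2:{ apply Rminus_diag_eq. apply RInt_ext. intros y _.
        apply is_derive_unique. apply (is_derive_RInt_cont (fun x => f x y)), Hc. }
    apply (is_derive_minus (V := R_NormedModule)).
    - apply (is_derive_RInt_param (fun X y => RInt (fun x => f x y) a X)).
      + exists (mkposreal 1 Rlt_0_1). intros u _ t _. exists (f u t).
        apply (is_derive_RInt_cont (fun x => f x t)), Hc.
      + intros t _. apply continuity_2d_pt_ext with (2 := H X t). intros u v. symmetry.
        apply is_derive_unique. apply (is_derive_RInt_cont (fun x => f x v)), Hc.
      + exists (mkposreal 1 Rlt_0_1). intros u _. apply ex_RInt_cont.
        intros y. apply continuous_RInt_param, H.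
    - apply (is_derive_RInt_cont (fun x => RInt (fun y => f x y) c d)).
      intros x. apply (continuous_RInt_param (fun y x => f x y)), H'. }
  assert (H0 : RInt (fun y => RInt (fun x => f x y) a a) c d
       - RInt (fun x => RInt (fun y => f x y) c d) a a = 0).
  { rewrite (RInt_point a). change zero with 0.
    rewrite (RInt_ext _ (fun _ => 0)) by (intros; apply (RInt_point (V := R_CompleteNormedModule))).
    rewrite RInt_const. unfold scal; simpl; unfold mult; simpl; ring. }
  apply Rminus_diag_uniq. rewrite <- H0.
  destruct (Rtotal_order a b) as [Hab | [-> | Hab]].
  - symmetry. apply (eq_is_derive (V := R_NormedModule) (fun X => RInt (fun y => RInt (fun x => f x y) a X) c d
       - RInt (fun x => RInt (fun y => f x y) c d) a X) a b); auto.
  - reflexivity.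
  - apply (eq_is_derive (V := R_NormedModule) (fun X => RInt (fun y => RInt (fun x => f x y) a X) c d
       - RInt (fun x => RInt (fun y => f x y) c d) a X) b a); auto.
Qed.

(** Splitting at 1, the segment [0,1] and the tail contribute at most [C] each. *)
Lemma RInt_0oo_abs_le (f : R -> R) (C l : R) :
  (forall x, continuous f x) ->
  (forall x, 0 <= x -> Rabs (f x) <= C / (1 + x ^ 2)) ->
  is_RInt_0oo f l -> Rabs l <= 2 * C.
Proof.
  intros Hf HC Hl.
  destruct (RInt_0oo_dominated f C Hf HC) as [l' [Hl' Hb]].
  rewrite (is_RInt_0oo_unique f l l' Hl Hl').
  specialize (Hb 1 Rlt_0_1).
  assert (H : Rabs (RInt f 0 1) <= (1 - 0) * C).
  { apply abs_RInt_le_const; [lra | apply ex_RInt_cont, Hf |].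
    intros x Hx. apply Rle_trans with (1 := HC x ltac:(lra)).
    assert (0 <= C).
    { generalize (HC 0 (Rle_refl 0)) (Rabs_pos (f 0)).
      replace (C / (1 + 0 ^ 2)) with C by field. lra. }
    rewrite <- (Rmult_1_r C) at 2. apply Rmult_le_compat_l; [assumption|].
    rewrite <- Rinv_1. apply Rinv_le_contravar; nra. }
  replace (C / 1) with C in Hb by field.
  apply Rabs_le_between in Hb. apply Rabs_le_between in H. apply Rabs_le. lra.
Qed.

(** The uniform tail bound makes [Phi] a uniform limit of the truncated integrals, which are
    continuous in the parameter. *)
Lemma RInt_0oo_param (f : R -> R -> R) (C : R) :
  (forall x y, continuity_2d_pt f x y) ->
  (forall x y, 0 <= x -> Rabs (f x y) <= C / (1 + x ^ 2)) ->
  exists Phi : R -> R,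
    (forall y, is_RInt_0oo (fun x => f x y) (Phi y)) /\
    (forall y, continuous Phi y) /\
    (forall y b, 0 < b -> Rabs (Phi y - RInt (fun x => f x y) 0 b) <= C / b).
Proof.
  intros Hf HC.
  assert (Hex : forall y, exists l, is_RInt_0oo (fun x => f x y) l /\
     forall b, 0 < b -> Rabs (l - RInt (fun x => f x y) 0 b) <= C / b).
  { intros y. apply RInt_0oo_dominated; [intros x; apply (continuity_2d_l f), Hf |].
    intros x Hx. apply HC, Hx. }
  set (Phi := fun y => RInt_gen (V := R_CompleteNormedModule) (fun x => f x y) (at_point 0) (Rbar_locally p_infty)).
  assert (HPhi : forall y, is_RInt_0oo (fun x => f x y) (Phi y) /\
     forall b, 0 < b -> Rabs (Phi y - RInt (fun x => f x y) 0 b) <= C / b).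
  { intros y. destruct (Hex y) as [l [Hl Hb]]. unfold Phi.
    rewrite (is_RInt_gen_unique (V := R_CompleteNormedModule) _ l Hl). auto. }
  exists Phi. split; [|split]; [intros y; apply HPhi | | intros y; apply HPhi].
  intros y. apply continuity_pt_filterlim, continuity_pt_locally. intros eps.
  destruct (is_lim_const_div C (ball 0 (pos_div_2 (pos_div_2 eps))) (locally_ball 0 _)) as [M HM].
  (* At this truncation each of the two tails costs at most eps / 4, which leaves eps / 2 for the
     truncated integral. *)
  set (b := Rmax M 0 + 1).
  assert (Hb : 0 < b) by (unfold b; generalize (Rmax_r M 0); lra).
  assert (HMb : Rabs (C / b - 0) < eps / 2 / 2).
  { apply (HM b). unfold b. generalize (Rmax_l M 0). lra. }
  assert (Hc := continuous_RInt_param f 0 b y Hf).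
  apply continuity_pt_filterlim in Hc. rewrite continuity_pt_locally in Hc.
  destruct (Hc (pos_div_2 eps)) as [d Hd]. exists d. intros z Hz. specialize (Hd z Hz).
  assert (H1 := proj2 (HPhi z) b Hb). assert (H2 := proj2 (HPhi y) b Hb).
  simpl in Hd. apply Rabs_def2 in HMb. apply Rabs_def2 in Hd.
  apply Rabs_le_between in H1. apply Rabs_le_between in H2. apply Rabs_def1; lra.
Qed.

(** Swapping on the rectangle up to [b] leaves the integral over [c,d] of the tails, at most (d - c)
    C / b. *)
Lemma Fubini_0oo_segment (f : R -> R -> R) (C c d : R) (Phi : R -> R) :
  c <= d ->
  (forall x y, continuity_2d_pt f x y) ->
  (forall x y, 0 <= x -> Rabs (f x y) <= C / (1 + x ^ 2)) ->
  (forall y, is_RInt_0oo (fun x => f x y) (Phi y)) ->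
  is_RInt_0oo (fun x => RInt (fun y => f x y) c d) (RInt Phi c d) /\
  (forall y, continuous Phi y).
Proof.
  intros Hcd Hf HC HPhi.
  destruct (RInt_0oo_param f C Hf HC) as [Phi' [HPhi' [Hcont Hbd]]].
  assert (E : Phi = Phi').
  { apply functional_extensionality. intros y. apply (is_RInt_0oo_unique (fun x => f x y)); auto. }
  rewrite <- E in *. split; [|exact Hcont].
  apply is_RInt_0oo_of_lim with (I := fun b => RInt (fun x => RInt (fun y => f x y) c d) 0 b).
  { intros b _. apply (is_RInt_cont (fun x => RInt (fun y => f x y) c d)).
    intros x. apply (continuous_RInt_param (fun y x => f x y)), continuity_2d_swap, Hf. }
  intros P [eps HP].
  destruct (is_lim_const_div ((d - c) * C) (ball 0 eps) (locally_ball 0 _)) as [M HM].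
  exists (Rmax M 0). intros b Hb.
  assert (HMb : M < b /\ 0 < b) by (generalize (Rmax_l M 0) (Rmax_r M 0); lra).
  specialize (HM b (proj1 HMb)). change (Rabs ((d - c) * C / b - 0) < eps) in HM.
  apply HP. rewrite <- (RInt_swap_rectangle f 0 b c d Hf).
  assert (Hc2 : forall y, continuous (fun y => RInt (fun x => f x y) 0 b) y).
  { intros y. apply continuous_RInt_param, Hf. }
  change (Rabs (RInt (fun y => RInt (fun x => f x y) 0 b) c d - RInt Phi c d) < eps).
  replace (RInt (fun y => RInt (fun x => f x y) 0 b) c d - RInt Phi c d)
    with (RInt (fun y => RInt (fun x => f x y) 0 b - Phi y) c d).
  2:{ apply (RInt_minus (V := R_CompleteNormedModule)); apply ex_RInt_cont; assumption. }
  apply Rle_lt_trans with ((d - c) * (C / b)).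
  - apply abs_RInt_le_const; [exact Hcd | |].
    + apply ex_RInt_cont. intros x. apply (continuous_minus (V := R_NormedModule)); auto.
    + intros y _. rewrite Rabs_minus_sym. apply Hbd, HMb.
  - apply Rabs_def2 in HM. unfold Rdiv in *. lra.
Qed.

(** The integral of [Psi] over [0,b] is, by the half-bounded case, the integral in y of the
    truncations of [Phi]. Each truncation misses [Phi y] by at most C / (b (1 + y^2)), and this
    error is itself integrable in y with total O(1 / b). *)
Lemma Fubini_0oo_0oo (f : R -> R -> R) (C : R) :
  (forall x y, continuity_2d_pt f x y) ->
  (forall x y, Rabs (f x y) <= C / (1 + x ^ 2) / (1 + y ^ 2)) ->
  exists (Phi Psi : R -> R) (l : R),
    (forall y, is_RInt_0oo (fun x => f x y) (Phi y)) /\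
    (forall x, is_RInt_0oo (fun y => f x y) (Psi x)) /\
    is_RInt_0oo Phi l /\ is_RInt_0oo Psi l.
Proof.
  intros Hf HC. assert (Hf' := continuity_2d_swap f Hf).
  assert (Hp : forall x, 0 < 1 + x ^ 2) by (intros x; nra).
  assert (HC0 : 0 <= C).
  { generalize (HC 0 0) (Rabs_pos (f 0 0)).
    replace (C / (1 + 0 ^ 2) / (1 + 0 ^ 2)) with C by field. lra. }
  assert (Hl1 : forall x, 0 <= / (1 + x ^ 2) <= 1).
  { intros x. split; [apply Rlt_le, Rinv_0_lt_compat, Hp|].
    rewrite <- Rinv_1. apply Rinv_le_contravar; nra. }
  assert (HC1 : forall x y, Rabs (f x y) <= C / (1 + x ^ 2)).
  { intros x y. apply Rle_trans with (1 := HC x y). unfold Rdiv.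
    generalize (Hl1 x) (Hl1 y); intros. assert (0 <= C * / (1 + x ^ 2)) by nra. nra. }
  assert (HC2 : forall x y, Rabs (f x y) <= C / (1 + y ^ 2) / (1 + x ^ 2)).
  { intros x y. replace (C / (1 + y ^ 2) / (1 + x ^ 2)) with (C / (1 + x ^ 2) / (1 + y ^ 2)); auto.
    field. split; apply Rgt_not_eq, Hp. }
  assert (HC3 : forall x y, Rabs (f x y) <= C / (1 + y ^ 2)).
  { intros x y. apply Rle_trans with (1 := HC2 x y). unfold Rdiv.
    generalize (Hl1 x) (Hl1 y); intros. assert (0 <= C * / (1 + y ^ 2)) by nra. nra. }
  destruct (RInt_0oo_param f C Hf (fun x y _ => HC1 x y)) as [Phi [HPhi [HPc HPb]]].
  destruct (RInt_0oo_param (fun y x => f x y) C Hf' (fun y x _ => HC3 x y)) as [Psi [HPsi [HPsc HPsb]]].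
  assert (HPhid : forall y, 0 <= y -> Rabs (Phi y) <= 2 * C / (1 + y ^ 2)).
  { intros y _. replace (2 * C / (1 + y ^ 2)) with (2 * (C / (1 + y ^ 2))) by (unfold Rdiv; ring).
    apply (RInt_0oo_abs_le (fun x => f x y)); auto.
    intros x. apply (continuity_2d_l f), Hf. }
  destruct (RInt_0oo_dominated Phi (2 * C) HPc HPhid) as [l [Hl _]].
  exists Phi, Psi, l. split; [|split; [|split]]; auto.
  apply is_RInt_0oo_of_lim with (I := RInt Psi 0).
  { intros b _. apply is_RInt_cont, HPsc. }
  intros P [eps HP].
  destruct (is_lim_const_div (2 * C) (ball 0 eps) (locally_ball 0 _)) as [M HM].
  exists (Rmax M 0). intros b Hb.
  assert (HMb : M < b /\ 0 < b) by (generalize (Rmax_l M 0) (Rmax_r M 0); lra).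
  specialize (HM b (proj1 HMb)). change (Rabs (2 * C / b - 0) < eps) in HM.
  apply HP. change (Rabs (RInt Psi 0 b - l) < eps).
  destruct (Fubini_0oo_segment (fun y x => f x y) C 0 b Psi ltac:(lra) Hf'
     (fun y x _ => HC3 x y) HPsi) as [H1 _].
  rewrite Rabs_minus_sym.
  apply Rle_lt_trans with (2 * (C / b)).
  - apply (RInt_0oo_abs_le (fun y => Phi y - RInt (fun x => f x y) 0 b)).
    + intros y. apply (continuous_minus (V := R_NormedModule)); [apply HPc |].
      apply continuous_RInt_param, Hf.
    + intros y _.
      replace (C / b / (1 + y ^ 2)) with (C / (1 + y ^ 2) / b).
      2:{ field. split; [lra | apply Rgt_not_eq, Hp]. }
      destruct (RInt_0oo_dominated (fun x => f x y) (C / (1 + y ^ 2))) as [l' [Hl' Hb']].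
      * intros x. apply (continuity_2d_l f), Hf.
      * intros x _. apply HC2.
      * rewrite (is_RInt_0oo_unique _ _ _ (HPhi y) Hl'). apply Hb', HMb.
    + apply (is_RInt_gen_minus (V := R_NormedModule)); assumption.
  - apply Rabs_def2 in HM. unfold Rdiv in *. lra.
Qed.

(** * Differentiation under the integral sign *)

Lemma is_lim_0_of_bound (f : R -> R) (C : R) :
  (forall x, 1 <= x -> Rabs (f x) <= C / x) -> is_lim f p_infty 0.
Proof.
  intros H.
  apply (is_lim_le_le_loc (fun x => - (C / x)) (fun x => C / x)).
  - exists 1. intros x Hx. apply Rabs_le_between, H. lra.
  - replace (Finite 0) with (Rbar_opp 0) by (simpl; f_equal; ring).
    apply is_lim_opp, is_lim_const_div.
  - apply is_lim_const_div.
Qed.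

Lemma is_RInt_0oo_derive (F f : R -> R) (L : R) :
  (forall x, is_derive F x (f x)) -> (forall x, continuous f x) ->
  is_lim F p_infty L -> is_RInt_0oo f (L - F 0).
Proof.
  intros HF Hf HL. apply is_RInt_0oo_of_lim with (I := fun b => F b - F 0).
  - intros b _. apply (is_RInt_derive (V := R_CompleteNormedModule)); auto.
  - apply (is_lim_minus' F (fun _ => F 0) p_infty L (F 0)); [exact HL | apply is_lim_const].
Qed.

(** Two uses of the mean value theorem give this without the usual factor 1/2. *)
Lemma taylor2_bound (F F1 F2 : R -> R) (x0 x M del : R) :
  Rabs (x - x0) < del ->
  (forall y, Rabs (y - x0) < del -> is_derive F y (F1 y)) ->
  (forall y, Rabs (y - x0) < del -> is_derive F1 y (F2 y)) ->
  (forall y, Rabs (y - x0) < del -> Rabs (F2 y) <= M) ->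
  Rabs (F x - F x0 - (x - x0) * F1 x0) <= (x - x0) ^ 2 * M.
Proof.
  intros Hx H1 H2 HM.
  assert (Hbtw : forall a, Rmin x0 x <= a <= Rmax x0 x -> Rabs (a - x0) <= Rabs (x - x0)).
  { intros a. unfold Rmin, Rmax, Rabs. destruct (Rle_dec x0 x); destruct (Rcase_abs (a - x0));
      destruct (Rcase_abs (x - x0)); lra. }
  assert (HB : forall a, Rmin x0 x <= a <= Rmax x0 x -> Rabs (a - x0) < del).
  { intros a Ha. apply Rle_lt_trans with (1 := Hbtw a Ha), Hx. }
  destruct (MVT_gen F x0 x F1) as [c [Hc Ec]].
  { intros y Hy. apply H1, HB. lra. }
  { intros y Hy. apply continuity_pt_filterlim, (continuous_of_derive F y (F1 y)), H1, HB, Hy. }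
  assert (Hbc : forall a, Rmin x0 c <= a <= Rmax x0 c -> Rmin x0 x <= a <= Rmax x0 x).
  { intros a. revert Hc. unfold Rmin, Rmax.
    destruct (Rle_dec x0 x); destruct (Rle_dec x0 c); lra. }
  destruct (MVT_gen F1 x0 c F2) as [e [He Ee]].
  { intros y Hy. apply H2, HB, Hbc. lra. }
  { intros y Hy. apply continuity_pt_filterlim, (continuous_of_derive F1 y (F2 y)), H2, HB, Hbc, Hy. }
  replace (F x - F x0 - (x - x0) * F1 x0) with ((F1 c - F1 x0) * (x - x0)) by lra.
  rewrite Ee, !Rabs_mult.
  assert (Ha := HM e (HB e (Hbc e He))). assert (Hb := Hbtw c Hc).
  replace ((x - x0) ^ 2) with (Rabs (x - x0) * Rabs (x - x0)) by (rewrite <- (pow2_abs (x - x0)); ring).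
  generalize (Rabs_pos (F2 e)) (Rabs_pos (c - x0)) (Rabs_pos (x - x0)). intros.
  rewrite (Rmult_comm _ M), <- Rmult_assoc. apply Rmult_le_compat_r; [assumption|].
  apply Rmult_le_compat; assumption.
Qed.

(** Integrating the second-order Taylor bound gives an error (x - x0)^2 d for the difference
    quotient before division, hence differentiability. The upper end is a filter so that the same
    statement serves the half-line and the segment [0,t]. *)
Lemma is_derive_RInt_gen_param (Fb : (R -> Prop) -> Prop) (FF : ProperFilter Fb)
  (f : R -> R -> R) (f1 D phi : R -> R) (x0 psi d del : R) :
  0 < del -> Fb (fun b => 0 <= b) ->
  (forall x, Rabs (x - x0) < del -> is_RInt_gen (f x) (at_point 0) Fb (phi x)) ->
  is_RInt_gen f1 (at_point 0) Fb psi -> is_RInt_gen D (at_point 0) Fb d ->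
  Fb (fun b => forall x y, Rabs (x - x0) < del -> 0 <= y <= b ->
     Rabs (f x y - f x0 y - (x - x0) * f1 y) <= (x - x0) ^ 2 * D y) ->
  is_derive phi x0 psi.
Proof.
  intros Hdel HFb Hf Hf1 HD HT.
  assert (Hb : forall x, Rabs (x - x0) < del ->
     Rabs (phi x - phi x0 - (x - x0) * psi) <= (x - x0) ^ 2 * d).
  { intros x Hx.
    apply (RInt_gen_norm (V := R_CompleteNormedModule) (Fa := at_point 0) (Fb := Fb)
       (fun y => f x y - f x0 y - (x - x0) * f1 y) (fun y => (x - x0) ^ 2 * D y)).
    - exists (fun a => a = 0) (fun b => 0 <= b); [reflexivity | exact HFb |].
      simpl. intros a b -> Hb. exact Hb.
    - eexists (fun a => a = 0) _; [reflexivity | exact HT |].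
      simpl. intros a b -> Hb y Hy. apply Hb; assumption.
    - apply (is_RInt_gen_minus (V := R_NormedModule) (fun y => f x y - f x0 y)).
      + apply (is_RInt_gen_minus (V := R_NormedModule) (f x) (f x0)); apply Hf; auto.
        rewrite Rminus_diag, Rabs_R0; exact Hdel.
      + apply (is_RInt_gen_scal (V := R_NormedModule) f1), Hf1.
    - apply (is_RInt_gen_scal (V := R_NormedModule) D), HD. }
  apply is_derive_Reals. intros eps Heps.
  assert (Hdl : 0 < Rmin del (eps / (Rabs d + 1))).
  { apply Rmin_pos; [exact Hdel|]. apply Rdiv_lt_0_compat; [exact Heps|].
    generalize (Rabs_pos d); lra. }
  exists (mkposreal _ Hdl). simpl. intros h Hh Hhd.
  assert (Hh1 := Rlt_le_trans _ _ _ Hhd (Rmin_l _ _)).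
  assert (Hh2 := Rlt_le_trans _ _ _ Hhd (Rmin_r _ _)).
  assert (HB := Hb (x0 + h)). replace (x0 + h - x0) with h in HB by ring.
  specialize (HB Hh1).
  replace ((phi (x0 + h) - phi x0) / h - psi) with ((phi (x0 + h) - phi x0 - h * psi) / h)
    by (field; exact Hh).
  unfold Rdiv. rewrite Rabs_mult, Rabs_inv.
  assert (Hhp := Rabs_pos_lt h Hh). assert (Hdp := Rabs_pos d).
  apply Rle_lt_trans with (Rabs h * d).
  - apply Rmult_le_reg_r with (Rabs h); [exact Hhp|].
    rewrite Rmult_assoc, Rinv_l, Rmult_1_r by lra.
    replace (Rabs h * d * Rabs h) with (h ^ 2 * d); [exact HB|].
    rewrite <- (pow2_abs h). ring.
  - apply Rle_lt_trans with (Rabs h * (Rabs d + 1)).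
    + apply Rmult_le_compat_l; [lra | generalize (Rle_abs d); lra].
    + apply Rlt_le_trans with (eps / (Rabs d + 1) * (Rabs d + 1)).
      * apply Rmult_lt_compat_r; lra.
      * right. field. lra.
Qed.

(** * Gaussian integrals *)

Lemma Derive_eta (f : R -> R) (x l : R) :
  is_derive f x l -> Derive (fun y : R => f y) x = l.
Proof. apply is_derive_unique. Qed.

(** The unnormalised error function, sqrt(pi) / 2 times erf. *)
Definition gauss_prim (x : R) : R := RInt (fun w => exp (- w ^ 2)) 0 x.

Ltac cont := apply continuous_of_ex_derive; auto_derive; auto.

Lemma is_derive_gauss_prim (x : R) : is_derive gauss_prim x (exp (- x ^ 2)).
Proof. apply (is_derive_RInt_cont (fun w => exp (- w ^ 2))). intros y. cont. Qed.

Lemma gauss_prim_0 : gauss_prim 0 = 0.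
Proof. apply (RInt_point (V := R_CompleteNormedModule)). Qed.

Lemma gauss_prim_nonneg (x : R) : 0 <= x -> 0 <= gauss_prim x.
Proof.
  intros Hx. apply RInt_ge_0; [exact Hx | |].
  - apply ex_RInt_cont. intros y. cont.
  - intros y _. apply Rlt_le, exp_pos.
Qed.

Lemma gauss_prim_opp (x : R) : gauss_prim (- x) = - gauss_prim x.
Proof.
  assert (HD : forall y, is_derive (fun y => gauss_prim (- y) + gauss_prim y) y 0).
  { intros y. assert (H1 := is_derive_gauss_prim y). assert (H2 := is_derive_gauss_prim (- y)).
    auto_derive.
    - split; [eexists; exact H2 | split; [eexists; exact H1 | exact I]].
    - rewrite (Derive_eta _ _ _ H1), (Derive_eta _ _ _ H2).
      replace ((- y) ^ 2) with (y ^ 2) by ring. ring. }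
  enough (gauss_prim (- x) + gauss_prim x = 0) by lra.
  replace 0 with (gauss_prim (- 0) + gauss_prim 0) by (rewrite Ropp_0, gauss_prim_0; ring).
  destruct (Rtotal_order 0 x) as [Hx | [<- | Hx]].
  - symmetry. apply (eq_is_derive (V := R_NormedModule) (fun y => gauss_prim (- y) + gauss_prim y)); auto.
  - reflexivity.
  - apply (eq_is_derive (V := R_NormedModule) (fun y => gauss_prim (- y) + gauss_prim y)); auto.
Qed.

Lemma gauss_prim_scale (x : R) :
  RInt (fun s => x * exp (- (x ^ 2 * s ^ 2))) 0 1 = gauss_prim x.
Proof.
  assert (H : is_RInt (fun s => x * exp (- (x ^ 2 * s ^ 2))) 0 1 (minus (gauss_prim (x * 1)) (gauss_prim (x * 0)))).
  { apply (is_RInt_derive (V := R_CompleteNormedModule) (fun s => gauss_prim (x * s))).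
    - intros s _. assert (H1 := is_derive_gauss_prim (x * s)).
      auto_derive; [eexists; exact H1|].
      rewrite (Derive_eta _ _ _ H1). rewrite Rpow_mult_distr. ring.
    - intros s _. cont. }
  rewrite (is_RInt_unique _ _ _ _ H). unfold minus, plus, opp; simpl.
  rewrite Rmult_1_r, Rmult_0_r, gauss_prim_0. ring.
Qed.

(* The classical identity: both summands have opposite derivatives. *)
Lemma gauss_prim_sqr (x : R) : 0 <= x ->
  gauss_prim x ^ 2 + RInt (fun s => exp (- (x ^ 2 * (1 + s ^ 2))) / (1 + s ^ 2)) 0 1 = PI / 4.
Proof.
  intros Hx.
  assert (Hs : forall s, 1 + s ^ 2 <> 0) by (intros s; nra).
  set (A := fun x => gauss_prim x ^ 2 +
     RInt (fun s => exp (- (x ^ 2 * (1 + s ^ 2))) / (1 + s ^ 2)) 0 1).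
  assert (HD : forall y s, is_derive (fun x => exp (- (x ^ 2 * (1 + s ^ 2))) / (1 + s ^ 2)) y
             (- (2 * exp (- y ^ 2)) * (y * exp (- (y ^ 2 * s ^ 2))))).
  { intros y s. auto_derive; [auto|].
    replace (- (y * (y * 1) * (1 + s * (s * 1)))) with (- y ^ 2 + - (y ^ 2 * s ^ 2)) by ring.
    rewrite exp_plus. field; nra. }
  assert (HA : forall y, is_derive A y 0).
  { intros y. assert (H1 := is_derive_gauss_prim y).
    replace 0 with (2 * gauss_prim y * exp (- y ^ 2) +
       RInt (fun s => Derive (fun x => exp (- (x ^ 2 * (1 + s ^ 2))) / (1 + s ^ 2)) y) 0 1).
    2:{ rewrite (RInt_ext _ (fun s => scal (- (2 * exp (- y ^ 2))) (y * exp (- (y ^ 2 * s ^ 2))))).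
        2:{ intros s _. apply is_derive_unique, HD. }
        rewrite (RInt_scal (V := R_CompleteNormedModule)).
        2:{ apply ex_RInt_cont. intros s. cont. }
        rewrite gauss_prim_scale. unfold scal; simpl; unfold mult; simpl. ring. }
    apply (is_derive_plus (V := R_NormedModule)).
    - auto_derive; [eexists; exact H1|].
      rewrite (Derive_eta _ _ _ H1). ring.
    - apply is_derive_RInt_param.
      + exists (mkposreal 1 Rlt_0_1). intros z _ s _. eexists. apply HD.
      + intros s _.
        apply continuity_2d_pt_ext with (fun y s => - (2 * exp (- y ^ 2)) * (y * exp (- (y ^ 2 * s ^ 2)))).
        { intros u v. symmetry. apply is_derive_unique, HD. }
        apply continuity_2d_pt_filterlim.
        apply (continuous_mult (K := R_AbsRing)
           (fun z : R * R => - (2 * exp (- fst z ^ 2)))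
           (fun z : R * R => fst z * exp (- (fst z ^ 2 * snd z ^ 2)))).
        * apply (continuous_comp fst (fun u => - (2 * exp (- u ^ 2)))); [apply continuous_fst | cont].
        * apply (continuous_mult (K := R_AbsRing) (fun z : R * R => fst z)); [apply continuous_fst|].
          apply (continuous_comp (fun z : R * R => fst z ^ 2 * snd z ^ 2) (fun u => exp (- u))); [|cont].
          apply (continuous_mult (K := R_AbsRing) (fun z : R * R => fst z ^ 2)).
          -- apply (continuous_comp fst (fun u => u ^ 2)); [apply continuous_fst | cont].
          -- apply (continuous_comp snd (fun u => u ^ 2)); [apply continuous_snd | cont].
      + exists (mkposreal 1 Rlt_0_1). intros z _. apply ex_RInt_cont. intros s. cont. nra.
  }
  change (A x = PI / 4).
  (* At 0 the remaining integral is atan 1, which is the source of pi / 4. *)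
  assert (H0 : A 0 = PI / 4).
  { unfold A. rewrite gauss_prim_0.
    assert (H : is_RInt (fun s => exp (- (0 ^ 2 * (1 + s ^ 2))) / (1 + s ^ 2)) 0 1 (minus (atan 1) (atan 0))).
    { apply (is_RInt_derive (V := R_CompleteNormedModule) atan).
      - intros s _. replace (- (0 ^ 2 * (1 + s ^ 2))) with 0 by ring. rewrite exp_0.
        replace (1 / (1 + s ^ 2)) with (/ (1 + s²)) by (unfold Rsqr; field; nra).
        apply is_derive_atan.
      - intros s _. cont. nra. }
    rewrite (is_RInt_unique _ _ _ _ H). unfold minus, plus, opp; simpl.
    rewrite atan_0, atan_1. ring. }
  rewrite <- H0. destruct (Rle_lt_or_eq_dec 0 x Hx) as [Hx' | <-]; [|reflexivity].
  symmetry. apply (eq_is_derive (V := R_NormedModule) A); auto.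
Qed.

Lemma exp_neg_le_inv (u : R) : 0 <= u -> exp (- u) <= / (1 + u).
Proof.
  intros Hu. rewrite exp_Ropp. apply Rinv_le_contravar; [lra|].
  destruct (Req_dec u 0) as [-> | H]; [rewrite exp_0; lra|].
  apply Rlt_le, exp_ineq1. exact H.
Qed.

(** In [gauss_prim_sqr] the integral term is O(1 / x), so the square tends to pi / 4, and the sign
    of [gauss_prim] selects the root. *)
Lemma is_lim_gauss_prim : is_lim gauss_prim p_infty (sqrt PI / 2).
Proof.
  assert (H : is_lim (fun x => gauss_prim x ^ 2) p_infty (PI / 4)).
  { apply (is_lim_ext_loc (fun x => PI / 4 -
       RInt (fun s => exp (- (x ^ 2 * (1 + s ^ 2))) / (1 + s ^ 2)) 0 1)).
    { exists 0. intros x Hx. rewrite <- (gauss_prim_sqr x) by lra. ring. }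
    replace (Finite (PI / 4)) with (Finite (PI / 4 - 0)) by (f_equal; ring).
    apply (is_lim_minus' (fun _ => PI / 4) _ p_infty (PI / 4) 0); [apply is_lim_const|].
    apply (is_lim_0_of_bound _ 1). intros x Hx.
    replace (1 / x) with ((1 - 0) * (1 / x)) by ring.
    apply abs_RInt_le_const; [lra | |].
    { apply ex_RInt_cont. intros s. cont. nra. }
    intros s Hs.
    assert (Hs1 : 1 <= 1 + s ^ 2) by nra.
    rewrite Rabs_pos_eq.
    2:{ apply Rdiv_le_0_compat; [apply Rlt_le, exp_pos | lra]. }
    apply Rle_trans with (exp (- (x ^ 2 * (1 + s ^ 2)))).
    { rewrite <- (Rdiv_1_r (exp _)) at 2. apply Rmult_le_compat_l; [apply Rlt_le, exp_pos|].
      apply Rinv_le_contravar; lra. }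
    apply Rle_trans with (1 := exp_neg_le_inv (x ^ 2 * (1 + s ^ 2)) ltac:(nra)).
    unfold Rdiv. rewrite Rmult_1_l. apply Rinv_le_contravar; nra. }
  assert (E : sqrt PI / 2 = sqrt (PI / 4)).
  { rewrite sqrt_div_alt by lra. replace 4 with (2 ^ 2) by ring. rewrite sqrt_pow2; lra. }
  rewrite E.
  apply (is_lim_ext_loc (fun x => sqrt (gauss_prim x ^ 2))).
  { exists 0. intros x Hx. apply sqrt_pow2, gauss_prim_nonneg. lra. }
  apply (is_lim_comp_continuous (fun x => gauss_prim x ^ 2) sqrt p_infty (PI / 4) H).
  apply continuity_pt_filterlim, continuity_pt_sqrt. generalize PI_RGT_0; lra.
Qed.

(** * Oscillatory Gaussian integrals *)

Definition heat (z t : R) : R := exp (- (z ^ 2 / (4 * t))) / sqrt (4 * PI * t).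

Lemma exp_INR_mult (n : nat) (x : R) : exp (INR n * x) = exp x ^ n.
Proof.
  induction n as [|n IH]; [simpl; rewrite Rmult_0_l; apply exp_0|].
  rewrite S_INR, Rmult_plus_distr_r, Rmult_1_l, exp_plus, IH. simpl. ring.
Qed.

(** The case n = 1 applied to u / n and raised to the power n. It is the only source of decay of
    exponentials used below, with explicit constants. *)
Lemma exp_neg_le_inv_pow (u : R) (n : nat) :
  (0 < n)%nat -> 0 <= u -> exp (- u) <= / (1 + u / INR n) ^ n.
Proof.
  intros Hn Hu. assert (Hn' : 0 < INR n) by (apply lt_0_INR; exact Hn).
  assert (H0 : 0 <= u / INR n) by (apply Rdiv_le_0_compat; assumption).
  replace (- u) with (INR n * - (u / INR n)) by (field; lra).
  rewrite exp_INR_mult, <- pow_inv. apply pow_incr. split; [apply Rlt_le, exp_pos|].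
  apply exp_neg_le_inv, H0.
Qed.

(** The choice m = min(1, t / 3) gives m (1 + r^2) <= 1 + t r^2 / 3. The third power leaves an
    integrable majorant after multiplication by r^2. *)
Lemma exp_neg_sqr_dominated (t : R) : 0 < t ->
  exists C, 0 < C /\ forall r, exp (- (t * r ^ 2)) <= C / (1 + r ^ 2) ^ 3.
Proof.
  intros Ht. set (m := Rmin 1 (t / 3)).
  assert (Hm : 0 < m) by (apply Rmin_pos; lra).
  assert (Hm1 := Rmin_l 1 (t / 3)). assert (Hm2 := Rmin_r 1 (t / 3)). fold m in Hm1, Hm2.
  exists (/ m ^ 3). split; [apply Rinv_0_lt_compat, pow_lt, Hm|].
  intros r. assert (Hr : 0 <= r ^ 2) by nra.
  apply Rle_trans with (1 := exp_neg_le_inv_pow (t * r ^ 2) 3 ltac:(auto) ltac:(nra)).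
  unfold Rdiv. rewrite <- Rinv_mult, <- Rpow_mult_distr.
  apply Rinv_le_contravar; [apply pow_lt; nra|].
  apply pow_incr. simpl INR. split; [nra|]. nra.
Qed.

(** Here m (1 + r) <= 1 + c r / 4, and (1 + r)^2 >= 1 + r^2 turns the fourth power of 1 + r into the
    square of 1 + r^2. One spare power absorbs the factor r of the boundary term. *)
Lemma exp_neg_dominated (c : R) : 0 < c ->
  exists C, 0 < C /\ forall r, 0 <= r -> exp (- (c * r)) <= C / (1 + r ^ 2) ^ 2.
Proof.
  intros Hc. set (m := Rmin 1 (c / 4)).
  assert (Hm : 0 < m) by (apply Rmin_pos; lra).
  assert (Hm1 := Rmin_l 1 (c / 4)). assert (Hm2 := Rmin_r 1 (c / 4)). fold m in Hm1, Hm2.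
  exists (/ m ^ 4). split; [apply Rinv_0_lt_compat, pow_lt, Hm|].
  intros r Hr.
  apply Rle_trans with (1 := exp_neg_le_inv_pow (c * r) 4 ltac:(auto) ltac:(nra)).
  assert (H1 : m * (1 + r) <= 1 + c * r / INR 4) by (simpl INR; nra).
  assert (H2 : 0 < m * (1 + r)) by nra.
  apply Rle_trans with (/ (m * (1 + r)) ^ 4).
  { apply Rinv_le_contravar; [apply pow_lt; exact H2|]. apply pow_incr; lra. }
  unfold Rdiv. rewrite <- Rinv_mult, Rpow_mult_distr.
  apply Rinv_le_contravar.
  - apply Rmult_lt_0_compat; apply pow_lt; nra.
  - apply Rmult_le_compat_l; [apply Rlt_le, pow_lt, Hm|].
    replace ((1 + r) ^ 4) with (((1 + r) ^ 2) ^ 2) by ring.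
    apply pow_incr. nra.
Qed.

Lemma div_pow_succ_mult_le (C x p : R) (n : nat) :
  0 <= C -> 0 <= p <= 1 + x ^ 2 -> p * (C / (1 + x ^ 2) ^ S n) <= C / (1 + x ^ 2) ^ n.
Proof.
  intros HC Hp. assert (H1 : 0 < 1 + x ^ 2) by nra.
  assert (H2 : 0 < (1 + x ^ 2) ^ n) by (apply pow_lt, H1).
  apply Rle_trans with ((1 + x ^ 2) * (C / (1 + x ^ 2) ^ S n)).
  - apply Rmult_le_compat_r; [|apply Hp].
    apply Rdiv_le_0_compat; [exact HC | apply pow_lt, H1].
  - right. simpl pow. field. split; [apply Rgt_not_eq, H2 | simpl in H1; lra].
Qed.

Lemma div_pow_succ_le (C x : R) (n : nat) :
  0 <= C -> C / (1 + x ^ 2) ^ S n <= C / (1 + x ^ 2) ^ n.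
Proof.
  intros HC. rewrite <- (Rmult_1_l (C / (1 + x ^ 2) ^ S n)).
  apply div_pow_succ_mult_le; [exact HC | nra].
Qed.

Lemma Rabs_cos_le_1 (x : R) : Rabs (cos x) <= 1.
Proof. apply Rabs_le. generalize (COS_bound x). lra. Qed.

Lemma Rabs_sin_le_1 (x : R) : Rabs (sin x) <= 1.
Proof. apply Rabs_le. generalize (SIN_bound x). lra. Qed.

(** By the substitution w = sqrt t * r. The value is written as pi times the kernel at z = 0, the
    initial value for the differential equation in z that follows. *)
Lemma RInt_0oo_gauss (t : R) : 0 < t ->
  is_RInt_0oo (fun r => exp (- (t * r ^ 2))) (PI / sqrt (4 * PI * t)).
Proof.
  intros Ht. assert (Hs : 0 < sqrt t) by (apply sqrt_lt_R0, Ht).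
  assert (HP := PI_RGT_0). assert (HsP : 0 < sqrt PI) by (apply sqrt_lt_R0, HP).
  replace (PI / sqrt (4 * PI * t)) with (sqrt PI / 2 / sqrt t - gauss_prim (sqrt t * 0) / sqrt t).
  2:{ rewrite Rmult_0_r, gauss_prim_0.
      rewrite sqrt_mult, sqrt_mult by lra. replace 4 with (2 ^ 2) at 1 by ring.
      rewrite sqrt_pow2 by lra. rewrite <- (sqrt_sqrt PI) at 2 by lra. field. lra. }
  apply (is_RInt_0oo_derive (fun r => gauss_prim (sqrt t * r) / sqrt t)).
  - intros r. assert (H1 := is_derive_gauss_prim (sqrt t * r)).
    auto_derive; [eexists; exact H1|].
    rewrite (Derive_eta _ _ _ H1).
    rewrite Rpow_mult_distr, pow2_sqrt by lra. field. lra.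
  - intros r. cont.
  - apply (is_lim_scal_r (fun r => gauss_prim (sqrt t * r)) (/ sqrt t) p_infty (sqrt PI / 2)).
    intros P HP'. destruct (is_lim_gauss_prim P HP') as [M HM].
    exists (M / sqrt t). intros r Hr. apply HM.
    apply Rmult_lt_reg_r with (/ sqrt t); [apply Rinv_0_lt_compat, Hs|].
    replace (sqrt t * r * / sqrt t) with r by (field; lra). exact Hr.
Qed.

(* Both sides, as functions of [z], solve [phi' = - z / (2 t) * phi]. *)
Lemma RInt_0oo_gauss_cos (t z : R) : 0 < t ->
  is_RInt_0oo (fun r => exp (- (t * r ^ 2)) * cos (r * z)) (PI * heat z t).
Proof.
  intros Ht. destruct (exp_neg_sqr_dominated t Ht) as [C [HC0 HC]].
  assert (HC2 : forall r, r ^ 2 * exp (- (t * r ^ 2)) <= C / (1 + r ^ 2)).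
  { intros r. replace (C / (1 + r ^ 2)) with (C / (1 + r ^ 2) ^ 1) by (rewrite pow_1; reflexivity).
    apply Rle_trans with (r ^ 2 * (C / (1 + r ^ 2) ^ 3)).
    { apply Rmult_le_compat_l; [nra | apply HC]. }
    apply Rle_trans with (C / (1 + r ^ 2) ^ 2).
    { apply div_pow_succ_mult_le; [lra | nra]. }
    apply div_pow_succ_le; lra. }
  assert (HC1 : forall r, exp (- (t * r ^ 2)) <= C / (1 + r ^ 2)).
  { intros r. replace (C / (1 + r ^ 2)) with (C / (1 + r ^ 2) ^ 1) by (rewrite pow_1; reflexivity).
    apply Rle_trans with (1 := HC r).
    apply Rle_trans with (C / (1 + r ^ 2) ^ 2); apply div_pow_succ_le; lra. }
  assert (Hdom : forall p c r, Rabs c <= 1 -> Rabs p * exp (- (t * r ^ 2)) <= C / (1 + r ^ 2) ->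
     Rabs (p * exp (- (t * r ^ 2)) * c) <= C / (1 + r ^ 2)).
  { intros p c r Hc Hp. rewrite !Rabs_mult, (Rabs_pos_eq (exp _)) by apply Rlt_le, exp_pos.
    apply Rle_trans with (2 := Hp). rewrite <- (Rmult_1_r (Rabs p * _)) at 2.
    apply Rmult_le_compat_l; [|exact Hc].
    apply Rmult_le_pos; [apply Rabs_pos | apply Rlt_le, exp_pos]. }
  assert (Hr1 : forall r, Rabs r * exp (- (t * r ^ 2)) <= 2 * C / (1 + r ^ 2)).
  { intros r. assert (Rabs r <= 1 + r ^ 2) by (apply Rabs_le; nra).
    generalize (HC1 r) (HC2 r) (exp_pos (- (t * r ^ 2))); intros.
    replace (2 * C / (1 + r ^ 2)) with (C / (1 + r ^ 2) + C / (1 + r ^ 2)) by (unfold Rdiv; ring).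
    nra. }
  assert (Hex : forall z, exists l, is_RInt_0oo (fun r => exp (- (t * r ^ 2)) * cos (r * z)) l).
  { intros z'. destruct (RInt_0oo_dominated (fun r => exp (- (t * r ^ 2)) * cos (r * z')) C) as [l [Hl _]].
    - intros r. cont.
    - intros r _. rewrite <- (Rmult_1_l (exp _)). apply Hdom; [apply Rabs_cos_le_1|].
      rewrite Rabs_R1, Rmult_1_l. apply HC1.
    - exists l; exact Hl. }
  set (phi := fun z => RInt_gen (V := R_CompleteNormedModule)
     (fun r => exp (- (t * r ^ 2)) * cos (r * z)) (at_point 0) (Rbar_locally p_infty)).
  assert (Hphi : forall z, is_RInt_0oo (fun r => exp (- (t * r ^ 2)) * cos (r * z)) (phi z)).
  { intros z'. destruct (Hex z') as [l Hl]. unfold phi.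
    rewrite (is_RInt_gen_unique (V := R_CompleteNormedModule) _ l Hl). exact Hl. }
  assert (HD : forall z, is_derive phi z (- (z / (2 * t)) * phi z)).
  { intros z0.
    destruct (RInt_0oo_dominated (fun r => - r * exp (- (t * r ^ 2)) * sin (r * z0)) (2 * C)) as [psi [Hpsi _]].
    { intros r. cont. }
    { intros r _. rewrite !Rabs_mult, Rabs_Ropp, <- Rabs_mult.
      apply Rle_trans with (2 := Hr1 r). rewrite !Rabs_mult.
      rewrite (Rabs_pos_eq (exp _)) by apply Rlt_le, exp_pos.
      rewrite <- (Rmult_1_r (Rabs r * _)) at 2. apply Rmult_le_compat_l; [|apply Rabs_sin_le_1].
      apply Rmult_le_pos; [apply Rabs_pos | apply Rlt_le, exp_pos]. }
    destruct (RInt_0oo_dominated (fun r => r ^ 2 * exp (- (t * r ^ 2))) C) as [d [Hd _]].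
    { intros r. cont. }
    { intros r _. rewrite Rabs_pos_eq; [apply HC2|].
      apply Rmult_le_pos; [nra | apply Rlt_le, exp_pos]. }
    replace (- (z0 / (2 * t)) * phi z0) with psi.
    { apply (is_derive_RInt_gen_param (Rbar_locally p_infty) _
        (fun z r => exp (- (t * r ^ 2)) * cos (r * z)) (fun r => - r * exp (- (t * r ^ 2)) * sin (r * z0))
        (fun r => r ^ 2 * exp (- (t * r ^ 2))) phi z0 psi d 1).
      - lra.
      - exists 0. intros; lra.
      - intros; apply Hphi.
      - exact Hpsi.
      - exact Hd.
      - exists 0. intros b _ x r Hx _.
        apply (taylor2_bound (fun z => exp (- (t * r ^ 2)) * cos (r * z))
          (fun z => - r * exp (- (t * r ^ 2)) * sin (r * z))
          (fun z => - r ^ 2 * exp (- (t * r ^ 2)) * cos (r * z)) z0 x _ 1 Hx).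
        + intros y _. auto_derive; [auto | unfold Rminus; simpl; ring].
        + intros y _. auto_derive; [auto | unfold Rminus; simpl; ring].
        + intros y _. rewrite !Rabs_mult, Rabs_Ropp, (Rabs_pos_eq (exp _)) by apply Rlt_le, exp_pos.
          rewrite (Rabs_pos_eq (r ^ 2)) by nra.
          rewrite <- (Rmult_1_r (r ^ 2 * _)) at 2. apply Rmult_le_compat_l; [|apply Rabs_cos_le_1].
          apply Rmult_le_pos; [nra | apply Rlt_le, exp_pos]. }
    (* The integrand is the exact r-derivative of sin(r z0) exp(- t r^2) / (2 t), which vanishes at
       0 and at infinity. This is the differential equation psi = - z0 / (2 t) * phi z0. *)
    assert (HI : is_RInt_0oo (fun r => z0 / (2 * t) * (exp (- (t * r ^ 2)) * cos (r * z0)) + - r * exp (- (t * r ^ 2)) * sin (r * z0))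
       (0 - sin (0 * z0) * exp (- (t * 0 ^ 2)) / (2 * t))).
    { apply (is_RInt_0oo_derive (fun r => sin (r * z0) * exp (- (t * r ^ 2)) / (2 * t))).
      - intros r. auto_derive; [auto|]. simpl. field. lra.
      - intros r. cont.
      - apply (is_lim_0_of_bound _ (C / (2 * t))). intros r Hr.
        unfold Rdiv. rewrite !Rabs_mult, (Rabs_pos_eq (exp _)) by apply Rlt_le, exp_pos.
        assert (Hi : 0 < / (2 * t)) by (apply Rinv_0_lt_compat; lra).
        rewrite (Rabs_pos_eq (/ _)) by lra.
        rewrite (Rmult_assoc C), (Rmult_comm (/ (2 * t))), <- Rmult_assoc.
        apply Rmult_le_compat_r; [lra|].
        apply Rle_trans with (1 * (C / (1 + r ^ 2))).
        + apply Rmult_le_compat; [apply Rabs_pos | apply Rlt_le, exp_pos | apply Rabs_sin_le_1 | apply HC1].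
        + rewrite Rmult_1_l. apply Rmult_le_compat_l; [lra|].
          apply Rinv_le_contravar; nra. }
    assert (HI2 := is_RInt_gen_plus (V := R_NormedModule) _ _ _ _
       (is_RInt_gen_scal (V := R_NormedModule) _ (z0 / (2 * t)) _ (Hphi z0)) Hpsi).
    assert (E := is_RInt_0oo_unique _ _ _ HI HI2).
    rewrite Rmult_0_l, sin_0 in E.
    change (0 - 0 * exp (- (t * 0 ^ 2)) / (2 * t) = z0 / (2 * t) * phi z0 + psi) in E.
    replace (0 - 0 * exp (- (t * 0 ^ 2)) / (2 * t)) with 0 in E by (unfold Rdiv; ring). lra. }
  (* The equation is solved by its integrating factor, so that the value at z = 0 determines
     [phi]. *)
  assert (HD2 : forall z, is_derive (fun z => phi z * exp (z ^ 2 / (4 * t))) z 0).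
  { intros z'. assert (H1 := HD z'). auto_derive; [eexists; exact H1|].
    rewrite (Derive_eta _ _ _ H1). field. lra. }
  assert (H0 : phi 0 = PI / sqrt (4 * PI * t)).
  { apply (is_RInt_0oo_unique (fun r => exp (- (t * r ^ 2)))); [|apply RInt_0oo_gauss, Ht].
    apply (is_RInt_gen_ext (V := R_NormedModule)) with (2 := Hphi 0).
    apply filter_forall. intros ab r _. rewrite Rmult_0_r, cos_0. rring. }
  enough (E : phi z * exp (z ^ 2 / (4 * t)) = phi 0 * exp (0 ^ 2 / (4 * t))).
  { replace (PI * heat z t) with (phi z); [apply Hphi|].
    unfold heat. rewrite exp_Ropp.
    replace (0 ^ 2 / (4 * t)) with 0 in E by (field; lra). rewrite exp_0, H0 in E.
    assert (He := exp_pos (z ^ 2 / (4 * t))).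
    apply Rmult_eq_reg_r with (exp (z ^ 2 / (4 * t))); [|lra]. rewrite E.
    field. split; [apply Rgt_not_eq, He | apply Rgt_not_eq, sqrt_lt_R0].
    generalize PI_RGT_0; nra. }
  destruct (Rtotal_order 0 z) as [Hz | [<- | Hz]]; [symmetry | reflexivity | ];
    apply (eq_is_derive (V := R_NormedModule) (fun z => phi z * exp (z ^ 2 / (4 * t)))); auto.
Qed.

Ltac c2d := repeat first
  [ apply continuity_2d_pt_const | apply continuity_2d_pt_id1 | apply continuity_2d_pt_id2
  | apply continuity_2d_pt_plus | apply continuity_2d_pt_minus | apply continuity_2d_pt_mult
  | apply continuity_2d_pt_opp
  | apply (continuity_1d_2d_pt_comp exp); [apply derivable_continuous_pt, derivable_pt_exp |]
  | apply (continuity_1d_2d_pt_comp cos); [apply continuity_cos |]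
  | apply (continuity_1d_2d_pt_comp sin); [apply continuity_sin |]
  | apply (continuity_1d_2d_pt_comp (fun u => u ^ 2)); [apply continuity_pt_filterlim; cont |]
  ].

(* The straight homotopy [w(s) = 1 + s * (exp (i pi / 4) - 1)], [q = cos (pi / 4)], moves the
   positive half-line to the ray; for [f(l) = exp (i l z - l^2 t)] one has
   [d/ds (f (r w) w) = d/dr (r w' f (r w))], whose real parts are used here. *)
Lemma RInt_0oo_ray (q z t : R) : 0 < q -> 2 * q ^ 2 = 1 -> 0 < z -> 0 < t ->
  is_RInt_0oo (fun r => exp (- (z * q * r)) *
      (q * cos (r * q * z - t * r ^ 2) - q * sin (r * q * z - t * r ^ 2))) (PI * heat z t).
Proof.
  intros Hq Hq2 Hz Ht. assert (Hq1 : q < 1) by nra.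
  (* With w = p + i s q, the exponent i l z - l^2 t at l = r w is A + i B. [F] and [G] are the real
     parts of w e^(A + i B) and r w' e^(A + i B), where w' = (q - 1) + i q. [H] is their common
     derivative, the real part of w' (X + i Y) e^(A + i B) with X + i Y = 1 + r d/dr (A + i B). *)
  set (p := fun s => 1 - s * (1 - q)).
  set (A := fun r s => - (z * r * (s * q)) - t * r ^ 2 * (p s ^ 2 - (s * q) ^ 2)).
  set (B := fun r s => r * p s * z - 2 * t * r ^ 2 * p s * (s * q)).
  set (F := fun r s => exp (A r s) * (p s * cos (B r s) - s * q * sin (B r s))).
  set (G := fun r s => r * exp (A r s) * ((q - 1) * cos (B r s) - q * sin (B r s))).
  set (X := fun r s => 1 - r * z * (s * q) - 2 * t * r ^ 2 * (p s ^ 2 - (s * q) ^ 2)).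
  set (Y := fun r s => r * z * p s - 4 * t * r ^ 2 * p s * (s * q)).
  set (H := fun r s => exp (A r s) * (((q - 1) * X r s - q * Y r s) * cos (B r s)
                 - ((q - 1) * Y r s + q * X r s) * sin (B r s))).
  assert (HF : forall r s, is_derive (F r) s (H r s)).
  { intros r s. unfold F, H, X, Y, A, B, p. auto_derive; [auto|]. unfold Rminus; simpl. ring. }
  assert (HG : forall r s, is_derive (fun r => G r s) r (H r s)).
  { intros r s. unfold G, H, X, Y, A, B, p. auto_derive; [auto|]. unfold Rminus; simpl. ring. }
  assert (HH : forall r s, continuity_2d_pt H r s).
  { intros r s. unfold H, X, Y, A, B, p. c2d. }
  assert (HH' := continuity_2d_swap H HH).
  assert (HFc : forall s r, continuous (fun r => F r s) r).
  { intros s r. unfold F, A, B, p. cont. }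
  (* Cauchy's theorem on the triangle cut off at radius parameter [R0]: [H] is integrated in both
     orders, and the integral of [G] is the contribution of the closing segment. *)
  assert (E : forall R0, RInt (fun r => F r 1) 0 R0 = RInt (fun r => F r 0) 0 R0 + RInt (fun s => G R0 s) 0 1).
  { intros R0.
    assert (E1 : RInt (fun s => RInt (fun r => H r s) 0 R0) 0 1 = RInt (fun s => G R0 s) 0 1).
    { apply RInt_ext. intros s _. apply is_RInt_unique.
      replace (G R0 s) with (minus (G R0 s) (G 0 s)).
      2:{ unfold G, minus, plus, opp; simpl. ring. }
      apply (is_RInt_derive (V := R_CompleteNormedModule) (fun r => G r s)); intros r _; [apply HG|].
      apply (continuity_2d_l H), HH. }
    rewrite (RInt_swap_rectangle H 0 R0 0 1 HH) in E1.
    rewrite <- E1.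
    replace (RInt (fun r => RInt (fun s => H r s) 0 1) 0 R0)
      with (RInt (fun r => F r 1 - F r 0) 0 R0).
    - rewrite (RInt_minus (V := R_CompleteNormedModule) (fun r => F r 1) (fun r => F r 0)); try (apply ex_RInt_cont, HFc).
      unfold minus, plus, opp; simpl. rring.
    - apply RInt_ext. intros r _. symmetry. apply is_RInt_unique.
      apply (is_RInt_derive (V := R_CompleteNormedModule) (F r)); intros s _; [apply HF|].
      apply (continuity_2d_r H), HH. }
  set (m := Rmin z t). assert (Hm : 0 < m) by (apply Rmin_pos; assumption).
  assert (Hmz := Rmin_l z t). assert (Hmt := Rmin_r z t). fold m in Hmz, Hmt.
  assert (Hlim : is_lim (fun R0 => RInt (fun s => G R0 s) 0 1) p_infty 0).
  { apply (is_lim_0_of_bound _ (8 / (m * q) ^ 2)). intros r Hr.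
    replace (8 / (m * q) ^ 2 / r) with ((1 - 0) * (8 / (m * q) ^ 2 / r)) by ring.
    apply abs_RInt_le_const; [lra | |].
    { apply ex_RInt_cont. intros s. unfold G, A, B, p. cont. }
    intros s Hs. unfold G.
    (* The Gaussian decay degenerates at s = 1, because p^2 - (s q)^2 = (1 - s)(p + s q). The loss
       is made up by exp(- z r s q): the two decay rates are at least m r q (1 - s) and m r q s,
       using r >= 1. *)
    assert (HA : A r s <= - (m * q * r)).
    { assert (E1 : p s ^ 2 - (s * q) ^ 2 = (1 - s) * (p s + s * q)) by (unfold p; ring).
      assert (E2 : q <= p s + s * q) by (unfold p; nra).
      assert (E3 : q * (1 - s) <= p s ^ 2 - (s * q) ^ 2) by (rewrite E1; nra).
      assert (E4 : m * r <= t * r ^ 2).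
      { apply Rmult_le_compat; nra. }
      assert (E5 : m * r * (q * (1 - s)) <= t * r ^ 2 * (p s ^ 2 - (s * q) ^ 2)).
      { apply Rmult_le_compat; nra. }
      assert (E6 : m * r * (s * q) <= z * r * (s * q)).
      { apply Rmult_le_compat_r; nra. }
      unfold A. nra. }
    rewrite !Rabs_mult, (Rabs_pos_eq r) by lra.
    rewrite (Rabs_pos_eq (exp _)) by apply Rlt_le, exp_pos.
    assert (Hcs : Rabs ((q - 1) * cos (B r s) - q * sin (B r s)) <= 2).
    { generalize (COS_bound (B r s)) (SIN_bound (B r s)). intros.
      apply Rabs_le. nra. }
    assert (Hmq : 0 < m * q) by nra.
    assert (He : exp (A r s) <= 4 / (m * q * r) ^ 2).
    { apply Rle_trans with (exp (- (m * q * r))).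
      { destruct (Rle_lt_or_eq_dec _ _ HA) as [Hlt | ->]; [left; apply exp_increasing, Hlt | right; reflexivity]. }
      apply Rle_trans with (1 := exp_neg_le_inv_pow (m * q * r) 2 ltac:(auto) ltac:(nra)).
      replace (4 / (m * q * r) ^ 2) with (/ (m * q * r / 2) ^ 2) by (field; split; nra).
      apply Rinv_le_contravar; [apply pow_lt; nra | apply pow_incr; simpl INR; nra]. }
    apply Rle_trans with (r * (4 / (m * q * r) ^ 2) * 2).
    - apply Rmult_le_compat; [| apply Rabs_pos | | exact Hcs].
      + apply Rmult_le_pos; [lra | apply Rlt_le, exp_pos].
      + apply Rmult_le_compat_l; [lra | exact He].
    - right. field. split; [lra | split; lra]. }
  assert (H0 : is_lim (RInt (fun r => F r 0) 0) p_infty (PI * heat z t)).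
  { apply is_RInt_0oo_lim.
    apply (is_RInt_gen_ext (V := R_NormedModule)) with (2 := RInt_0oo_gauss_cos t z Ht).
    apply filter_forall. intros ab r _. unfold F, A, B, p.
    replace (- (z * r * (0 * q)) - t * r ^ 2 * ((1 - 0 * (1 - q)) ^ 2 - (0 * q) ^ 2)) with (- (t * r ^ 2)) by ring.
    replace (r * (1 - 0 * (1 - q)) * z - 2 * t * r ^ 2 * (1 - 0 * (1 - q)) * (0 * q)) with (r * z) by ring.
    rring. }
  apply (is_RInt_gen_ext (V := R_NormedModule) (fun r => F r 1)).
  { apply filter_forall. intros ab r _. unfold F, A, B, p.
    replace (- (z * r * (1 * q)) - t * r ^ 2 * ((1 - 1 * (1 - q)) ^ 2 - (1 * q) ^ 2)) with (- (z * q * r)) by ring.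
    replace (r * (1 - 1 * (1 - q)) * z - 2 * t * r ^ 2 * (1 - 1 * (1 - q)) * (1 * q))
      with (r * q * z - t * r ^ 2 * (2 * q ^ 2)) by ring.
    rewrite Hq2, Rmult_1_r. rring. }
  apply is_RInt_0oo_of_lim with (I := RInt (fun r => F r 1) 0).
  { intros b _. apply is_RInt_cont, HFc. }
  apply (is_lim_ext (fun R0 => RInt (fun r => F r 0) 0 R0 + RInt (fun s => G R0 s) 0 1) _ p_infty (PI * heat z t)).
  { intros R0. symmetry. apply E. }
  replace (Finite (PI * heat z t)) with (Finite (PI * heat z t + 0)) by (f_equal; ring).
  apply (is_lim_plus' _ _ p_infty (PI * heat z t) 0); assumption.
Qed.

(** The function exp(- z q r) sin(r q z - t r^2) vanishes at both ends. The integral of its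
    derivative is z times the unweighted ray integral minus 2 t times the weighted one. *)
Lemma RInt_0oo_ray_weighted (q z t : R) : 0 < q -> 2 * q ^ 2 = 1 -> 0 < z -> 0 < t ->
  is_RInt_0oo (fun r => r * exp (- (z * q * r)) * cos (r * q * z - t * r ^ 2))
    (z / (2 * t) * (PI * heat z t)).
Proof.
  intros Hq Hq2 Hz Ht.
  destruct (exp_neg_dominated (z * q)) as [C [HC0 HC]]; [nra|].
  assert (HI : is_RInt_0oo (fun r => exp (- (z * q * r)) *
      (- (z * q) * sin (r * q * z - t * r ^ 2) + (q * z - 2 * t * r) * cos (r * q * z - t * r ^ 2)))
      (0 - exp (- (z * q * 0)) * sin (0 * q * z - t * 0 ^ 2))).
  { apply (is_RInt_0oo_derive (fun r => exp (- (z * q * r)) * sin (r * q * z - t * r ^ 2))).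
    - intros r. auto_derive; [auto | unfold Rminus; simpl; ring].
    - intros r. cont.
    - apply (is_lim_0_of_bound _ C). intros r Hr.
      rewrite Rabs_mult, (Rabs_pos_eq (exp _)) by apply Rlt_le, exp_pos.
      apply Rle_trans with (C / (1 + r ^ 2) ^ 2 * 1).
      + apply Rmult_le_compat; [apply Rlt_le, exp_pos | apply Rabs_pos | apply HC; lra | apply Rabs_sin_le_1].
      + rewrite Rmult_1_r. apply Rmult_le_compat_l; [lra|]. apply Rinv_le_contravar; nra. }
  replace (0 * q * z - t * 0 ^ 2) with 0 in HI by ring. rewrite sin_0, Rmult_0_r, Rminus_0_r in HI.
  assert (HI2 := is_RInt_gen_scal (V := R_NormedModule) _ (/ (2 * t)) _
     (is_RInt_gen_minus (V := R_NormedModule) _ _ _ _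
        (is_RInt_gen_scal (V := R_NormedModule) _ z _ (RInt_0oo_ray q z t Hq Hq2 Hz Ht)) HI)).
  replace (z / (2 * t) * (PI * heat z t)) with (scal (/ (2 * t)) (minus (scal z (PI * heat z t)) 0)).
  2:{ unfold scal, minus, plus, opp; simpl; unfold mult; simpl. field. lra. }
  apply (is_RInt_gen_ext (V := R_NormedModule)) with (2 := HI2).
  apply filter_forall. intros ab r _. unfold scal, minus, plus, opp; simpl; unfold mult; simpl.
  apply Rminus_diag_uniq. field. lra.
Qed.

(** * Exchanging the contour integral with the transforms *)

(** The first variable is the parameter along a ray; the second is the variable of the datum,
    running up to infinity or up to t according to [Fb]. The common value of the two iterated
    integrals is [l]. *)
Definition swappable (Fb : (R -> Prop) -> Prop) (f : R -> R -> R) : Prop :=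
  exists (Phi Psi : R -> R) (l : R),
    Fb (fun b => forall y, 0 <= y <= b -> is_RInt_0oo (fun x => f x y) (Phi y)) /\
    (forall x, 0 <= x -> is_RInt_gen (f x) (at_point 0) Fb (Psi x)) /\
    is_RInt_gen Phi (at_point 0) Fb l /\ is_RInt_0oo Psi l.

Lemma continuity_2d_comp (f : R -> R -> R) (a b : R -> R) :
  (forall x y, continuity_2d_pt f x y) -> (forall x, continuous a x) -> (forall x, continuous b x) ->
  forall x y, continuity_2d_pt (fun u v => f (a u) (b v)) x y.
Proof.
  intros Hf Ha Hb x y. apply continuity_2d_pt_filterlim.
  apply (continuous_comp_2 (fun z : R * R => a (fst z)) (fun z : R * R => b (snd z)) f (x, y)).
  - apply (continuous_comp fst a); [apply continuous_fst | apply Ha].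
  - apply (continuous_comp snd b); [apply continuous_snd | apply Hb].
  - apply continuity_2d_pt_filterlim, Hf.
Qed.

Lemma continuous_Rabs (x : R) : continuous Rabs x.
Proof. apply continuity_pt_filterlim, Rcontinuity_abs. Qed.

Lemma is_RInt_gen_0_ext {V : NormedModule R_AbsRing} (Fb : (R -> Prop) -> Prop) (FF : ProperFilter Fb)
  (f g : R -> V) (l : V) :
  Fb (fun b => 0 <= b) -> Fb (fun b => forall x, 0 < x < b -> f x = g x) ->
  is_RInt_gen f (at_point 0) Fb l -> is_RInt_gen g (at_point 0) Fb l.
Proof.
  intros H0 Hfg. apply is_RInt_gen_ext.
  eexists (fun a => a = 0) _; [reflexivity | exact (filter_and _ _ H0 Hfg) |].
  simpl. intros a b -> [Hb H] x. rewrite Rmin_left, Rmax_right by exact Hb. apply H.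
Qed.

Lemma nonneg_p_infty : Rbar_locally p_infty (fun b => 0 <= b).
Proof. exists 0. intros; lra. Qed.

Lemma is_RInt_0oo_ext {V : NormedModule R_AbsRing} (f g : R -> V) (l : V) :
  (forall x, 0 < x -> f x = g x) -> is_RInt_0oo f l -> is_RInt_0oo g l.
Proof.
  intros H. apply is_RInt_gen_0_ext; [typeclasses eauto | apply nonneg_p_infty |].
  exists 0. intros b _ x Hx. apply H, Hx.
Qed.

(** Fubini's theorem above asks for a bound on the whole plane, while the kernels decay on the
    quadrant only. Composition with the absolute value reduces one to the other without losing
    continuity. *)
Lemma swappable_0oo (f : R -> R -> R) (C : R) :
  (forall x y, continuity_2d_pt f x y) ->
  (forall x y, 0 <= x -> 0 <= y -> Rabs (f x y) <= C / (1 + x ^ 2) / (1 + y ^ 2)) ->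
  swappable (Rbar_locally p_infty) f.
Proof.
  intros Hf HC.
  destruct (Fubini_0oo_0oo (fun x y => f (Rabs x) (Rabs y)) C) as [Phi [Psi [l [H1 [H2 [H3 H4]]]]]].
  - apply continuity_2d_comp; auto using continuous_Rabs.
  - intros x y. rewrite <- (pow2_abs x), <- (pow2_abs y). apply HC; apply Rabs_pos.
  - exists Phi, Psi, l. split; [|split; [|split]]; auto.
    + exists 0. intros b _ y Hy. apply is_RInt_0oo_ext with (2 := H1 y).
      intros x Hx. rewrite !Rabs_pos_eq by lra. reflexivity.
    + intros x Hx. apply is_RInt_0oo_ext with (2 := H2 x).
      intros y Hy. rewrite !Rabs_pos_eq by lra. reflexivity.
Qed.

Lemma swappable_segment (f : R -> R -> R) (C t : R) :
  0 <= t -> (forall x y, continuity_2d_pt f x y) ->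
  (forall x y, 0 <= x -> 0 <= y <= t -> Rabs (f x y) <= C / (1 + x ^ 2)) ->
  swappable (at_point t) f.
Proof.
  intros Ht Hf HC.
  (* Clamping y to [0,t] makes the bound valid for every y; continuity is seen from the closed form
     (|y| + t - |y - t|) / 2. *)
  set (c := fun y => Rmax 0 (Rmin y t)).
  assert (Hc : forall y, continuous c y).
  { intros y. apply (continuous_ext (fun y => (Rabs y + t - Rabs (y - t)) / 2)).
    - intros z. unfold c, Rmax, Rmin, Rabs.
      destruct (Rcase_abs z), (Rcase_abs (z - t)); destruct (Rle_dec z t);
      match goal with |- context [Rle_dec 0 ?u] => destruct (Rle_dec 0 u) end; lra.
    - apply (continuous_scal_l (V := R_NormedModule) (fun y => Rabs y + t - Rabs (y - t)) (/ 2) y).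
      apply (continuous_minus (V := R_NormedModule)).
      + apply (continuous_plus (V := R_NormedModule)); [apply continuous_Rabs | apply continuous_const].
      + apply (continuous_comp (fun y => y - t) Rabs); [cont | apply continuous_Rabs]. }
  assert (Hcb : forall y, 0 <= c y <= t).
  { intros y. unfold c, Rmax, Rmin. destruct (Rle_dec y t);
      match goal with |- context [Rle_dec 0 ?u] => destruct (Rle_dec 0 u) end; lra. }
  assert (Hci : forall y, 0 <= y <= t -> c y = y).
  { intros y Hy. unfold c. rewrite Rmin_left, Rmax_right by lra. reflexivity. }
  assert (Hf' : forall x y, continuity_2d_pt (fun x y => f (Rabs x) (c y)) x y).
  { apply continuity_2d_comp; auto using continuous_Rabs. }
  assert (HC' : forall x y, 0 <= x -> Rabs (f (Rabs x) (c y)) <= C / (1 + x ^ 2)).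
  { intros x y Hx. rewrite <- (pow2_abs x). apply HC; [apply Rabs_pos | apply Hcb]. }
  destruct (RInt_0oo_param _ C Hf' HC') as [Phi [HPhi _]].
  destruct (Fubini_0oo_segment _ C 0 t Phi Ht Hf' HC' HPhi) as [H1 H2].
  exists Phi, (fun x => RInt (fun y => f (Rabs x) (c y)) 0 t), (RInt Phi 0 t).
  split; [|split; [|split]].
  - intros y Hy. apply is_RInt_0oo_ext with (2 := HPhi y).
    intros x Hx. rewrite Rabs_pos_eq by lra. rewrite Hci by exact Hy. reflexivity.
  - intros x Hx. apply is_RInt_gen_at_point.
    apply (is_RInt_ext (fun y => f (Rabs x) (c y))).
    + intros y. rewrite Rmin_left, Rmax_right by exact Ht. intros Hy.
      rewrite Rabs_pos_eq by lra. rewrite Hci by lra. reflexivity.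
    + apply (is_RInt_cont (fun y => f (Rabs x) (c y))).
      intros y. apply (continuity_2d_r (fun x y => f (Rabs x) (c y))), Hf'.
  - apply is_RInt_gen_at_point. apply (is_RInt_cont Phi), H2.
  - exact H1.
Qed.

(** * Complex-valued integrals and oscillatory integrands *)

Notation is_CInt f Fa Fb l := (is_RInt_gen (V := C_R_NormedModule) f Fa Fb l).

Lemma is_CInt_pair {Fa Fb : (R -> Prop) -> Prop} {FFa : Filter Fa} {FFb : Filter Fb} (f : R -> C) (l : C) :
  is_RInt_gen (fun x => Re (f x)) Fa Fb (Re l) -> is_RInt_gen (fun x => Im (f x)) Fa Fb (Im l) ->
  is_CInt f Fa Fb l.
Proof.
  intros H1 H2 P [eps HP].
  assert (F1 := H1 (ball (Re l) eps) (locally_ball _ _)).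
  assert (F2 := H2 (ball (Im l) eps) (locally_ball _ _)).
  unfold filtermapi in *. generalize (filter_and _ _ F1 F2). apply filter_imp.
  intros [a b] [[y1 [Hy1 By1]] [y2 [Hy2 By2]]]. exists (y1, y2). split.
  - apply (is_RInt_fct_extend_pair (U := R_NormedModule) (V := R_NormedModule) f); assumption.
  - apply HP. split; assumption.
Qed.

Lemma is_CInt_Re {Fa Fb : (R -> Prop) -> Prop} {FFa : Filter Fa} {FFb : Filter Fb} (f : R -> C) (l : C) :
  is_CInt f Fa Fb l -> is_RInt_gen (fun x => Re (f x)) Fa Fb (Re l).
Proof.
  intros H P [eps HP].
  assert (F := H (ball (M := C_UniformSpace) l eps) (locally_ball (T := C_UniformSpace) _ _)).
  unfold filtermapi in *. revert F. apply filter_imp. intros [a b] [y [Hy [By _]]]. exists (Re y). split.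
  - exact (is_RInt_fct_extend_fst (U := R_NormedModule) (V := R_NormedModule) f _ _ _ Hy).
  - apply HP, By.
Qed.

Lemma is_CInt_Im {Fa Fb : (R -> Prop) -> Prop} {FFa : Filter Fa} {FFb : Filter Fb} (f : R -> C) (l : C) :
  is_CInt f Fa Fb l -> is_RInt_gen (fun x => Im (f x)) Fa Fb (Im l).
Proof.
  intros H P [eps HP].
  assert (F := H (ball (M := C_UniformSpace) l eps) (locally_ball (T := C_UniformSpace) _ _)).
  unfold filtermapi in *. revert F. apply filter_imp. intros [a b] [y [Hy [_ By]]]. exists (Im y). split.
  - exact (is_RInt_fct_extend_snd (U := R_NormedModule) (V := R_NormedModule) f _ _ _ Hy).
  - apply HP, By.
Qed.

Lemma is_CInt_Cmult {Fa Fb : (R -> Prop) -> Prop} {FFa : Filter Fa} {FFb : Filter Fb} (f : R -> C) (c l : C) :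
  is_CInt f Fa Fb l -> is_CInt (fun x => c * f x)%C Fa Fb (c * l)%C.
Proof.
  intros H. assert (H1 := is_CInt_Re _ _ H). assert (H2 := is_CInt_Im _ _ H).
  apply is_CInt_pair; [|].
  - exact (is_RInt_gen_minus (V := R_NormedModule) _ _ _ _
      (is_RInt_gen_scal (V := R_NormedModule) _ (Re c) _ H1)
      (is_RInt_gen_scal (V := R_NormedModule) _ (Im c) _ H2)).
  - exact (is_RInt_gen_plus (V := R_NormedModule) _ _ _ _
      (is_RInt_gen_scal (V := R_NormedModule) _ (Re c) _ H2)
      (is_RInt_gen_scal (V := R_NormedModule) _ (Im c) _ H1)).
Qed.

Lemma RInt_gen_C_unique {Fa Fb : (R -> Prop) -> Prop} {FFa : ProperFilter Fa} {FFb : ProperFilter Fb}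
  (f : R -> C) (l : C) :
  is_CInt f Fa Fb l -> RInt_gen (V := C_R_CompleteNormedModule) f Fa Fb = l.
Proof. intros H. apply (is_RInt_gen_unique (V := C_R_CompleteNormedModule) f l H). Qed.

(** Used to bring the exponential factor of a contour integrand inside the transform it multiplies.
    Since [c] is nonzero, convergence of [f] is inferred from that of the product. *)
Lemma Cmult_RInt_gen {Fa Fb : (R -> Prop) -> Prop} {FFa : ProperFilter Fa} {FFb : ProperFilter Fb}
  (f : R -> C) (c l : C) :
  c <> 0%C -> is_CInt (fun x => c * f x)%C Fa Fb l ->
  (c * RInt_gen (V := C_R_CompleteNormedModule) f Fa Fb)%C = l.
Proof.
  intros Hc H. apply (is_CInt_Cmult _ (/ c)%C) in H.
  rewrite (RInt_gen_C_unique f (/ c * l)%C).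
  - rewrite Cmult_assoc, Cinv_r, Cmult_1_l by exact Hc. reflexivity.
  - revert H. apply is_RInt_gen_ext. apply filter_forall. intros ab x _.
    rewrite Cmult_assoc, Cinv_l, Cmult_1_l by exact Hc. reflexivity.
Qed.

(* Only the difference of the contributions of two rays has a closed form [K], which is why
   the two are exchanged together. *)
Lemma swappable_C_diff (Fb : (R -> Prop) -> Prop) (FF : ProperFilter Fb) (H1 H2 : R -> R -> C) (K : R -> C) :
  Fb (fun b => 0 <= b) ->
  swappable Fb (fun x y => Re (H1 x y)) -> swappable Fb (fun x y => Im (H1 x y)) ->
  swappable Fb (fun x y => Re (H2 x y)) -> swappable Fb (fun x y => Im (H2 x y)) ->
  Fb (fun b => forall y, 0 < y < b -> is_CInt (fun x => H1 x y - H2 x y)%C (at_point 0) (Rbar_locally p_infty) (K y)) ->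
  exists (Psi1 Psi2 : R -> C) (l1 l2 : C),
    (forall x, 0 <= x -> is_CInt (H1 x) (at_point 0) Fb (Psi1 x)) /\
    (forall x, 0 <= x -> is_CInt (H2 x) (at_point 0) Fb (Psi2 x)) /\
    is_CInt Psi1 (at_point 0) (Rbar_locally p_infty) l1 /\
    is_CInt Psi2 (at_point 0) (Rbar_locally p_infty) l2 /\
    is_CInt K (at_point 0) Fb (l1 - l2)%C.
Proof.
  intros Hb [A1 [B1 [m1 [A11 [A12 [A13 A14]]]]]] [A2 [B2 [m2 [A21 [A22 [A23 A24]]]]]]
    [A3 [B3 [m3 [A31 [A32 [A33 A34]]]]]] [A4 [B4 [m4 [A41 [A42 [A43 A44]]]]]] HK.
  exists (fun x => (B1 x, B2 x)), (fun x => (B3 x, B4 x)), (m1, m2), (m3, m4).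
  assert (HE : Fb (fun b => forall y, 0 < y < b -> A1 y - A3 y = Re (K y) /\ A2 y - A4 y = Im (K y))).
  { generalize (filter_and _ _ (filter_and _ _ A11 A21) (filter_and _ _ (filter_and _ _ A31 A41) HK)).
    apply filter_imp. intros b [[E1 E2] [[E3 E4] E5]] y Hy.
    specialize (E1 y ltac:(lra)). specialize (E2 y ltac:(lra)).
    specialize (E3 y ltac:(lra)). specialize (E4 y ltac:(lra)). specialize (E5 y Hy). split.
    - exact (is_RInt_0oo_unique _ _ _ (is_RInt_gen_minus (V := R_NormedModule) _ _ _ _ E1 E3)
        (is_CInt_Re _ _ E5)).
    - exact (is_RInt_0oo_unique _ _ _ (is_RInt_gen_minus (V := R_NormedModule) _ _ _ _ E2 E4)
        (is_CInt_Im _ _ E5)). }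
  split; [|split; [|split; [|split]]].
  - intros x Hx. apply is_CInt_pair; [apply A12, Hx | apply A22, Hx].
  - intros x Hx. apply is_CInt_pair; [apply A32, Hx | apply A42, Hx].
  - apply is_CInt_pair; [exact A14 | exact A24].
  - apply is_CInt_pair; [exact A34 | exact A44].
  - apply is_CInt_pair; [|].
    + apply (is_RInt_gen_0_ext Fb FF (fun y => A1 y - A3 y)); [exact Hb | |].
      * revert HE. apply filter_imp. intros b E y Hy. apply (E y Hy).
      * exact (is_RInt_gen_minus (V := R_NormedModule) _ _ _ _ A13 A33).
    + apply (is_RInt_gen_0_ext Fb FF (fun y => A2 y - A4 y)); [exact Hb | |].
      * revert HE. apply filter_imp. intros b E y Hy. apply (E y Hy).
      * exact (is_RInt_gen_minus (V := R_NormedModule) _ _ _ _ A23 A43).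
Qed.

Definition dominated_C (v : R -> C) : Prop :=
  (forall y, continuous (fun y => Re (v y)) y) /\ (forall y, continuous (fun y => Im (v y)) y) /\
  exists C, forall y, 0 <= y -> Rabs (Re (v y)) <= C / (1 + y ^ 2) /\ Rabs (Im (v y)) <= C / (1 + y ^ 2).

Lemma Rabs_Cmult_le (a b c d A B : R) :
  Rabs a <= A -> Rabs b <= A -> Rabs c <= B -> Rabs d <= B ->
  Rabs (a * c - b * d) <= 2 * (A * B) /\ Rabs (a * d + b * c) <= 2 * (A * B).
Proof.
  intros Ha Hb Hc Hd.
  assert (H : forall x y, Rabs x <= A -> Rabs y <= B -> Rabs (x * y) <= A * B).
  { intros x y Hx Hy. rewrite Rabs_mult. apply Rmult_le_compat; auto using Rabs_pos. }
  generalize (H a c Ha Hc) (H b d Hb Hd) (H a d Ha Hd) (H b c Hb Hc). intros.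
  split.
  - unfold Rminus. eapply Rle_trans; [apply Rabs_triang|]. rewrite Rabs_Ropp. lra.
  - eapply Rle_trans; [apply Rabs_triang|]. lra.
Qed.

Lemma continuity_2d_of_r (f : R -> R) :
  (forall y, continuous f y) -> forall x y, continuity_2d_pt (fun _ v => f v) x y.
Proof.
  intros Hf x y. apply (continuity_1d_2d_pt_comp f (fun _ v => v)); [|apply continuity_2d_pt_id2].
  apply continuity_pt_filterlim, Hf.
Qed.

Lemma swappable_Cmult_0oo (v : R -> C) (E : R -> R -> C) (M : R) :
  dominated_C v ->
  (forall x y, continuity_2d_pt (fun x y => Re (E x y)) x y) ->
  (forall x y, continuity_2d_pt (fun x y => Im (E x y)) x y) ->
  (forall x y, 0 <= x -> 0 <= y ->
     Rabs (Re (E x y)) <= M / (1 + x ^ 2) /\ Rabs (Im (E x y)) <= M / (1 + x ^ 2)) ->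
  swappable (Rbar_locally p_infty) (fun x y => Re (v y * E x y)%C) /\
  swappable (Rbar_locally p_infty) (fun x y => Im (v y * E x y)%C).
Proof.
  intros [Hr [Hi [C HC]]] HEr HEi HM.
  assert (HB : forall x y, 0 <= x -> 0 <= y ->
    Rabs (Re (v y * E x y)%C) <= 2 * (C * M) / (1 + x ^ 2) / (1 + y ^ 2) /\
    Rabs (Im (v y * E x y)%C) <= 2 * (C * M) / (1 + x ^ 2) / (1 + y ^ 2)).
  { intros x y Hx Hy. replace (2 * (C * M) / (1 + x ^ 2) / (1 + y ^ 2))
      with (2 * (C / (1 + y ^ 2) * (M / (1 + x ^ 2)))) by (unfold Rdiv; ring).
    destruct (HM x y Hx Hy), (HC y Hy). apply Rabs_Cmult_le; assumption. }
  split; apply swappable_0oo with (2 * (C * M)).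
  - intros x y. apply continuity_2d_pt_minus; apply continuity_2d_pt_mult; auto;
      apply continuity_2d_of_r; auto.
  - intros x y Hx Hy. apply HB; assumption.
  - intros x y. apply continuity_2d_pt_plus; apply continuity_2d_pt_mult; auto;
      apply continuity_2d_of_r; auto.
  - intros x y Hx Hy. apply HB; assumption.
Qed.

Lemma continuous_bounded_segment (f : R -> R) (a b : R) : a <= b ->
  (forall y, continuous f y) -> exists M, forall y, a <= y <= b -> Rabs (f y) <= M.
Proof.
  intros Hab Hf.
  destruct (continuity_ab_maj (fun y => Rabs (f y)) a b Hab) as [m [Hm _]].
  - intros c _. apply continuity_pt_filterlim.
    apply (continuous_comp f Rabs); [apply Hf | apply continuous_Rabs].
  - exists (Rabs (f m)). exact Hm.
Qed.

Lemma swappable_Cmult_segment (v : R -> C) (E : R -> R -> C) (M t : R) :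
  0 <= t ->
  (forall y, continuous (fun y => Re (v y)) y) -> (forall y, continuous (fun y => Im (v y)) y) ->
  (forall x y, continuity_2d_pt (fun x y => Re (E x y)) x y) ->
  (forall x y, continuity_2d_pt (fun x y => Im (E x y)) x y) ->
  (forall x y, 0 <= x -> 0 <= y <= t ->
     Rabs (Re (E x y)) <= M / (1 + x ^ 2) /\ Rabs (Im (E x y)) <= M / (1 + x ^ 2)) ->
  swappable (at_point t) (fun x y => Re (v y * E x y)%C) /\
  swappable (at_point t) (fun x y => Im (v y * E x y)%C).
Proof.
  intros Ht Hr Hi HEr HEi HM.
  destruct (continuous_bounded_segment _ 0 t Ht Hr) as [C1 HC1].
  destruct (continuous_bounded_segment _ 0 t Ht Hi) as [C2 HC2].
  set (C := Rmax C1 C2).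
  assert (HB : forall x y, 0 <= x -> 0 <= y <= t ->
    Rabs (Re (v y * E x y)%C) <= 2 * (C * M) / (1 + x ^ 2) /\
    Rabs (Im (v y * E x y)%C) <= 2 * (C * M) / (1 + x ^ 2)).
  { intros x y Hx Hy. replace (2 * (C * M) / (1 + x ^ 2))
      with (2 * (C * (M / (1 + x ^ 2)))) by (unfold Rdiv; ring).
    destruct (HM x y Hx Hy). apply Rabs_Cmult_le; try assumption.
    - apply Rle_trans with (1 := HC1 y Hy), Rmax_l.
    - apply Rle_trans with (1 := HC2 y Hy), Rmax_r. }
  split; apply swappable_segment with (2 * (C * M)); auto.
  - intros x y. apply continuity_2d_pt_minus; apply continuity_2d_pt_mult; auto;
      apply continuity_2d_of_r; auto.
  - intros x y Hx Hy. apply HB; assumption.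
  - intros x y. apply continuity_2d_pt_plus; apply continuity_2d_pt_mult; auto;
      apply continuity_2d_of_r; auto.
  - intros x y Hx Hy. apply HB; assumption.
Qed.

Ltac cring := match goal with |- @eq _ ?a ?b => change (@eq C a b); ring end.

Lemma is_CInt_RtoC {Fa Fb : (R -> Prop) -> Prop} {FFa : Filter Fa} {FFb : Filter Fb} (f : R -> R) (l : R) :
  is_RInt_gen f Fa Fb l -> is_CInt (fun x => RtoC (f x)) Fa Fb (RtoC l).
Proof.
  intros H. apply is_CInt_pair; [exact H |].
  assert (H0 := is_RInt_gen_minus (V := R_NormedModule) _ _ _ _ H H).
  replace (Im (RtoC l)) with (minus l l).
  2:{ unfold minus, plus, opp; simpl. ring. }
  revert H0. apply is_RInt_gen_ext. apply filter_forall. intros ab x _.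
  unfold minus, plus, opp; simpl. rring.
Qed.

Lemma is_CInt_Cmult_inv {Fa Fb : (R -> Prop) -> Prop} {FFa : Filter Fa} {FFb : Filter Fb}
  (f : R -> C) (c l : C) :
  c <> 0%C -> is_CInt (fun x => c * f x)%C Fa Fb l -> is_CInt f Fa Fb (/ c * l)%C.
Proof.
  intros Hc H. apply (is_CInt_Cmult _ (/ c)%C) in H.
  revert H. apply is_RInt_gen_ext. apply filter_forall. intros ab x _.
  rewrite Cmult_assoc, Cinv_l, Cmult_1_l by exact Hc. reflexivity.
Qed.

(** The negative half-line is reflected with a sign, which presents the real line as a difference of
    two outgoing half-lines, exactly as Gamma is a difference of two rays. [swappable_C_diff] then
    serves both contours. *)
Lemma is_CInt_line (f : R -> C) (l1 l2 : C) :
  is_CInt f (at_point 0) (Rbar_locally p_infty) l1 ->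
  is_CInt (fun x => - f (- x)%R)%C (at_point 0) (Rbar_locally p_infty) l2 ->
  is_CInt f (Rbar_locally m_infty) (Rbar_locally p_infty) (l1 - l2)%C.
Proof.
  intros H1 H2.  replace (l1 - l2)%C with (- l2 + l1)%C by ring.
  apply (is_RInt_gen_Chasles (V := C_R_NormedModule) f 0); [|exact H1].
  intros P HP.
  assert (HP' : locally (l2 : C_R_NormedModule) (fun l => P (opp l))).
  { exact (filterlim_opp (V := C_R_NormedModule) l2 P HP). }
  destruct (H2 _ HP') as [Q S HQ [M HM] HQS].
  exists (fun a => a < - M) (fun b => b = 0); [exists (- M); auto | reflexivity |].
  intros a b Ha ->. simpl.
  destruct (HQS 0 (- a) HQ (HM (- a) ltac:(lra))) as [y [Hy Py]]. simpl in Hy.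
  exists (opp y). split; [|exact Py].
  apply (is_RInt_swap (V := C_R_NormedModule)).
  assert (Hy' : is_RInt (V := C_R_NormedModule) (fun x => - f (- x)%R)%C (- 0) (- a) y).
  { rewrite Ropp_0. exact Hy. }
  apply (is_RInt_comp_opp (V := C_R_NormedModule)) in Hy'.
  revert Hy'. apply is_RInt_ext. intros x _.
  rewrite Ropp_involutive. apply (opp_opp (G := C_R_NormedModule)).
Qed.

Lemma Cexp_plus (a b : C) : Cexp (a + b) = (Cexp a * Cexp b)%C.
Proof.
  destruct a as [a1 a2], b as [b1 b2]. unfold Cexp, Cmult, Cplus; simpl.
  rewrite exp_plus, cos_plus, sin_plus. f_equal; ring.
Qed.

Lemma Cexp_neq_0 (a : C) : Cexp a <> 0%C.
Proof.
  intros H. assert (E : (Cexp (a + - a) = 0)%C) by (rewrite Cexp_plus, H; ring).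
  rewrite Cplus_opp_r in E. apply (f_equal Re) in E. revert E. unfold Cexp; simpl.
  rewrite exp_0, cos_0. lra.
Qed.

Lemma Cexp_PI4 : Cexp (Ci * RtoC (PI / 4)) = (/ sqrt 2, / sqrt 2).
Proof.
  unfold Cexp, Ci, RtoC, Cmult, Re, Im; simpl.
  replace (0 * (PI / 4) - 1 * 0) with 0 by ring. replace (0 * 0 + 1 * (PI / 4)) with (PI / 4) by ring.
  rewrite exp_0, cos_PI4, sin_PI4. unfold Rdiv. f_equal; ring.
Qed.

Lemma Cexp_3PI4 : Cexp (Ci * RtoC (3 * PI / 4)) = (- / sqrt 2, / sqrt 2).
Proof.
  unfold Cexp, Ci, RtoC, Cmult, Re, Im; simpl.
  replace (0 * (3 * PI / 4) - 1 * 0) with 0 by ring.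
  replace (0 * 0 + 1 * (3 * PI / 4)) with (3 * (PI / 4)) by field.
  rewrite exp_0, cos_3PI4, sin_3PI4. unfold Rdiv. f_equal; ring.
Qed.

Lemma inv_sqrt2_facts : 0 < / sqrt 2 /\ 2 * (/ sqrt 2) ^ 2 = 1.
Proof.
  assert (H : 0 < sqrt 2) by (apply sqrt_lt_R0; lra). split.
  - apply Rinv_0_lt_compat, H.
  - rewrite pow_inv, pow2_sqrt by lra. field.
Qed.

Lemma exp_trig_bound (e p s B a : R) : 0 <= e -> e <= a -> Rabs p <= 1 -> Rabs s <= 1 ->
  Rabs (e * (p * cos B + s * sin B)) <= 2 * a.
Proof.
  intros He Ha Hp Hs. rewrite Rabs_mult, (Rabs_pos_eq e) by exact He.
  assert (H : Rabs (p * cos B + s * sin B) <= 2).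
  { eapply Rle_trans; [apply Rabs_triang|]. rewrite !Rabs_mult.
    generalize (Rabs_cos_le_1 B) (Rabs_sin_le_1 B) (Rabs_pos p) (Rabs_pos s) (Rabs_pos (cos B)) (Rabs_pos (sin B)).
    intros. nra. }
  generalize (Rabs_pos (p * cos B + s * sin B)). intros. nra.
Qed.

(* Common shape of the integrands along all rays: amplitude [e], phase [B]. *)
Definition osc (e : R -> R -> R) (p1 s1 p2 s2 : R) (B : R -> R -> R) (r y : R) : C :=
  (e r y * (p1 * cos (B r y) + s1 * sin (B r y)), e r y * (p2 * cos (B r y) + s2 * sin (B r y))).

Lemma swappable_osc_0oo (v : R -> C) (e B : R -> R -> R) (p1 s1 p2 s2 M : R) :
  dominated_C v ->
  (forall x y, continuity_2d_pt e x y) -> (forall x y, continuity_2d_pt B x y) ->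
  Rabs p1 <= 1 -> Rabs s1 <= 1 -> Rabs p2 <= 1 -> Rabs s2 <= 1 ->
  (forall r y, 0 <= r -> 0 <= y -> 0 <= e r y <= M / (1 + r ^ 2)) ->
  swappable (Rbar_locally p_infty) (fun x y => Re (v y * osc e p1 s1 p2 s2 B x y)%C) /\
  swappable (Rbar_locally p_infty) (fun x y => Im (v y * osc e p1 s1 p2 s2 B x y)%C).
Proof.
  intros Hv He HB Hp1 Hs1 Hp2 Hs2 HM.
  apply swappable_Cmult_0oo with (2 * M); [exact Hv | | |].
  - intros x y. unfold osc, Re; simpl. c2d; auto.
  - intros x y. unfold osc, Im; simpl. c2d; auto.
  - intros x y Hx Hy. destruct (HM x y Hx Hy).
    replace (2 * M / (1 + x ^ 2)) with (2 * (M / (1 + x ^ 2))) by (unfold Rdiv; ring).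
    split; apply exp_trig_bound; auto.
Qed.

Lemma swappable_osc_segment (v : R -> C) (e B : R -> R -> R) (p1 s1 p2 s2 M t : R) :
  0 <= t ->
  (forall y, continuous (fun y => Re (v y)) y) -> (forall y, continuous (fun y => Im (v y)) y) ->
  (forall x y, continuity_2d_pt e x y) -> (forall x y, continuity_2d_pt B x y) ->
  Rabs p1 <= 1 -> Rabs s1 <= 1 -> Rabs p2 <= 1 -> Rabs s2 <= 1 ->
  (forall r y, 0 <= r -> 0 <= y -> 0 <= e r y <= M / (1 + r ^ 2)) ->
  swappable (at_point t) (fun x y => Re (v y * osc e p1 s1 p2 s2 B x y)%C) /\
  swappable (at_point t) (fun x y => Im (v y * osc e p1 s1 p2 s2 B x y)%C).
Proof.
  intros Ht Hr Hi He HB Hp1 Hs1 Hp2 Hs2 HM.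
  apply swappable_Cmult_segment with (2 * M); auto.
  - intros x y. unfold osc, Re; simpl. c2d; auto.
  - intros x y. unfold osc, Im; simpl. c2d; auto.
  - intros x y Hx Hy. destruct (HM x y Hx (proj1 Hy)).
    replace (2 * M / (1 + x ^ 2)) with (2 * (M / (1 + x ^ 2))) by (unfold Rdiv; ring).
    split; apply exp_trig_bound; auto.
Qed.

(** * The three contour integrals as integrals against the heat kernel *)

Lemma Ceq (z w : C) : Re z = Re w -> Im z = Im w -> z = w.
Proof. destruct z, w; simpl. intros -> ->. reflexivity. Qed.

Ltac Rabs1 := match goal with |- Rabs _ <= 1 => apply Rabs_le; lra end.

(** [v] is a continuous representative of the datum, as Fubini's theorem requires. The factor 2 pi
    times the kernel is cancelled later by the prefactor 1 / (2 pi). *)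
Lemma int_line_heat (u0 v : R -> C) (x t : R) :
  0 < t -> dominated_C v -> (forall y, 0 < y -> v y = u0 y) ->
  is_CInt (fun y => v y * RtoC 2 * RtoC (PI * heat (x - y) t))%C (at_point 0) (Rbar_locally p_infty)
    (int_line (fun l => utm_kernel (RtoC l) x t * u0_hat u0 (RtoC l))%C).
Proof.
  intros Ht Hv Hvu.
  destruct (exp_neg_sqr_dominated t Ht) as [C0 [HC0 HC]].
  set (e := fun r (_ : R) => exp (- (t * r ^ 2))). set (B := fun r y => r * (x - y)).
  assert (Hec : forall r y, continuity_2d_pt e r y) by (intros; unfold e; c2d).
  assert (HBc : forall r y, continuity_2d_pt B r y) by (intros; unfold B; c2d).
  assert (Heb : forall r y, 0 <= r -> 0 <= y -> 0 <= e r y <= C0 / (1 + r ^ 2)).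
  { intros r y _ _. unfold e. split; [apply Rlt_le, exp_pos|].
    replace (C0 / (1 + r ^ 2)) with (C0 / (1 + r ^ 2) ^ 1) by (rewrite pow_1; reflexivity).
    apply Rle_trans with (1 := HC r).
    apply Rle_trans with (C0 / (1 + r ^ 2) ^ 2); apply div_pow_succ_le; lra. }
  (* The two half-lines carry e^(iB) and - e^(- iB), up to the amplitude; their difference is 2 cos
     B. *)
  destruct (swappable_osc_0oo v e B 1 0 0 1 C0) as [S1 S2]; auto; try Rabs1.
  destruct (swappable_osc_0oo v e B (-1) 0 0 1 C0) as [S3 S4]; auto; try Rabs1.
  destruct (swappable_C_diff (Rbar_locally p_infty) _ _ _
     (fun y => v y * RtoC 2 * RtoC (PI * heat (x - y) t))%C nonneg_p_infty S1 S2 S3 S4)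
     as [Psi1 [Psi2 [l1 [l2 [H1 [H2 [H3 [H4 H5]]]]]]]].
  { exists 0. intros b _ y _.
    apply (is_RInt_gen_ext (V := C_R_NormedModule)
      (fun r => v y * RtoC 2 * RtoC (exp (- (t * r ^ 2)) * cos (r * (x - y))))%C).
    { apply filter_forall. intros ab r _. unfold osc, e, B. destruct (v y) as [a b'].
      apply Ceq; simpl; ring. }
    apply is_CInt_Cmult, is_CInt_RtoC, RInt_0oo_gauss_cos, Ht. }
  replace (int_line _) with (l1 - l2)%C; [exact H5|].
  symmetry. unfold int_line. apply RInt_gen_C_unique.
  assert (G : forall (r : R) (E Psi : R -> C),
     (forall y, Cexp (Ci * RtoC r * RtoC x - RtoC r ^ 2 * RtoC t + - (Ci * RtoC r * RtoC y)) = E y)%C ->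
     is_CInt (fun y => v y * E y)%C (at_point 0) (Rbar_locally p_infty) (Psi r) ->
     (utm_kernel (RtoC r) x t * u0_hat u0 (RtoC r))%C = Psi r).
  { intros r E Psi HE HPsi. unfold u0_hat, int_halfline. apply Cmult_RInt_gen; [apply Cexp_neq_0|].
    apply is_RInt_0oo_ext with (2 := HPsi). intros y Hy.
    rewrite <- HE, Cexp_plus, (Hvu y Hy). unfold utm_kernel. cring. }
  apply is_CInt_line.
  - apply is_RInt_0oo_ext with (2 := H3). intros r Hr. symmetry.
    apply (G r (osc e 1 0 0 1 B r) Psi1); [|apply H1; lra].
    intros y. unfold osc, e, B.
    replace (Ci * RtoC r * RtoC x - RtoC r ^ 2 * RtoC t + - (Ci * RtoC r * RtoC y))%C
      with (- (t * r ^ 2), r * (x - y)) by (apply Ceq; simpl; ring).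
    unfold Cexp; simpl. f_equal; ring.
  - apply is_RInt_0oo_ext with (2 := H4). intros r Hr.
    rewrite (G (- r) (fun y => - osc e (-1) 0 0 1 B r y)%C (fun r => - Psi2 (- r)%R)%C).
    + rewrite Ropp_involutive. cring.
    + intros y. unfold osc, e, B.
      replace (Ci * RtoC (- r)%R * RtoC x - RtoC (- r)%R ^ 2 * RtoC t + - (Ci * RtoC (- r)%R * RtoC y))%C
        with (- (t * r ^ 2), - (r * (x - y))) by (apply Ceq; simpl; ring).
      unfold Cexp, Re, Im; cbn [fst snd]. rewrite cos_neg, sin_neg. apply Ceq; simpl; ring.
    + rewrite Ropp_involutive.
      replace (- Psi2 r)%C with (- (1) * Psi2 r)%C by ring.
      apply (is_RInt_gen_ext (V := C_R_NormedModule)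
        (fun y => - (1) * (v y * osc e (-1) 0 0 1 B r y))%C).
      { apply filter_forall. intros ab y _. cring. }
      apply is_CInt_Cmult, H2. lra.
Qed.

(** Since |exp(- l^2 t)| = 1 on Gamma, the amplitude is exp(- (x + y) q r), and it is dominated
    uniformly in y >= 0 only thanks to 0 < x. The integrand on the second ray is minus the conjugate
    of that on the first, apart from the datum, so the difference is twice a real part, evaluated by
    [RInt_0oo_ray]. *)
Lemma int_Gamma_heat_0oo (u0 v : R -> C) (x t : R) :
  0 < x -> 0 < t -> dominated_C v -> (forall y, 0 < y -> v y = u0 y) ->
  is_CInt (fun y => v y * RtoC 2 * RtoC (PI * heat (x + y) t))%C (at_point 0) (Rbar_locally p_infty)
    (int_Gamma (fun l => utm_kernel l x t * u0_hat u0 (- l))%C).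
Proof.
  intros Hx Ht Hv Hvu.
  destruct inv_sqrt2_facts as [Hq Hq2]. set (q := / sqrt 2) in *.
  assert (Hq1 : q < 1) by nra.
  destruct (exp_neg_dominated (x * q)) as [C0 [HC0 HC]]; [nra|].
  set (e := fun r y => exp (- ((x + y) * q * r))). set (B := fun r y => r * q * (x + y) - t * r ^ 2).
  assert (Hec : forall r y, continuity_2d_pt e r y) by (intros; unfold e; c2d).
  assert (HBc : forall r y, continuity_2d_pt B r y) by (intros; unfold B; c2d).
  assert (Heb : forall r y, 0 <= r -> 0 <= y -> 0 <= e r y <= C0 / (1 + r ^ 2)).
  { intros r y Hr Hy. unfold e. split; [apply Rlt_le, exp_pos|].
    apply Rle_trans with (exp (- (x * q * r))).
    { destruct (Rle_lt_or_eq_dec (- ((x + y) * q * r)) (- (x * q * r))) as [H | ->];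
        [|left; apply exp_increasing, H | right; reflexivity].
      assert (0 <= y * (q * r)) by (apply Rmult_le_pos; nra). nra. }
    replace (C0 / (1 + r ^ 2)) with (C0 / (1 + r ^ 2) ^ 1) by (rewrite pow_1; reflexivity).
    apply Rle_trans with (1 := HC r Hr). apply div_pow_succ_le; lra. }
  destruct (swappable_osc_0oo v e B q (- q) q q C0) as [S1 S2]; auto; try Rabs1.
  destruct (swappable_osc_0oo v e B (- q) q q q C0) as [S3 S4]; auto; try Rabs1.
  destruct (swappable_C_diff (Rbar_locally p_infty) _ _ _
     (fun y => v y * RtoC 2 * RtoC (PI * heat (x + y) t))%C nonneg_p_infty S1 S2 S3 S4)
     as [Psi1 [Psi2 [l1 [l2 [H1 [H2 [H3 [H4 H5]]]]]]]].
  { exists 0. intros b _ y Hy.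
    apply (is_RInt_gen_ext (V := C_R_NormedModule)
      (fun r => v y * RtoC 2 * RtoC (exp (- ((x + y) * q * r)) *
        (q * cos (r * q * (x + y) - t * r ^ 2) - q * sin (r * q * (x + y) - t * r ^ 2))))%C).
    { apply filter_forall. intros ab r _. unfold osc, e, B. destruct (v y) as [a b'].
      apply Ceq; simpl; ring. }
    apply is_CInt_Cmult, is_CInt_RtoC, RInt_0oo_ray; lra. }
  replace (int_Gamma _) with (l1 - l2)%C; [exact H5|]. unfold int_Gamma.
  assert (G : forall (W : C) (r : R) (E : R -> C) (Psi : C), W <> 0%C ->
     (forall y, Cexp (Ci * (RtoC r * W) * RtoC x - (RtoC r * W) ^ 2 * RtoC t
            + - (Ci * - (RtoC r * W) * RtoC y)) * W = E y)%C ->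
     is_CInt (fun y => v y * E y)%C (at_point 0) (Rbar_locally p_infty) Psi ->
     (utm_kernel (RtoC r * W) x t * u0_hat u0 (- (RtoC r * W)) * W)%C = Psi).
  { intros W r E Psi HW HE HPsi.
    transitivity (utm_kernel (RtoC r * W) x t * W * u0_hat u0 (- (RtoC r * W)))%C; [ring|].
    unfold u0_hat, int_halfline.
    apply Cmult_RInt_gen; [apply Cmult_neq_0; [apply Cexp_neq_0 | exact HW]|].
    apply is_RInt_0oo_ext with (2 := HPsi). intros y Hy.
    rewrite <- HE, Cexp_plus, (Hvu y Hy). unfold utm_kernel. cring. }
  f_equal; [|f_equal]; symmetry; unfold int_ray, int_halfline; apply RInt_gen_C_unique.
  - apply is_RInt_0oo_ext with (2 := H3). intros r Hr. symmetry.
    apply (G _ r (osc e q (- q) q q B r) (Psi1 r)); [apply Cexp_neq_0 | | apply H1; lra].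
    intros y. rewrite Cexp_PI4. fold q. unfold osc, e, B.
    replace (Ci * (RtoC r * (q, q)) * RtoC x - (RtoC r * (q, q)) ^ 2 * RtoC t
            + - (Ci * - (RtoC r * (q, q)) * RtoC y))%C
      with (- ((x + y) * q * r), r * q * (x + y) - t * r ^ 2 * (2 * q ^ 2)) by (apply Ceq; simpl; ring).
    rewrite Hq2, Rmult_1_r.
    unfold Cexp, Re, Im; cbn [fst snd]. apply Ceq; unfold Cmult, Re, Im; cbn [fst snd]; ring.
  - apply is_RInt_0oo_ext with (2 := H4). intros r Hr. symmetry.
    apply (G _ r (osc e (- q) q q q B r) (Psi2 r)); [apply Cexp_neq_0 | | apply H2; lra].
    intros y. rewrite Cexp_3PI4. fold q. unfold osc, e, B.
    replace (Ci * (RtoC r * ((- q)%R, q)) * RtoC x - (RtoC r * ((- q)%R, q)) ^ 2 * RtoC t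
            + - (Ci * - (RtoC r * ((- q)%R, q)) * RtoC y))%C
      with (- ((x + y) * q * r), - (r * q * (x + y) - t * r ^ 2 * (2 * q ^ 2))) by (apply Ceq; simpl; ring).
    rewrite Hq2, Rmult_1_r.
    unfold Cexp, Re, Im; cbn [fst snd]. rewrite cos_neg, sin_neg.
    apply Ceq; unfold Cmult, Re, Im; cbn [fst snd]; ring.
Qed.

(** After multiplication by the kernel, the datum at time y is propagated over the time t - y. The
    closed form is available only for y < t, whereas the domination, coming from exp(i l x), is
    uniform up to y = t; this is enough for the exchange. *)
Lemma int_Gamma_heat_segment (g0 g : R -> C) (x t : R) :
  0 < x -> 0 < t ->
  (forall y, continuous (fun y => Re (g y)) y) -> (forall y, continuous (fun y => Im (g y)) y) ->
  (forall y, 0 < y -> g y = g0 y) ->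
  is_CInt (fun y => g y * (RtoC 2 * Ci) * RtoC (x / (2 * (t - y)) * (PI * heat x (t - y))))%C (at_point 0) (at_point t)
    (int_Gamma (fun l => utm_kernel l x t * l * g0_tilde g0 l t)%C).
Proof.
  intros Hx Ht Hgr Hgi Hg.
  destruct inv_sqrt2_facts as [Hq Hq2]. set (q := / sqrt 2) in *.
  assert (Hq1 : q < 1) by nra.
  destruct (exp_neg_dominated (x * q)) as [C0 [HC0 HC]]; [nra|].
  set (e := fun r (_ : R) => r * exp (- (x * q * r))). set (B := fun r y => r * q * x - (t - y) * r ^ 2).
  assert (Hec : forall r y, continuity_2d_pt e r y) by (intros; unfold e; c2d).
  assert (HBc : forall r y, continuity_2d_pt B r y) by (intros; unfold B; c2d).
  assert (Heb : forall r y, 0 <= r -> 0 <= y -> 0 <= e r y <= C0 / (1 + r ^ 2)).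
  { intros r y Hr Hy. unfold e. split; [apply Rmult_le_pos; [exact Hr | apply Rlt_le, exp_pos]|].
    replace (C0 / (1 + r ^ 2)) with (C0 / (1 + r ^ 2) ^ 1) by (rewrite pow_1; reflexivity).
    apply Rle_trans with (r * (C0 / (1 + r ^ 2) ^ 2)).
    { apply Rmult_le_compat_l; [exact Hr | apply HC, Hr]. }
    apply div_pow_succ_mult_le; [lra | nra]. }
  assert (Hbt : at_point t (fun b => 0 <= b)) by (unfold at_point; lra).
  (* The product of l and dl is i r dr on the first ray and - i r dr on the second, so the
     difference is 2 i r cos B times the amplitude exp(- x q r). *)
  destruct (swappable_osc_segment g e B 0 (-1) 1 0 C0 t) as [S1 S2]; auto; try lra; try Rabs1.
  destruct (swappable_osc_segment g e B 0 (-1) (-1) 0 C0 t) as [S3 S4]; auto; try lra; try Rabs1.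
  destruct (swappable_C_diff (at_point t) _ _ _
     (fun y => g y * (RtoC 2 * Ci) * RtoC (x / (2 * (t - y)) * (PI * heat x (t - y))))%C Hbt S1 S2 S3 S4)
     as [Psi1 [Psi2 [l1 [l2 [H1 [H2 [H3 [H4 H5]]]]]]]].
  { intros y Hy.
    apply (is_RInt_gen_ext (V := C_R_NormedModule)
      (fun r => g y * (RtoC 2 * Ci) * RtoC (r * exp (- (x * q * r)) * cos (r * q * x - (t - y) * r ^ 2)))%C).
    { apply filter_forall. intros ab r _. unfold osc, e, B. destruct (g y) as [a b'].
      apply Ceq; simpl; ring. }
    apply is_CInt_Cmult, is_CInt_RtoC, RInt_0oo_ray_weighted; lra. }
  replace (int_Gamma _) with (l1 - l2)%C; [exact H5|]. unfold int_Gamma.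
  assert (G : forall (W : C) (r : R) (E : R -> C) (Psi : C), W <> 0%C -> 0 < r ->
     (forall y, Cexp (Ci * (RtoC r * W) * RtoC x - (RtoC r * W) ^ 2 * RtoC t
            + (RtoC r * W) ^ 2 * RtoC y) * (RtoC r * W) * W = E y)%C ->
     is_CInt (fun y => g y * E y)%C (at_point 0) (at_point t) Psi ->
     (utm_kernel (RtoC r * W) x t * (RtoC r * W) * g0_tilde g0 (RtoC r * W) t * W)%C = Psi).
  { intros W r E Psi HW Hr HE HPsi.
    set (c := (utm_kernel (RtoC r * W) x t * (RtoC r * W) * W)%C).
    assert (Hc : c <> 0%C).
    { unfold c. apply Cmult_neq_0; [apply Cmult_neq_0; [apply Cexp_neq_0 | apply Cmult_neq_0]|]; try exact HW.
      intros H0. apply (f_equal Re) in H0. simpl in H0. lra. }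
    assert (HI : is_CInt (fun y => c * (Cexp ((RtoC r * W) ^ 2 * RtoC y) * g0 y))%C (at_point 0) (at_point t) Psi).
    { apply (is_RInt_gen_0_ext (V := C_R_NormedModule) (at_point t) _ (fun y => g y * E y)%C); [exact Hbt | | exact HPsi].
      intros y Hy. rewrite <- HE, Cexp_plus, (Hg y) by apply Hy. unfold c, utm_kernel. cring. }
    apply is_CInt_Cmult_inv in HI; [| exact Hc].
    apply (is_RInt_gen_at_point (V := C_R_NormedModule)) in HI.
    apply (is_RInt_unique (V := C_R_CompleteNormedModule)) in HI.
    unfold g0_tilde. rewrite HI.
    transitivity (c * / c * Psi)%C; [unfold c; ring|].
    rewrite Cinv_r, Cmult_1_l by exact Hc. reflexivity. }
  f_equal; [|f_equal]; symmetry; unfold int_ray, int_halfline; apply RInt_gen_C_unique.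
  - apply is_RInt_0oo_ext with (2 := H3). intros r Hr. symmetry.
    apply (G _ r (osc e 0 (-1) 1 0 B r) (Psi1 r)); [apply Cexp_neq_0 | exact Hr | | apply H1; lra].
    intros y. rewrite Cexp_PI4. fold q. unfold osc, e, B.
    replace (Ci * (RtoC r * (q, q)) * RtoC x - (RtoC r * (q, q)) ^ 2 * RtoC t
            + (RtoC r * (q, q)) ^ 2 * RtoC y)%C
      with (- (x * q * r), r * q * x - (t - y) * r ^ 2 * (2 * q ^ 2)) by (apply Ceq; simpl; ring).
    rewrite <- Cmult_assoc.
    replace (RtoC r * (q, q) * (q, q))%C with (0, r * (2 * q ^ 2)) by (apply Ceq; simpl; ring).
    rewrite Hq2, !Rmult_1_r.
    unfold Cexp, Re, Im; cbn [fst snd]. apply Ceq; unfold Cmult, Re, Im; cbn [fst snd]; ring.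
  - apply is_RInt_0oo_ext with (2 := H4). intros r Hr. symmetry.
    apply (G _ r (osc e 0 (-1) (-1) 0 B r) (Psi2 r)); [apply Cexp_neq_0 | exact Hr | | apply H2; lra].
    intros y. rewrite Cexp_3PI4. fold q. unfold osc, e, B.
    replace (Ci * (RtoC r * ((- q)%R, q)) * RtoC x - (RtoC r * ((- q)%R, q)) ^ 2 * RtoC t
            + (RtoC r * ((- q)%R, q)) ^ 2 * RtoC y)%C
      with (- (x * q * r), - (r * q * x - (t - y) * r ^ 2 * (2 * q ^ 2))) by (apply Ceq; simpl; ring).
    rewrite <- Cmult_assoc.
    replace (RtoC r * ((- q)%R, q) * ((- q)%R, q))%C with (0, - (r * (2 * q ^ 2))) by (apply Ceq; simpl; ring).
    rewrite Hq2, !Rmult_1_r.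
    unfold Cexp, Re, Im; cbn [fst snd]. rewrite cos_neg, sin_neg.
    apply Ceq; unfold Cmult, Re, Im; cbn [fst snd]; ring.
Qed.

(** * Heat potentials and their derivatives *)

(** [heat1], [heat2], [heat3] are the z-derivatives of the kernel; by the heat equation [heat2] is
    also its s-derivative. *)
Definition heat1 (z s : R) : R := - (z / (2 * s)) * heat z s.
Definition heat2 (z s : R) : R := (z ^ 2 / (4 * s ^ 2) - 1 / (2 * s)) * heat z s.
Definition heat3 (z s : R) : R := (3 * z / (4 * s ^ 2) - z ^ 3 / (8 * s ^ 3)) * heat z s.

(* Valid for every [s]: the kernel vanishes for [s <= 0], since [sqrt] does and [/ 0 = 0]. *)
Lemma is_derive_heat (z s : R) : is_derive (fun z => heat z s) z (heat1 z s).
Proof.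
  unfold heat1, heat, Rdiv. rewrite !Rinv_mult.
  set (c := / s). set (d := / sqrt (4 * PI * s)).
  auto_derive; [auto|]. simpl. field.
Qed.

Lemma is_derive_heat1 (z s : R) : is_derive (fun z => heat1 z s) z (heat2 z s).
Proof.
  assert (H := is_derive_heat z s). unfold heat1 in *.
  auto_derive; [eexists; exact H|]. rewrite (Derive_eta _ _ _ H). unfold heat2, Rdiv.
  rewrite !Rinv_mult, <- !pow_inv. set (c := / s). simpl. field.
Qed.

Lemma is_derive_heat2 (z s : R) : is_derive (fun z => heat2 z s) z (heat3 z s).
Proof.
  assert (H := is_derive_heat z s). unfold heat1, heat2 in *.
  auto_derive; [eexists; exact H|]. rewrite (Derive_eta _ _ _ H). unfold heat3, Rdiv.
  simpl. rewrite !Rinv_mult. set (c := / s). rewrite !Rinv_1. field.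
Qed.

Lemma heat_nonneg (z s : R) : 0 <= heat z s.
Proof.
  unfold heat, Rdiv. apply Rmult_le_pos; [apply Rlt_le, exp_pos|].
  destruct (Rle_lt_or_eq_dec 0 (sqrt (4 * PI * s)) (sqrt_pos _)) as [H | <-].
  - apply Rlt_le, Rinv_0_lt_compat, H.
  - rewrite Rinv_0. apply Rle_refl.
Qed.

Lemma heat_nonpos_time (z s : R) : s <= 0 -> heat z s = 0.
Proof.
  intros Hs. unfold heat. rewrite (sqrt_neg_0 (4 * PI * s)); [unfold Rdiv; rewrite Rinv_0; ring|].
  generalize PI_RGT_0; nra.
Qed.

(** Everything follows from E (1 + z^2 / (4 t)) <= 1 for the exponential E. These bounds are uniform
    in z but not in t; they justify differentiation of the potentials at a fixed time. *)
Lemma heat_bounds (t : R) : 0 < t ->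
  exists M, forall z, Rabs (heat z t) <= M /\ Rabs (heat1 z t) <= M /\ Rabs (heat2 z t) <= M.
Proof.
  intros Ht. assert (HPI := PI_RGT_0).
  assert (Hs : 0 < / sqrt (4 * PI * t)) by (apply Rinv_0_lt_compat, sqrt_lt_R0; nra).
  assert (Hit : 0 < / t) by (apply Rinv_0_lt_compat, Ht).
  set (d := / sqrt (4 * PI * t)) in *. set (c := / t) in *.
  assert (Hct : c * t = 1) by (unfold c; field; lra).
  exists (d * (1 + c * (1 + 4 * t) + 4 * c)). intros z.
  assert (E0 := heat_nonneg z t).
  assert (Eu : 0 <= z ^ 2 / (4 * t)) by (apply Rdiv_le_0_compat; nra).
  assert (E1 := exp_neg_le_inv (z ^ 2 / (4 * t)) Eu).
  set (E := exp (- (z ^ 2 / (4 * t)))) in *.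
  assert (HE : 0 < E) by apply exp_pos.
  assert (E2 : E * (1 + z ^ 2 / (4 * t)) <= 1).
  { apply Rle_trans with (/ (1 + z ^ 2 / (4 * t)) * (1 + z ^ 2 / (4 * t))).
    - apply Rmult_le_compat_r; [lra | exact E1].
    - right. apply Rinv_l. lra. }
  replace (z ^ 2 / (4 * t)) with (z ^ 2 * c / 4) in * by (unfold c; field; lra).
  assert (HH : heat z t = d * E) by (unfold heat, d, E, Rdiv; ring_simplify; f_equal; ring).
  assert (E3 : z ^ 2 * E <= 4 * t).
  { replace (z ^ 2 * E) with (4 * t * (E * (z ^ 2 * c / 4))).
    - assert (E * (z ^ 2 * c / 4) <= 1) by nra. nra.
    - replace (4 * t * (E * (z ^ 2 * c / 4))) with (c * t * (z ^ 2 * E)) by field. rewrite Hct. ring. }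
  assert (E4 : E <= 1) by nra.
  assert (E5 : Rabs z * E <= 1 + 4 * t).
  { assert (Rabs z <= 1 + z ^ 2) by (apply Rabs_le; nra). nra. }
  split; [|split].
  - rewrite Rabs_pos_eq, HH by exact E0. apply Rmult_le_compat_l; nra.
  - unfold heat1. rewrite Rabs_mult, Rabs_Ropp, (Rabs_pos_eq (heat z t)), HH by exact E0.
    replace (z / (2 * t)) with (z * (c / 2)) by (unfold c; field; lra).
    rewrite Rabs_mult, (Rabs_pos_eq (c / 2)) by lra.
    replace (Rabs z * (c / 2) * (d * E)) with (d * (c / 2 * (Rabs z * E))) by ring.
    apply Rmult_le_compat_l; [lra|]. assert (c / 2 * (Rabs z * E) <= c / 2 * (1 + 4 * t)) by (apply Rmult_le_compat_l; lra).
    nra.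
  - unfold heat2. rewrite Rabs_mult, (Rabs_pos_eq (heat z t)), HH by exact E0.
    replace (z ^ 2 / (4 * t ^ 2) - 1 / (2 * t)) with (c * (z ^ 2 * c / 4) - c / 2) by (unfold c; field; lra).
    replace (Rabs (c * (z ^ 2 * c / 4) - c / 2) * (d * E)) with (d * (E * Rabs (c * (z ^ 2 * c / 4) - c / 2))) by ring.
    apply Rmult_le_compat_l; [lra|].
    apply Rle_trans with (E * (c * (1 + z ^ 2 * c / 4))).
    + apply Rmult_le_compat_l; [lra|]. apply Rabs_le. nra.
    + replace (E * (c * (1 + z ^ 2 * c / 4))) with (c * (E * (1 + z ^ 2 * c / 4))) by ring. nra.
Qed.

Definition dominated (u : R -> R) : Prop :=
  (forall y, continuous u y) /\ exists C, forall y, 0 <= y -> Rabs (u y) <= C / (1 + y ^ 2).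

(** With sg = 1 the source is at y, with sg = -1 at its mirror image - y, which is how the sum and
    difference in N and D arise. *)
Definition pot (sg t : R) (u : R -> R) (x : R) : R :=
  RInt_gen (V := R_CompleteNormedModule) (fun y => heat (x - sg * y) t * u y) (at_point 0) (Rbar_locally p_infty).

Lemma ex_RInt_0oo_mult (k u : R -> R) (M : R) :
  (forall y, continuous k y) -> (forall y, Rabs (k y) <= M) -> dominated u ->
  exists l, is_RInt_0oo (fun y => k y * u y) l.
Proof.
  intros Hk HM [Hu [C HC]].
  destruct (RInt_0oo_dominated (fun y => k y * u y) (M * C)) as [l [Hl _]].
  - intros y. apply (continuous_mult (K := R_AbsRing) k u); auto.
  - intros y Hy. rewrite Rabs_mult. unfold Rdiv. rewrite Rmult_assoc.
    apply Rmult_le_compat; auto using Rabs_pos.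
  - exists l. exact Hl.
Qed.

Lemma continuous_heat_shift (f : R -> R -> R) (f' : R -> R -> R) (sg t x y : R) :
  (forall z, is_derive (fun z => f z t) z (f' z t)) -> continuous (fun y => f (x - sg * y) t) y.
Proof.
  intros H. apply (continuous_comp (fun y => x - sg * y) (fun z => f z t)); [cont|].
  apply (continuous_of_derive _ _ _ (H _)).
Qed.

Lemma is_RInt_pot (sg t : R) (u : R -> R) (x : R) : 0 < t -> dominated u ->
  is_RInt_0oo (fun y => heat (x - sg * y) t * u y) (pot sg t u x).
Proof.
  intros Ht Hu. destruct (heat_bounds t Ht) as [M HM].
  destruct (ex_RInt_0oo_mult (fun y => heat (x - sg * y) t) u M) as [l Hl]; auto.
  - intros y. apply (continuous_heat_shift heat heat1). intros z. apply is_derive_heat.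
  - intros y. apply HM.
  - unfold pot. rewrite (is_RInt_gen_unique (V := R_CompleteNormedModule) _ l Hl). exact Hl.
Qed.

(** Differentiation under the integral puts the derivative on the kernel. Since it is - sg times a
    y-derivative, integration by parts moves it to [u] and leaves the boundary term at y = 0. *)
Lemma is_derive_pot (sg t : R) (u u1 : R -> R) (x : R) :
  0 < t -> sg * sg = 1 -> dominated u -> dominated u1 -> (forall y, is_derive u y (u1 y)) ->
  is_derive (pot sg t u) x (sg * (heat x t * u 0 + pot sg t u1 x)).
Proof.
  intros Ht Hsg Hu Hu1 Hd. destruct (heat_bounds t Ht) as [M HM].
  destruct (ex_RInt_0oo_mult (fun y => heat1 (x - sg * y) t) u M) as [psi Hpsi]; auto.
  { intros y. apply (continuous_heat_shift heat1 heat2). intros z. apply is_derive_heat1. }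
  { intros y. apply HM. }
  (* The Taylor remainder is dominated by M |u|, where [M] bounds [heat2]. *)
  assert (Hua : dominated (fun y => Rabs (u y))).
  { destruct Hu as [H1 [C H2]]. split.
    - intros y. apply (continuous_comp u Rabs); [apply H1 | apply continuous_Rabs].
    - exists C. intros y Hy. rewrite Rabs_Rabsolu. apply H2, Hy. }
  destruct (ex_RInt_0oo_mult (fun _ => M) (fun y => Rabs (u y)) (Rabs M)) as [d Hd']; auto.
  { intros y. apply continuous_const. }
  { intros y. apply Rle_refl. }
  assert (HI : is_RInt_0oo (fun y => - sg * heat1 (x - sg * y) t * u y + heat (x - sg * y) t * u1 y)
     (0 - heat (x - sg * 0) t * u 0)).
  { apply (is_RInt_0oo_derive (fun y => heat (x - sg * y) t * u y)).
    - intros y. assert (H1 := is_derive_heat (x - sg * y) t). assert (H2 := Hd y).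
      apply (is_derive_mult (fun y => heat (x - sg * y) t) u y (- sg * heat1 (x - sg * y) t)); [|exact H2|intros; apply Rmult_comm].
      apply (is_derive_comp (fun z => heat z t) (fun y => x - sg * y)); [exact H1|].
      auto_derive; [auto | ring].
    - intros y. apply (continuous_plus (V := R_NormedModule)).
      + apply (continuous_mult (K := R_AbsRing) (fun y => - sg * heat1 (x - sg * y) t) u); [|apply Hu].
        apply (continuous_scal_r (V := R_NormedModule) (- sg) (fun y => heat1 (x - sg * y) t)).
        apply (continuous_heat_shift heat1 heat2). intros z. apply is_derive_heat1.
      + apply (continuous_mult (K := R_AbsRing) (fun y => heat (x - sg * y) t) u1); [|apply Hu1].
        apply (continuous_heat_shift heat heat1). intros z. apply is_derive_heat.
    - destruct Hu as [_ [C HC]]. apply (is_lim_0_of_bound _ (M * C)). intros y Hy.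
      rewrite Rabs_mult. unfold Rdiv. rewrite Rmult_assoc.
      apply Rmult_le_compat; try apply Rabs_pos; [apply HM|].
      apply Rle_trans with (1 := HC y ltac:(lra)). apply Rmult_le_compat_l.
      + generalize (HC 0 (Rle_refl 0)) (Rabs_pos (u 0)).
        replace (C / (1 + 0 ^ 2)) with C by field. lra.
      + apply Rinv_le_contravar; nra. }
  assert (HI2 := is_RInt_gen_plus (V := R_NormedModule) _ _ _ _
       (is_RInt_gen_scal (V := R_NormedModule) _ (- sg) _ Hpsi) (is_RInt_pot sg t u1 x Ht Hu1)).
  assert (E : 0 - heat (x - sg * 0) t * u 0 = - sg * psi + pot sg t u1 x).
  { apply (is_RInt_0oo_unique _ _ _ HI). revert HI2. apply is_RInt_0oo_ext.
    intros y _. unfold plus, scal; simpl; unfold mult; simpl. rring. }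
  replace (x - sg * 0) with x in E by ring.
  replace (sg * (heat x t * u 0 + pot sg t u1 x)) with psi.
  2:{ replace (heat x t * u 0 + pot sg t u1 x) with (sg * psi) by lra.
      rewrite <- Rmult_assoc, Hsg, Rmult_1_l. reflexivity. }
  apply (is_derive_RInt_gen_param (Rbar_locally p_infty) _ (fun x y => heat (x - sg * y) t * u y)
    (fun y => heat1 (x - sg * y) t * u y) (fun y => M * Rabs (u y)) (pot sg t u) x psi d 1).
  - lra.
  - apply nonneg_p_infty.
  - intros x' _. apply is_RInt_pot; assumption.
  - exact Hpsi.
  - exact Hd'.
  - exists 0. intros b _ x' y Hx' _.
    replace (heat (x' - sg * y) t * u y - heat (x - sg * y) t * u y - (x' - x) * (heat1 (x - sg * y) t * u y))
      with ((heat (x' - sg * y) t - heat (x - sg * y) t - (x' - x) * heat1 (x - sg * y) t) * u y) by ring.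
    rewrite Rabs_mult, <- Rmult_assoc. apply Rmult_le_compat_r; [apply Rabs_pos|].
    replace (x' - x) with ((x' - sg * y) - (x - sg * y)) by ring.
    apply (taylor2_bound (fun z => heat z t) (fun z => heat1 z t) (fun z => heat2 z t) (x - sg * y) (x' - sg * y) M 1).
    + replace ((x' - sg * y) - (x - sg * y)) with (x' - x) by ring. exact Hx'.
    + intros z _. apply is_derive_heat.
    + intros z _. apply is_derive_heat1.
    + intros z _. apply HM.
Qed.

(** * The kernel for small times, away from z = 0 *)

(** The exponential is at most (20 s / a^2)^5, and dividing by sqrt s still leaves s^4. Four powers
    are one more than [heat3] consumes. The factored form lets the negative powers of s cancel
    algebraically. *)
Lemma heat_small_time (a T : R) : 0 < a -> 0 < T ->
  exists C, 0 <= C /\ forall z s, a <= z -> 0 < s <= T ->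
    exists h, 0 <= h <= C /\ heat z s = h * s ^ 4.
Proof.
  intros Ha HT. exists ((20 / a ^ 2) ^ 5 * (1 + T)). assert (HPI := PI_RGT_0).
  assert (Ha2 : 0 < 20 / a ^ 2) by (apply Rdiv_lt_0_compat; nra).
  split; [apply Rmult_le_pos; [apply pow_le; lra | lra]|].
  intros z s Hz Hs. assert (Hs4 : 0 < s ^ 4) by (apply pow_lt; lra).
  exists (heat z s / s ^ 4). split; [|field; lra].
  split; [apply Rdiv_le_0_compat; [apply heat_nonneg | exact Hs4]|].
  apply Rmult_le_reg_r with (s ^ 4); [exact Hs4|].
  replace (heat z s / s ^ 4 * s ^ 4) with (heat z s) by (field; lra).
  assert (Hz2 : a ^ 2 <= z ^ 2) by nra.
  assert (Hu : 0 < z ^ 2 / (4 * s)) by (apply Rdiv_lt_0_compat; nra).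
  assert (He : exp (- (z ^ 2 / (4 * s))) <= (20 / a ^ 2) ^ 5 * s ^ 5).
  { apply Rle_trans with (1 := exp_neg_le_inv_pow _ 5 ltac:(auto with arith) (Rlt_le _ _ Hu)).
    rewrite <- pow_inv, <- Rpow_mult_distr. apply pow_incr.
    simpl INR. split; [apply Rlt_le, Rinv_0_lt_compat; lra|].
    replace (20 / a ^ 2 * s) with (/ (a ^ 2 / (20 * s))) by (field; split; nra).
    apply Rinv_le_contravar; [apply Rdiv_lt_0_compat; nra|].
    replace (z ^ 2 / (4 * s) / (1 + 1 + 1 + 1 + 1)) with (z ^ 2 * / (20 * s)) by (field; lra).
    apply Rle_trans with (z ^ 2 * / (20 * s)); [|lra].
    apply Rmult_le_compat_r; [apply Rlt_le, Rinv_0_lt_compat; lra | exact Hz2]. }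
  assert (Hsq : 0 < sqrt s) by (apply sqrt_lt_R0; lra).
  assert (Hss : sqrt s * sqrt s = s) by (apply sqrt_sqrt; lra).
  assert (Hsq1 : sqrt s <= 1 + T) by nra.
  assert (Hsq2 : sqrt s <= sqrt (4 * PI * s)).
  { apply sqrt_le_1_alt. generalize PI2_1. nra. }
  unfold heat.
  apply Rle_trans with ((20 / a ^ 2) ^ 5 * s ^ 5 * / sqrt s).
  - apply Rmult_le_compat; [apply Rlt_le, exp_pos | apply Rlt_le, Rinv_0_lt_compat; lra | exact He |].
    apply Rinv_le_contravar; lra.
  - replace ((20 / a ^ 2) ^ 5 * s ^ 5 * / sqrt s) with ((20 / a ^ 2) ^ 5 * (s ^ 4 * sqrt s)).
    2:{ replace (s ^ 5) with (s ^ 4 * (sqrt s * sqrt s)) by (rewrite Hss; ring). field. split; nra. }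
    rewrite Rmult_assoc. apply Rmult_le_compat_l; [apply pow_le; lra|].
    rewrite Rmult_comm. apply Rmult_le_compat_r; lra.
Qed.

(** The factor s beyond boundedness is what gives continuity at s = 0, where the kernels take the
    value 0. The upper bound on z controls the polynomial factors. *)
Lemma heat_derivatives_bounded (a b T : R) : 0 < a -> 0 < T ->
  exists M, 0 <= M /\ forall z s, a <= z <= b -> 0 <= s <= T ->
    Rabs (heat z s) <= M * s /\ Rabs (heat1 z s) <= M * s /\ Rabs (heat2 z s) <= M * s /\
    Rabs (heat3 z s) <= M * s.
Proof.
  intros Ha HT. destruct (heat_small_time a T Ha HT) as [C [HC0 HC]].
  set (B := Rabs b).
  assert (HB : 0 <= B) by apply Rabs_pos.
  assert (P : forall i j, 0 <= C * (B ^ i * T ^ j)).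
  { intros i j. apply Rmult_le_pos; [exact HC0|]. apply Rmult_le_pos; apply pow_le; lra. }
  (* One summand for each monomial z^i s^(j+1) left once s^4 has cancelled the denominators; all
     coefficients have modulus at most 1. *)
  exists (C * (B ^ 0 * T ^ 3) + C * (B ^ 1 * T ^ 2) + C * (B ^ 2 * T ^ 1) + C * (B ^ 0 * T ^ 2)
     + C * (B ^ 1 * T ^ 1) + C * (B ^ 3 * T ^ 0)).
  assert (P1 := P 0%nat 3%nat). assert (P2 := P 1%nat 2%nat). assert (P3 := P 2%nat 1%nat).
  assert (P4 := P 0%nat 2%nat). assert (P5 := P 1%nat 1%nat). assert (P6 := P 3%nat 0%nat).
  split; [lra|].
  intros z s Hz [Hs0 HsT]. destruct (Rle_lt_or_eq_dec 0 s Hs0) as [Hs | <-].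
  2:{ unfold heat1, heat2, heat3. rewrite (heat_nonpos_time z 0) by lra.
      rewrite !Rmult_0_r, Rabs_R0. lra. }
  destruct (HC z s (proj1 Hz) (conj Hs HsT)) as [h [Hh Eh]].
  assert (HzB : 0 <= z <= B) by (unfold B; generalize (Rle_abs b); lra).
  assert (Q : forall i j, 0 <= h * (z ^ i * s ^ S j) <= C * (B ^ i * T ^ j) * s).
  { intros i j. assert (0 <= z ^ i) by (apply pow_le; lra). assert (0 <= s ^ j) by (apply pow_le; lra).
    assert (z ^ i <= B ^ i) by (apply pow_incr; lra). assert (s ^ j <= T ^ j) by (apply pow_incr; lra).
    split.
    - apply Rmult_le_pos; [lra|]. apply Rmult_le_pos; [assumption | apply pow_le; lra].
    - replace (h * (z ^ i * s ^ S j)) with (h * (z ^ i * s ^ j) * s) by (simpl; ring).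
      apply Rmult_le_compat_r; [lra|]. apply Rmult_le_compat; [lra | nra | lra |].
      apply Rmult_le_compat; assumption. }
  assert (Q1 := Q 0%nat 3%nat). assert (Q2 := Q 1%nat 2%nat). assert (Q3 := Q 2%nat 1%nat).
  assert (Q4 := Q 0%nat 2%nat). assert (Q5 := Q 1%nat 1%nat). assert (Q6 := Q 3%nat 0%nat).
  rewrite !Rmult_plus_distr_r.
  assert (S1 := Rmult_le_pos _ _ P1 Hs0). assert (S2 := Rmult_le_pos _ _ P2 Hs0).
  assert (S3 := Rmult_le_pos _ _ P3 Hs0). assert (S4 := Rmult_le_pos _ _ P4 Hs0).
  assert (S5 := Rmult_le_pos _ _ P5 Hs0). assert (S6 := Rmult_le_pos _ _ P6 Hs0).
  unfold heat1, heat2, heat3. rewrite Eh.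
  split; [|split; [|split]].
  - replace (h * s ^ 4) with (h * (z ^ 0 * s ^ 4)) by ring. apply Rabs_le. lra.
  - replace (- (z / (2 * s)) * (h * s ^ 4)) with (- (/ 2) * (h * (z ^ 1 * s ^ 3))) by (field; lra).
    apply Rabs_le. lra.
  - replace ((z ^ 2 / (4 * s ^ 2) - 1 / (2 * s)) * (h * s ^ 4))
      with (/ 4 * (h * (z ^ 2 * s ^ 2)) - / 2 * (h * (z ^ 0 * s ^ 3))) by (field; lra).
    apply Rabs_le. lra.
  - replace ((3 * z / (4 * s ^ 2) - z ^ 3 / (8 * s ^ 3)) * (h * s ^ 4))
      with (3 / 4 * (h * (z ^ 1 * s ^ 2)) - / 8 * (h * (z ^ 3 * s ^ 1))) by (field; lra).
    apply Rabs_le. lra.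
Qed.

Lemma continuous_null_past (f : R -> R) (M : R) :
  (forall s, s <= 0 -> f s = 0) -> (forall s, 0 <= s <= 1 -> Rabs (f s) <= M * s) ->
  (forall s, 0 < s -> continuous f s) -> forall s, continuous f s.
Proof.
  intros Hn HM Hc s. destruct (Rtotal_order s 0) as [Hs | [-> | Hs]].
  - apply (continuous_ext_loc f (fun _ => 0) s); [|apply continuous_const].
    assert (Hp : 0 < - s) by lra. exists (mkposreal _ Hp). intros y Hy.
    change (Rabs (y - s) < - s) in Hy. apply Rabs_def2 in Hy. symmetry. apply Hn. lra.
  - apply continuity_pt_filterlim, continuity_pt_locally. intros eps.
    rewrite (Hn 0) by lra.
    assert (Hd : 0 < Rmin 1 (eps / (Rabs M + 1))).
    { apply Rmin_pos; [lra|]. apply Rdiv_lt_0_compat; [apply cond_pos | generalize (Rabs_pos M); lra]. }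
    exists (mkposreal _ Hd). intros y Hy. change (Rabs (y - 0) < Rmin 1 (eps / (Rabs M + 1))) in Hy.
    rewrite Rminus_0_r in Hy |- *.
    destruct (Rle_lt_dec y 0) as [Hy0 | Hy0].
    { rewrite Hn, Rabs_R0 by exact Hy0. apply cond_pos. }
    rewrite (Rabs_pos_eq y) in Hy by lra.
    assert (Hy1 := Rlt_le_trans _ _ _ Hy (Rmin_l _ _)). assert (Hy2 := Rlt_le_trans _ _ _ Hy (Rmin_r _ _)).
    apply Rle_lt_trans with (1 := HM y ltac:(lra)).
    generalize (Rle_abs M) (Rabs_pos M). intros.
    apply Rle_lt_trans with ((Rabs M + 1) * y); [apply Rmult_le_compat_r; lra|].
    apply Rlt_le_trans with ((Rabs M + 1) * (eps / (Rabs M + 1))).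
    + apply Rmult_lt_compat_l; lra.
    + right. field. lra.
  - apply Hc, Hs.
Qed.

Lemma is_derive_heat_time_pos (z s : R) : 0 < s -> is_derive (heat z) s (heat2 z s).
Proof.
  intros Hs. assert (HPI := PI_RGT_0). assert (Hp : 0 < 4 * PI * s) by nra.
  assert (Hq : 0 < sqrt (4 * PI * s)) by (apply sqrt_lt_R0, Hp).
  unfold heat2, heat. auto_derive.
  - repeat split; lra.
  - assert (Hsq : sqrt (4 * PI * s) * sqrt (4 * PI * s) = 4 * PI * s) by (apply sqrt_sqrt; lra).
    set (w := sqrt (4 * PI * s)) in *.
    replace (z * (z * 1)) with (z ^ 2) by ring.
    change (z ^ 2 / (4 * s)) with (z ^ 2 * / (4 * s)). set (E := exp _).
    replace (4 * PI * 1) with (w * w / s) by (rewrite Hsq; field; lra).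
    field. lra.
Qed.

(** For x > 0 the extension of the kernels by zero to s <= 0 is continuous on the line, so the
    boundary integrals have no singularity at y = t and are ordinary integrals of continuous
    functions. *)
Lemma continuous_heat_family (x : R) : 0 < x ->
  (forall s, continuous (heat x) s) /\ (forall s, continuous (heat1 x) s) /\ (forall s, continuous (heat2 x) s).
Proof.
  intros Hx. destruct (heat_derivatives_bounded x x 1 Hx Rlt_0_1) as [M [_ HM]].
  assert (H0 : forall s, s <= 0 -> heat x s = 0) by (intros; apply heat_nonpos_time; assumption).
  assert (Hd : forall s, 0 < s -> ex_derive (heat x) s).
  { intros s Hs. eexists. apply is_derive_heat_time_pos, Hs. }
  split; [|split]; apply continuous_null_past with M.
  - exact H0.
  - intros s Hs. apply (HM x s); lra.
  - intros s Hs. apply continuous_of_ex_derive, Hd, Hs.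
  - intros s Hs. unfold heat1. rewrite (H0 s Hs). ring.
  - intros s Hs. apply (HM x s); lra.
  - intros s Hs. apply continuous_of_ex_derive. unfold heat1. assert (H := Hd s Hs).
    auto_derive. repeat split; [lra | exact H].
  - intros s Hs. unfold heat2. rewrite (H0 s Hs). ring.
  - intros s Hs. apply (HM x s); lra.
  - intros s Hs. apply continuous_of_ex_derive. unfold heat2. assert (H := Hd s Hs).
    auto_derive. repeat split; [nra | lra | exact H].
Qed.

(** The heat equation, including s <= 0: at s = 0 the difference quotient is O(s^3). Integration by
    parts in time can then be carried out up to the endpoint y = t. *)
Lemma is_derive_heat_time (x s : R) : 0 < x -> is_derive (heat x) s (heat2 x s).
Proof.
  intros Hx. destruct (Rtotal_order s 0) as [Hs | [-> | Hs]].
  - unfold heat2. rewrite (heat_nonpos_time x s), Rmult_0_r by lra.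
    apply (is_derive_ext_loc (fun _ => 0)); [|apply (is_derive_const (V := R_NormedModule) 0)].
    assert (Hp : 0 < - s) by lra. exists (mkposreal _ Hp). intros y Hy.
    change (Rabs (y - s) < - s) in Hy. apply Rabs_def2 in Hy. symmetry. apply heat_nonpos_time. lra.
  - unfold heat2. rewrite (heat_nonpos_time x 0), Rmult_0_r by lra.
    destruct (heat_small_time x 1 Hx Rlt_0_1) as [C [HC0 HC]].
    apply is_derive_Reals. intros eps Heps.
    assert (Hd : 0 < Rmin 1 (eps / (C + 1))).
    { apply Rmin_pos; [lra|]. apply Rdiv_lt_0_compat; lra. }
    exists (mkposreal _ Hd). simpl. intros y Hy0 Hy.
    rewrite Rplus_0_l, (heat_nonpos_time x 0), !Rminus_0_r by lra.
    destruct (Rle_lt_dec y 0) as [Hyn | Hyp].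
    { rewrite heat_nonpos_time by exact Hyn. unfold Rdiv. rewrite Rmult_0_l, Rabs_R0. exact Heps. }
    rewrite (Rabs_pos_eq y) in Hy by lra.
    assert (Hy1 := Rlt_le_trans _ _ _ Hy (Rmin_l _ _)). assert (Hy2 := Rlt_le_trans _ _ _ Hy (Rmin_r _ _)).
    destruct (HC x y) as [h [Hh ->]]; [lra | lra |].
    replace (h * y ^ 4 / y) with (h * y ^ 2 * y) by (field; lra).
    rewrite Rabs_pos_eq by (apply Rmult_le_pos; nra).
    apply Rle_lt_trans with ((C + 1) * y).
    + apply Rmult_le_compat_r; [lra|]. assert (0 <= y ^ 2 <= 1) by nra. nra.
    + apply Rlt_le_trans with ((C + 1) * (eps / (C + 1))).
      * apply Rmult_lt_compat_l; lra.
      * right. field. lra.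
  - apply is_derive_heat_time_pos, Hs.
Qed.

(** * Boundary potentials *)

Definition lat (k : R -> R -> R) (g : R -> R) (t x : R) : R := RInt (fun y => k x (t - y) * g y) 0 t.

Lemma continuous_lat (k g : R -> R) (t y : R) :
  (forall s, continuous k s) -> (forall s, continuous g s) -> continuous (fun y => k (t - y) * g y) y.
Proof.
  intros Hk Hg. apply (continuous_mult (K := R_AbsRing) (fun y => k (t - y)) g); [|apply Hg].
  apply (continuous_comp (fun y => t - y) k); [cont | apply Hk].
Qed.

Lemma is_derive_lat (k k1 k2 : R -> R -> R) (g : R -> R) (t x : R) :
  0 < t -> 0 < x -> (forall y, continuous g y) ->
  (forall x, 0 < x -> forall s, continuous (k x) s) -> (forall x, 0 < x -> forall s, continuous (k1 x) s) ->
  (forall z s, is_derive (fun z => k z s) z (k1 z s)) ->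
  (forall z s, is_derive (fun z => k1 z s) z (k2 z s)) ->
  (forall a b, 0 < a -> exists M, forall z s, a <= z <= b -> 0 <= s <= t -> Rabs (k2 z s) <= M) ->
  is_derive (lat k g t) x (lat k1 g t x).
Proof.
  intros Ht Hx Hg Hk Hk1 Hd1 Hd2 HM.
  (* Within distance x / 2 of x one stays in this interval, away from the singular point z = 0. *)
  destruct (HM (x / 2) (2 * x)) as [M HM2]; [lra|].
  assert (Hga : forall y, continuous (fun y => M * Rabs (g y)) y).
  { intros y. apply (continuous_scal_r (V := R_NormedModule) M (fun y => Rabs (g y))).
    apply (continuous_comp g Rabs); [apply Hg | apply continuous_Rabs]. }
  apply (is_derive_RInt_gen_param (at_point t) _ (fun x y => k x (t - y) * g y)
    (fun y => k1 x (t - y) * g y) (fun y => M * Rabs (g y)) (lat k g t) x _ (RInt (fun y => M * Rabs (g y)) 0 t) (x / 2)).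
  - lra.
  - unfold at_point. lra.
  - intros x' Hx'. apply Rabs_def2 in Hx'. apply is_RInt_gen_at_point.
    apply (is_RInt_cont (fun y => k x' (t - y) * g y)). intros y. apply continuous_lat; [apply Hk; lra | exact Hg].
  - apply is_RInt_gen_at_point. apply (is_RInt_cont (fun y => k1 x (t - y) * g y)).
    intros y. apply continuous_lat; [apply Hk1; lra | exact Hg].
  - apply is_RInt_gen_at_point. apply (is_RInt_cont (fun y => M * Rabs (g y))). exact Hga.
  - intros x' y Hx' Hy.
    replace (k x' (t - y) * g y - k x (t - y) * g y - (x' - x) * (k1 x (t - y) * g y))
      with ((k x' (t - y) - k x (t - y) - (x' - x) * k1 x (t - y)) * g y) by ring.
    rewrite Rabs_mult, <- Rmult_assoc. apply Rmult_le_compat_r; [apply Rabs_pos|].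
    apply (taylor2_bound (fun z => k z (t - y)) (fun z => k1 z (t - y)) (fun z => k2 z (t - y)) x x' M (x / 2) Hx').
    + intros z _. apply Hd1.
    + intros z _. apply Hd2.
    + intros z Hz. apply Rabs_def2 in Hz. apply HM2; lra.
Qed.

Lemma is_derive_lat_heat (g : R -> R) (t x : R) :
  0 < t -> 0 < x -> (forall y, continuous g y) -> is_derive (lat heat g t) x (lat heat1 g t x).
Proof.
  intros Ht Hx Hg. apply is_derive_lat with heat2; auto.
  - intros z Hz. apply (continuous_heat_family z Hz).
  - intros z Hz. apply (continuous_heat_family z Hz).
  - apply is_derive_heat.
  - apply is_derive_heat1.
  - intros a b Ha. destruct (heat_derivatives_bounded a b t Ha Ht) as [M [HM0 HM]].
    exists (M * t). intros z s Hz Hs. apply Rle_trans with (M * s); [apply (HM z s Hz Hs)|].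
    apply Rmult_le_compat_l; lra.
Qed.

(** The kernel becomes [heat2], a time derivative by the heat equation, and integration by parts in
    time moves it to [g]. The boundary term at y = t vanishes because x > 0, and the one at y = 0 is
    the singular term. *)
Lemma is_derive_lat_heat1 (g g1 : R -> R) (t x : R) :
  0 < t -> 0 < x -> (forall y, is_derive g y (g1 y)) -> (forall y, continuous g1 y) ->
  is_derive (lat heat1 g t) x (heat x t * g 0 + lat heat g1 t x).
Proof.
  intros Ht Hx Hg Hg1.
  assert (Hgc : forall y, continuous g y) by (intros y; apply (continuous_of_derive g y (g1 y)), Hg).
  destruct (continuous_heat_family x Hx) as [Hk0 [Hk1 Hk2]].
  replace (heat x t * g 0 + lat heat g1 t x) with (lat heat2 g t x).
  - apply is_derive_lat with heat3; auto.
    + intros z Hz. apply (continuous_heat_family z Hz).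
    + intros z Hz. apply (continuous_heat_family z Hz).
    + apply is_derive_heat1.
    + apply is_derive_heat2.
    + intros a b Ha. destruct (heat_derivatives_bounded a b t Ha Ht) as [M [HM0 HM]].
      exists (M * t). intros z s Hz Hs. apply Rle_trans with (M * s); [apply (HM z s Hz Hs)|].
      apply Rmult_le_compat_l; lra.
  - assert (HI : is_RInt (fun y => - heat2 x (t - y) * g y + heat x (t - y) * g1 y) 0 t
       (minus (heat x (t - t) * g t) (heat x (t - 0) * g 0))).
    { apply (is_RInt_derive (V := R_CompleteNormedModule) (fun y => heat x (t - y) * g y)).
      - intros y _.
        apply (is_derive_mult (fun y => heat x (t - y)) g y (- heat2 x (t - y))); [|apply Hg|intros; apply Rmult_comm].
        replace (- heat2 x (t - y)) with (-1 * heat2 x (t - y)) by ring.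
        apply (is_derive_comp (heat x) (fun y => t - y)); [apply is_derive_heat_time, Hx|].
        auto_derive; [auto | ring].
      - intros y _. apply (continuous_plus (V := R_NormedModule)).
        + apply (continuous_lat (fun s => - heat2 x s)); [|exact Hgc].
          intros s. apply (continuous_opp (V := R_NormedModule)), Hk2.
        + apply continuous_lat; assumption. }
    assert (H2 : is_RInt (fun y => heat2 x (t - y) * g y) 0 t (lat heat2 g t x)).
    { apply (is_RInt_cont (fun y => heat2 x (t - y) * g y)). intros y. apply continuous_lat; assumption. }
    assert (H0 : is_RInt (fun y => heat x (t - y) * g1 y) 0 t (lat heat g1 t x)).
    { apply (is_RInt_cont (fun y => heat x (t - y) * g1 y)). intros y. apply continuous_lat; assumption. }
    assert (H3 := is_RInt_minus (V := R_NormedModule) _ _ _ _ _ _ H0 H2).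
    assert (H4 : is_RInt (fun y => - heat2 x (t - y) * g y + heat x (t - y) * g1 y) 0 t
       (minus (lat heat g1 t x) (lat heat2 g t x))).
    { revert H3. apply is_RInt_ext. intros y _. unfold minus, plus, opp; simpl. rring. }
    assert (E := eq_trans (eq_sym (is_RInt_unique _ _ _ _ HI)) (is_RInt_unique _ _ _ _ H4)).
    revert E. unfold minus, plus, opp; simpl.
    rewrite Rminus_0_r, (heat_nonpos_time x (t - t)) by lra. lra.
Qed.

(** * Masses and limits of the potentials *)

(** For t > 0 this is erf(x / (2 sqrt t)) / 2, the integral of the kernel from 0 to x. *)
Definition gauss_cdf (x t : R) : R := gauss_prim (x / (2 * sqrt t)) / sqrt PI.

Lemma sqrt_PI_pos : 0 < sqrt PI.
Proof. apply sqrt_lt_R0, PI_RGT_0. Qed.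

Lemma gauss_cdf_opp (x t : R) : gauss_cdf (- x) t = - gauss_cdf x t.
Proof.
  unfold gauss_cdf. replace (- x / (2 * sqrt t)) with (- (x / (2 * sqrt t))) by (unfold Rdiv; ring).
  rewrite gauss_prim_opp. unfold Rdiv. ring.
Qed.

(** Dropping the nonnegative integral in [gauss_prim_sqr] gives the bound for nonnegative arguments;
    oddness gives the rest. *)
Lemma gauss_cdf_abs_le (x t : R) : Rabs (gauss_cdf x t) <= 1 / 2.
Proof.
  assert (H : forall y, 0 <= y -> gauss_prim y <= sqrt PI / 2).
  { intros y Hy. assert (HP := sqrt_PI_pos).
    assert (E : gauss_prim y ^ 2 <= (sqrt PI / 2) ^ 2).
    { replace ((sqrt PI / 2) ^ 2) with (PI / 4).
      2:{ replace ((sqrt PI / 2) ^ 2) with (sqrt PI * sqrt PI / 4) by field.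
          rewrite sqrt_sqrt; [reflexivity | apply Rlt_le, PI_RGT_0]. }
      rewrite <- (gauss_prim_sqr y Hy).
      enough (0 <= RInt (fun s => exp (- (y ^ 2 * (1 + s ^ 2))) / (1 + s ^ 2)) 0 1) by lra.
      apply RInt_ge_0; [lra | |].
      - apply ex_RInt_cont. intros s. cont. nra.
      - intros s _. apply Rdiv_le_0_compat; [apply Rlt_le, exp_pos | nra]. }
    apply Rsqr_incr_0_var; [rewrite !Rsqr_pow2; exact E | lra]. }
  assert (HP := sqrt_PI_pos).
  assert (Hp : forall y, 0 <= y -> 0 <= gauss_prim y / sqrt PI <= 1 / 2).
  { intros y Hy. split; [apply Rdiv_le_0_compat; [apply gauss_prim_nonneg, Hy | exact HP]|].
    apply Rmult_le_reg_r with (sqrt PI); [exact HP|].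
    replace (gauss_prim y / sqrt PI * sqrt PI) with (gauss_prim y) by (field; lra).
    specialize (H y Hy). lra. }
  unfold gauss_cdf. set (y := x / (2 * sqrt t)).
  destruct (Rle_lt_dec 0 y) as [Hy | Hy].
  - apply Rabs_le. specialize (Hp y Hy). lra.
  - specialize (Hp (- y) ltac:(lra)). rewrite gauss_prim_opp in Hp.
    apply Rabs_le. unfold Rdiv in *. lra.
Qed.

Lemma heat_gauss (z t : R) : 0 < t ->
  heat z t = exp (- (z / (2 * sqrt t)) ^ 2) * / (2 * sqrt t) * / sqrt PI.
Proof.
  intros Ht. assert (Hs : 0 < sqrt t) by (apply sqrt_lt_R0, Ht). assert (HP := sqrt_PI_pos).
  assert (HPI := PI_RGT_0).
  unfold heat. rewrite sqrt_mult, sqrt_mult by lra. replace (sqrt 4) with 2.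
  2:{ replace 4 with (2 ^ 2) by ring. rewrite sqrt_pow2; lra. }
  replace ((z / (2 * sqrt t)) ^ 2) with (z ^ 2 / (4 * t)).
  - field. lra.
  - replace t with (sqrt t * sqrt t) at 1 by (apply sqrt_sqrt; lra). field. lra.
Qed.

Lemma RInt_0oo_heat (sg x t : R) : 0 < t -> sg * sg = 1 ->
  is_RInt_0oo (fun y => heat (x - sg * y) t) (1 / 2 + gauss_cdf (sg * x) t).
Proof.
  intros Ht Hsg. assert (Hs : 0 < sqrt t) by (apply sqrt_lt_R0, Ht). assert (HP := sqrt_PI_pos).
  replace (1 / 2 + gauss_cdf (sg * x) t)
    with (sqrt PI / 2 / sqrt PI - gauss_prim ((0 - sg * x) / (2 * sqrt t)) / sqrt PI).
  2:{ replace (0 - sg * x) with (- (sg * x)) by ring. change (gauss_prim (- (sg * x) / (2 * sqrt t)) / sqrt PI)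
        with (gauss_cdf (- (sg * x)) t). rewrite gauss_cdf_opp. field. lra. }
  apply (is_RInt_0oo_derive (fun y => gauss_prim ((y - sg * x) / (2 * sqrt t)) / sqrt PI)).
  - intros y. assert (H := is_derive_gauss_prim ((y - sg * x) / (2 * sqrt t))).
    auto_derive; [eexists; exact H|]. unfold Rminus, Rdiv in H.
    rewrite (Derive_eta _ _ _ H), heat_gauss by exact Ht.
    replace (((x - sg * y) / (2 * sqrt t)) ^ 2) with (((y + - (sg * x)) * / (2 * sqrt t)) ^ 2).
    + simpl. unfold Rdiv. ring.
    + transitivity ((sg * sg * y ^ 2 - 2 * sg * x * y + sg * sg * x ^ 2) / (2 * sqrt t) ^ 2).
      * rewrite Hsg at 1. field. lra.
      * rewrite Hsg at 2. field. lra.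
  - intros y. apply (continuous_heat_shift heat heat1). intros z. apply is_derive_heat.
  - apply (is_lim_scal_r (fun y => gauss_prim ((y - sg * x) / (2 * sqrt t))) (/ sqrt PI) p_infty (sqrt PI / 2)).
    intros P HP'. destruct (is_lim_gauss_prim P HP') as [M HM].
    exists (M * (2 * sqrt t) + sg * x). intros y Hy. apply HM.
    apply Rmult_lt_reg_r with (2 * sqrt t); [lra|].
    replace ((y - sg * x) / (2 * sqrt t) * (2 * sqrt t)) with (y - sg * x) by (field; lra). lra.
Qed.

(** Half of the exponent absorbs |z| at the cost 2 sqrt t, and the other half is the kernel at time
    2 t up to sqrt 2; the constant 3 bounds 2 sqrt 2. The first moment is thus reduced to a mass at
    the doubled time. *)
Lemma heat_moment (z t : R) : 0 < t -> Rabs z * heat z t <= 3 * sqrt t * heat z (2 * t).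
Proof.
  intros Ht. assert (Hs : 0 < sqrt t) by (apply sqrt_lt_R0, Ht). assert (HPI := PI_RGT_0).
  assert (Hss : sqrt t * sqrt t = t) by (apply sqrt_sqrt; lra).
  unfold heat. replace (4 * PI * (2 * t)) with (2 * (4 * PI * t)) by ring.
  rewrite (sqrt_mult 2) by nra.
  assert (Hp : 0 < sqrt (4 * PI * t)) by (apply sqrt_lt_R0; nra).
  assert (H2 : 0 < sqrt 2) by (apply sqrt_lt_R0; lra).
  assert (H22 : sqrt 2 * sqrt 2 = 2) by (apply sqrt_sqrt; lra).
  assert (H23 : sqrt 2 <= 3 / 2) by nra.
  replace (- (z ^ 2 / (4 * t))) with (- (z ^ 2 / (8 * t)) + - (z ^ 2 / (8 * t))) by (field; lra).
  replace (z ^ 2 / (4 * (2 * t))) with (z ^ 2 / (8 * t)) by (field; lra).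
  rewrite exp_plus.
  assert (Hu : 0 <= z ^ 2 / (8 * t)) by (apply Rdiv_le_0_compat; nra).
  assert (He := exp_neg_le_inv _ Hu). set (E := exp (- (z ^ 2 / (8 * t)))) in *.
  assert (HE : 0 < E) by apply exp_pos.
  assert (Hz : Rabs z * E <= 2 * sqrt t).
  { apply Rle_trans with (Rabs z * / (1 + z ^ 2 / (8 * t))).
    - apply Rmult_le_compat_l; [apply Rabs_pos | exact He].
    - apply Rmult_le_reg_r with (1 + z ^ 2 / (8 * t)); [lra|].
      rewrite Rmult_assoc, Rinv_l, Rmult_1_r by lra.
      rewrite <- (pow2_abs z). set (a := Rabs z). assert (0 <= a) by apply Rabs_pos.
      apply Rmult_le_reg_r with (4 * sqrt t); [lra|].
      replace (2 * sqrt t * (1 + a ^ 2 / (8 * t)) * (4 * sqrt t))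
        with (8 * (sqrt t * sqrt t) + a ^ 2 * (sqrt t * sqrt t) / t) by (field; lra).
      rewrite Hss. replace (a ^ 2 * t / t) with (a ^ 2) by (field; lra).
      generalize (pow2_ge_0 (a - 2 * sqrt t)). intros. nra. }
  replace (Rabs z * (E * E / sqrt (4 * PI * t))) with (Rabs z * E * (E * / sqrt (4 * PI * t))) by (unfold Rdiv; ring).
  replace (3 * sqrt t * (E / (sqrt 2 * sqrt (4 * PI * t))))
    with (3 * sqrt t * / sqrt 2 * (E * / sqrt (4 * PI * t))) by (field; lra).
  apply Rmult_le_compat_r.
  - apply Rmult_le_pos; [lra | apply Rlt_le, Rinv_0_lt_compat, Hp].
  - apply Rle_trans with (1 := Hz).
    apply Rmult_le_reg_r with (sqrt 2); [exact H2|].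
    rewrite (Rmult_assoc (3 * sqrt t)), Rinv_l by lra. nra.
Qed.

(** The Lipschitz error L y is at most L (x + |x - sg y|). Its first part is integrated by the mass
    at time t, its second by [heat_moment] and the mass at time 2 t, both masses being at most 1. *)
Lemma pot_near (sg t x L : R) (u : R -> R) :
  0 < t -> 0 <= x -> sg = 1 \/ sg = -1 -> 0 <= L -> dominated u ->
  (forall y, 0 <= y -> Rabs (u y - u 0) <= L * y) ->
  Rabs (pot sg t u x - u 0 * (1 / 2 + gauss_cdf (sg * x) t)) <= L * (x + 3 * sqrt t).
Proof.
  intros Ht Hx Hsg HL Hu HLip.
  assert (Hsg2 : sg * sg = 1) by (destruct Hsg as [-> | ->]; ring).
  assert (Hs : 0 < sqrt t) by (apply sqrt_lt_R0, Ht).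
  assert (H1 := is_RInt_pot sg t u x Ht Hu).
  assert (H2 := RInt_0oo_heat sg x t Ht Hsg2).
  assert (H3 := RInt_0oo_heat sg x (2 * t) ltac:(lra) Hsg2).
  set (m := 1 / 2 + gauss_cdf (sg * x) t) in *. set (m' := 1 / 2 + gauss_cdf (sg * x) (2 * t)) in *.
  assert (Hm : m <= 1).
  { unfold m. generalize (gauss_cdf_abs_le (sg * x) t). intros H. apply Rabs_le_between in H. lra. }
  assert (Hm' : m' <= 1).
  { unfold m'. generalize (gauss_cdf_abs_le (sg * x) (2 * t)). intros H. apply Rabs_le_between in H. lra. }
  apply Rle_trans with (L * x * m + L * (3 * sqrt t) * m').
  2:{ assert (0 <= L * x) by nra. assert (0 <= L * (3 * sqrt t)) by nra. nra. }
  apply (RInt_gen_norm (V := R_CompleteNormedModule) (Fa := at_point 0) (Fb := Rbar_locally p_infty)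
    (fun y => heat (x - sg * y) t * u y - u 0 * heat (x - sg * y) t)
    (fun y => L * x * heat (x - sg * y) t + L * (3 * sqrt t) * heat (x - sg * y) (2 * t))).
  - exists (fun a => a = 0) (fun b => 0 <= b); [reflexivity | apply nonneg_p_infty |].
    simpl. intros a b -> Hb. exact Hb.
  - exists (fun a => a = 0) (fun b => 0 <= b); [reflexivity | apply nonneg_p_infty |].
    simpl. intros a b -> Hb y Hy. change (Rabs (heat (x - sg * y) t * u y - u 0 * heat (x - sg * y) t) <=
      L * x * heat (x - sg * y) t + L * (3 * sqrt t) * heat (x - sg * y) (2 * t)).
    replace (heat (x - sg * y) t * u y - u 0 * heat (x - sg * y) t)
      with ((u y - u 0) * heat (x - sg * y) t) by ring.
    assert (Hh := heat_nonneg (x - sg * y) t).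
    rewrite Rabs_mult, (Rabs_pos_eq (heat _ _)) by exact Hh.
    assert (Hy2 : y <= x + Rabs (x - sg * y)).
    { destruct Hsg as [-> | ->]; unfold Rabs; destruct (Rcase_abs _); lra. }
    assert (Hmo := heat_moment (x - sg * y) t Ht).
    apply Rle_trans with (L * y * heat (x - sg * y) t).
    { apply Rmult_le_compat_r; [exact Hh | apply HLip; lra]. }
    apply Rle_trans with (L * (x + Rabs (x - sg * y)) * heat (x - sg * y) t).
    { apply Rmult_le_compat_r; [exact Hh|]. apply Rmult_le_compat_l; assumption. }
    assert (L * (Rabs (x - sg * y) * heat (x - sg * y) t) <= L * (3 * sqrt t * heat (x - sg * y) (2 * t)))
      by (apply Rmult_le_compat_l; assumption).
    lra.
  - apply (is_RInt_gen_minus (V := R_NormedModule) _ _ _ _ H1), (is_RInt_gen_scal (V := R_NormedModule) _ (u 0) _ H2).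
  - apply (is_RInt_gen_plus (V := R_NormedModule) _ _ _ _
      (is_RInt_gen_scal (V := R_NormedModule) _ (L * x) _ H2) (is_RInt_gen_scal (V := R_NormedModule) _ (L * (3 * sqrt t)) _ H3)).
Qed.

(** The primitive - gauss_cdf x (t - y) cannot be used up to y = t: with division by zero,
    [gauss_cdf x 0] is 0 instead of the limit 1/2. The integral is therefore computed on [0, t - s],
    and s is sent to 0. *)
Lemma RInt_heat1_time (t x : R) : 0 < t -> 0 < x ->
  RInt (fun y => heat1 x (t - y)) 0 t = - (1 / 2) + gauss_cdf x t.
Proof.
  intros Ht Hx. destruct (continuous_heat_family x Hx) as [_ [Hk1 _]].
  assert (HP := sqrt_PI_pos).
  set (f := fun y => heat1 x (t - y)).
  assert (Hf : forall y, continuous f y).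
  { intros y. apply (continuous_comp (fun y => t - y) (heat1 x)); [cont | apply Hk1]. }
  assert (HI : forall s, 0 < s < t -> RInt f 0 (t - s) = - gauss_cdf x s + gauss_cdf x t).
  { intros s Hs0. apply is_RInt_unique.
    replace (- gauss_cdf x s + gauss_cdf x t) with (minus (- gauss_cdf x (t - (t - s))) (- gauss_cdf x (t - 0))).
    2:{ unfold minus, plus, opp; simpl. rewrite Rminus_0_r. replace (t - (t - s)) with s by ring. ring. }
    apply (is_RInt_derive (V := R_CompleteNormedModule) (fun y => - gauss_cdf x (t - y))).
    - intros y. rewrite Rmin_left, Rmax_right by lra. intros Hy.
      assert (Hq : 0 < sqrt (t - y)) by (apply sqrt_lt_R0; lra).
      assert (Hqq : sqrt (t - y) * sqrt (t - y) = t - y) by (apply sqrt_sqrt; lra).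
      assert (H := is_derive_gauss_prim (x / (2 * sqrt (t - y)))).
      unfold gauss_cdf. unfold Rdiv, Rminus in H, Hq, Hqq. auto_derive.
      + repeat split; try lra. eexists; exact H.
      + rewrite (Derive_eta _ _ _ H). unfold f, heat1. rewrite heat_gauss by lra.
        unfold Rminus, Rdiv in *. set (w := sqrt (t + - y)) in *. set (E := exp _).
        replace (t + - y) with (w * w) by exact Hqq. field. lra.
    - intros y _. apply Hf. }
  apply Rminus_diag_uniq. apply cond_eq. intros eps Heps. rewrite Rminus_0_r.
  assert (Hc : continuous (RInt f 0) t).
  { apply (continuous_of_derive _ _ (f t)), is_derive_RInt_cont, Hf. }
  apply continuity_pt_filterlim in Hc. rewrite continuity_pt_locally in Hc.
  assert (Heps2 : 0 < eps / 2) by lra.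
  destruct (Hc (mkposreal _ Heps2)) as [d Hd]. simpl in Hd.
  assert (Heps3 : 0 < eps / 2 * sqrt PI) by nra.
  destruct (is_lim_gauss_prim (ball (sqrt PI / 2) (mkposreal _ Heps3)) (locally_ball _ _)) as [M HM].
  (* If sqrt s <= c, then x / (2 sqrt s) is at least 2 (|M| + 1), beyond the threshold of the limit
     of [gauss_prim]. *)
  set (c := x / (4 * (Rabs M + 1))).
  assert (HM1 : 0 < Rabs M + 1) by (generalize (Rabs_pos M); lra).
  assert (Hc0 : 0 < c) by (apply Rdiv_lt_0_compat; lra).
  set (s := Rmin (Rmin (d / 2) (t / 2)) (c ^ 2)).
  assert (Hdp := cond_pos d).
  assert (Hs1 : s <= d / 2) by (apply Rle_trans with (1 := Rmin_l _ _), Rmin_l).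
  assert (Hs2 : s <= t / 2) by (apply Rle_trans with (1 := Rmin_l _ _), Rmin_r).
  assert (Hs3 : s <= c ^ 2) by apply Rmin_r.
  assert (Hs0 : 0 < s) by (repeat apply Rmin_pos; try lra; nra).
  assert (Hq : 0 < sqrt s) by (apply sqrt_lt_R0, Hs0).
  assert (Hqc : sqrt s <= c).
  { rewrite <- (sqrt_pow2 c) by lra. apply sqrt_le_1_alt, Hs3. }
  assert (HMx : M < x / (2 * sqrt s)).
  { apply Rle_lt_trans with (1 := Rle_abs M).
    apply Rmult_lt_reg_r with (2 * sqrt s); [lra|].
    replace (x / (2 * sqrt s) * (2 * sqrt s)) with x by (field; lra).
    assert (Ec : c * (4 * (Rabs M + 1)) = x) by (unfold c; field; lra).
    apply Rle_lt_trans with (Rabs M * (2 * c)); [apply Rmult_le_compat_l; [apply Rabs_pos | lra]|].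
    generalize (Rabs_pos M). intros. nra. }
  specialize (HM _ HMx). change (Rabs (gauss_prim (x / (2 * sqrt s)) - sqrt PI / 2) < eps / 2 * sqrt PI) in HM.
  assert (HM2 : Rabs (gauss_cdf x s - 1 / 2) < eps / 2).
  { unfold gauss_cdf.
    replace (gauss_prim (x / (2 * sqrt s)) / sqrt PI - 1 / 2)
      with ((gauss_prim (x / (2 * sqrt s)) - sqrt PI / 2) * / sqrt PI) by (field; lra).
    rewrite Rabs_mult, (Rabs_pos_eq (/ sqrt PI)) by (apply Rlt_le, Rinv_0_lt_compat, HP).
    apply Rmult_lt_reg_r with (sqrt PI); [exact HP|].
    rewrite Rmult_assoc, Rinv_l, Rmult_1_r by lra. exact HM. }
  assert (Hds := Hd (t - s)).
  assert (Hb : ball t d (t - s)).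
  { change (Rabs (t - s - t) < d). replace (t - s - t) with (- s) by ring. rewrite Rabs_Ropp, Rabs_pos_eq; lra. }
  specialize (Hds Hb). rewrite HI in Hds by lra.
  fold f. set (I := RInt f 0 t) in *. change (R : Type) in (type of I).
  apply Rabs_def2 in Hds. apply Rabs_def2 in HM2. apply Rabs_def1; lra.
Qed.

Lemma heat1_nonpos (x s : R) : 0 < x -> heat1 x s <= 0.
Proof.
  intros Hx. unfold heat1. destruct (Rle_lt_dec s 0) as [Hs | Hs].
  - rewrite heat_nonpos_time by exact Hs. lra.
  - assert (0 < x / (2 * s)) by (apply Rdiv_lt_0_compat; lra). generalize (heat_nonneg x s). nra.
Qed.

(** By [heat1_nonpos], - heat1 is a nonnegative weight, and its mass 1/2 - gauss_cdf x t is at most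
    1. *)
Lemma lat_heat1_near (t x e : R) (g : R -> R) :
  0 < t -> 0 < x -> (forall y, continuous g y) -> 0 <= e ->
  (forall y, 0 <= y <= t -> Rabs (g y - g 0) <= e) ->
  Rabs (lat heat1 g t x - g 0 * (- (1 / 2) + gauss_cdf x t)) <= e.
Proof.
  intros Ht Hx Hg He0 He. destruct (continuous_heat_family x Hx) as [_ [Hk1 _]].
  assert (Hf : forall y, continuous (fun y => heat1 x (t - y)) y).
  { intros y. apply (continuous_comp (fun y => t - y) (heat1 x)); [cont | apply Hk1]. }
  assert (Hm := RInt_heat1_time t x Ht Hx).
  assert (H1 := is_RInt_cont (fun y : R => heat1 x (t - y)) 0 t Hf). rewrite Hm in H1.
  assert (H2 : is_RInt (fun y => heat1 x (t - y) * g y) 0 t (lat heat1 g t x)).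
  { apply (is_RInt_cont (fun y => heat1 x (t - y) * g y)). intros y. apply continuous_lat; assumption. }
  apply Rle_trans with (- e * (- (1 / 2) + gauss_cdf x t)).
  2:{ generalize (gauss_cdf_abs_le x t). intros H. apply Rabs_le_between in H. nra. }
  apply (norm_RInt_le (V := R_CompleteNormedModule)
    (fun y => heat1 x (t - y) * g y - g 0 * heat1 x (t - y)) (fun y => - e * heat1 x (t - y)) 0 t).
  - lra.
  - intros y Hy. change (Rabs (heat1 x (t - y) * g y - g 0 * heat1 x (t - y)) <= - e * heat1 x (t - y)).
    replace (heat1 x (t - y) * g y - g 0 * heat1 x (t - y)) with ((g y - g 0) * heat1 x (t - y)) by ring.
    assert (Hn := heat1_nonpos x (t - y) Hx).
    rewrite Rabs_mult, (Rabs_left1 (heat1 _ _)) by exact Hn.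
    replace (- e * heat1 x (t - y)) with (e * - heat1 x (t - y)) by ring.
    apply Rmult_le_compat_r; [lra | apply He, Hy].
  - apply (is_RInt_minus (V := R_NormedModule) _ _ _ _ _ _ H2), (is_RInt_scal (V := R_NormedModule) _ _ _ (g 0) _ H1).
  - apply (is_RInt_scal (V := R_NormedModule) _ _ _ (- e) _ H1).
Qed.

(** The kernel satisfies heat x s <= 1 / (2 sqrt s) uniformly in x, and the integral of this
    majorant over [0,t] is sqrt t. *)
Lemma lat_heat_small (t x M : R) (h : R -> R) :
  0 < t -> 0 < x -> (forall y, continuous h y) -> (forall y, 0 <= y <= t -> Rabs (h y) <= M) ->
  Rabs (lat heat h t x) <= M * sqrt t.
Proof.
  intros Ht Hx Hh HM. destruct (continuous_heat_family x Hx) as [Hk0 _].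
  assert (Hf : forall y, continuous (fun y => heat x (t - y)) y).
  { intros y. apply (continuous_comp (fun y => t - y) (heat x)); [cont | apply Hk0]. }
  assert (HM0 : 0 <= M) by (generalize (HM 0 ltac:(lra)) (Rabs_pos (h 0)); lra).
  assert (H1 := is_RInt_cont (fun y : R => heat x (t - y)) 0 t Hf).
  assert (HS : RInt (fun y => heat x (t - y)) 0 t <= sqrt t).
  (* The majorant is singular at y = t. Instead of integrating it, the mean value theorem shows that
     F t >= F 0, which is the required inequality. *)
  { set (F := fun y => - sqrt (t - y) - RInt (fun y => heat x (t - y)) 0 y).
    destruct (MVT_gen F 0 t (fun y => / (2 * sqrt (t - y)) - heat x (t - y))) as [c [Hc Ec]].
    - intros y. rewrite Rmin_left, Rmax_right by lra. intros Hy.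
      apply (is_derive_minus (V := R_NormedModule)).
      + assert (Hq : 0 < sqrt (t - y)) by (apply sqrt_lt_R0; lra).
        auto_derive; [lra|]. unfold Rminus in *. field. lra.
      + apply (is_derive_RInt_cont (fun y => heat x (t - y))), Hf.
    - intros y _. apply continuity_pt_filterlim. apply (continuous_minus (V := R_NormedModule)).
      + apply (continuous_opp (V := R_NormedModule)).
        apply (continuous_comp (fun y => t - y) sqrt); [cont | apply continuous_sqrt].
      + apply (continuous_of_derive _ _ _ (is_derive_RInt_cont (fun y => heat x (t - y)) 0 y Hf)).
    - rewrite Rmin_left, Rmax_right in Hc by lra.
      assert (H0 : 0 <= / (2 * sqrt (t - c)) - heat x (t - c)).
      { destruct (Rle_lt_or_eq_dec c t (proj2 Hc)) as [Hct | ->].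
        - assert (Hq : 0 < sqrt (t - c)) by (apply sqrt_lt_R0; lra).
          assert (HPI : 1 <= sqrt PI).
          { rewrite <- sqrt_1. apply sqrt_le_1_alt. generalize PI2_1; lra. }
          rewrite heat_gauss by lra. assert (Hi : 0 < / (2 * sqrt (t - c))) by (apply Rinv_0_lt_compat; lra).
          assert (He : exp (- (x / (2 * sqrt (t - c))) ^ 2) <= 1).
          { rewrite <- exp_0. apply Rlt_le, exp_increasing.
            assert (0 < x / (2 * sqrt (t - c))) by (apply Rdiv_lt_0_compat; lra). nra. }
          assert (Hp : / sqrt PI <= 1) by (rewrite <- Rinv_1; apply Rinv_le_contravar; lra).
          assert (0 < / sqrt PI) by (apply Rinv_0_lt_compat; lra).
          generalize (exp_pos (- (x / (2 * sqrt (t - c))) ^ 2)). intros.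
          set (E := exp _) in *. set (a := / (2 * sqrt (t - c))) in *. set (p := / sqrt PI) in *.
          assert (E * a <= a) by nra. assert (0 <= E * a) by nra. nra.
        (* The intermediate point may be the endpoint t itself, where both terms are 0 by the
           convention for the inverse of 0. *)
        - rewrite heat_nonpos_time by lra. rewrite Rminus_diag, sqrt_0, Rmult_0_r, Rinv_0. lra. }
      assert (HF : 0 <= F t - F 0) by (rewrite Ec; apply Rmult_le_pos; lra).
      unfold F in HF. rewrite (RInt_point 0) in HF. change zero with 0 in HF.
      rewrite Rminus_diag, sqrt_0, !Rminus_0_r in HF. lra. }
  apply Rle_trans with (M * RInt (fun y => heat x (t - y)) 0 t); [|apply Rmult_le_compat_l; assumption].
  apply (norm_RInt_le (V := R_CompleteNormedModule) (fun y => heat x (t - y) * h y)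
    (fun y => M * heat x (t - y)) 0 t).
  - lra.
  - intros y Hy. change (Rabs (heat x (t - y) * h y) <= M * heat x (t - y)).
    rewrite Rabs_mult, Rmult_comm, (Rabs_pos_eq (heat _ _)) by apply heat_nonneg.
    apply Rmult_le_compat_r; [apply heat_nonneg | apply HM, Hy].
  - apply (is_RInt_cont (fun y => heat x (t - y) * h y)). intros y. apply continuous_lat; assumption.
  - apply (is_RInt_scal (V := R_NormedModule) _ _ _ M _ H1).
Qed.

(* [dirichlet u g] is [D(u) + B(g)] and [neumann v h] is [N(v) - 2 S(h)], since
   [- 2 * heat1 x s = x / s * heat x s]. *)
Definition dirichlet (u g : R -> R) (t x : R) : R :=
  pot 1 t u x - pot (-1) t u x - 2 * lat heat1 g t x.

Definition neumann (v h : R -> R) (t x : R) : R :=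
  pot 1 t v x + pot (-1) t v x - 2 * lat heat h t x.

Lemma is_derive_dirichlet (u u1 g g1 : R -> R) (t x : R) :
  0 < t -> 0 < x -> dominated u -> dominated u1 -> (forall y, is_derive u y (u1 y)) ->
  (forall y, is_derive g y (g1 y)) -> (forall y, continuous g1 y) -> u 0 = g 0 ->
  is_derive (dirichlet u g t) x (neumann u1 g1 t x).
Proof.
  intros Ht Hx Hu Hu1 Hd Hg Hg1 E.
  replace (neumann u1 g1 t x) with (1 * (heat x t * u 0 + pot 1 t u1 x)
    - -1 * (heat x t * u 0 + pot (-1) t u1 x) - 2 * (heat x t * g 0 + lat heat g1 t x)).
  2:{ unfold neumann. rewrite E. ring. }
  apply (is_derive_minus (V := R_NormedModule) (fun x => pot 1 t u x - pot (-1) t u x)).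
  - apply (is_derive_minus (V := R_NormedModule)); apply is_derive_pot; auto; ring.
  - apply (is_derive_scal (lat heat1 g t)). apply is_derive_lat_heat1; assumption.
Qed.

Lemma is_derive_neumann (v v1 h : R -> R) (t x : R) :
  0 < t -> 0 < x -> dominated v -> dominated v1 -> (forall y, is_derive v y (v1 y)) ->
  (forall y, continuous h y) ->
  is_derive (neumann v h t) x (dirichlet v1 h t x).
Proof.
  intros Ht Hx Hv Hv1 Hd Hh.
  replace (dirichlet v1 h t x) with (1 * (heat x t * v 0 + pot 1 t v1 x)
    + -1 * (heat x t * v 0 + pot (-1) t v1 x) - 2 * lat heat1 h t x).
  2:{ unfold dirichlet. ring. }
  apply (is_derive_minus (V := R_NormedModule) (fun x => pot 1 t v x + pot (-1) t v x)).
  - apply (is_derive_plus (V := R_NormedModule)); apply is_derive_pot; auto; ring.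
  - apply (is_derive_scal (lat heat h t)). apply is_derive_lat_heat; assumption.
Qed.

(** With c = gauss_cdf x t and equal boundary values, the masses combine to (1/2 + c) - (1/2 - c) -
    2 (c - 1/2) = 1. *)
Lemma dirichlet_near (u g : R -> R) (t x L e : R) :
  0 < t -> 0 < x -> dominated u -> 0 <= L -> (forall y, 0 <= y -> Rabs (u y - u 0) <= L * y) ->
  (forall y, continuous g y) -> 0 <= e -> (forall y, 0 <= y <= t -> Rabs (g y - g 0) <= e) -> u 0 = g 0 ->
  Rabs (dirichlet u g t x - u 0) <= 2 * L * (x + 3 * sqrt t) + 2 * e.
Proof.
  intros Ht Hx Hu HL HLip Hg He0 He E.
  assert (H1 := pot_near 1 t x L u Ht ltac:(lra) (or_introl eq_refl) HL Hu HLip).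
  assert (H2 := pot_near (-1) t x L u Ht ltac:(lra) (or_intror eq_refl) HL Hu HLip).
  assert (H3 := lat_heat1_near t x e g Ht Hx Hg He0 He).
  replace (-1 * x) with (- x) in H2 by ring. rewrite Rmult_1_l in H1. rewrite gauss_cdf_opp in H2.
  rewrite <- E in H3. unfold dirichlet.
  apply Rabs_le_between in H1. apply Rabs_le_between in H2. apply Rabs_le_between in H3.
  apply Rabs_le. lra.
Qed.

(** Here the two initial masses alone add up to 1, and the boundary datum enters only through an
    error, so no matching of values is involved. *)
Lemma neumann_near (v h : R -> R) (t x L M : R) :
  0 < t -> 0 < x -> dominated v -> 0 <= L -> (forall y, 0 <= y -> Rabs (v y - v 0) <= L * y) ->
  (forall y, continuous h y) -> (forall y, 0 <= y <= t -> Rabs (h y) <= M) ->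
  Rabs (neumann v h t x - v 0) <= 2 * L * (x + 3 * sqrt t) + 2 * M * sqrt t.
Proof.
  intros Ht Hx Hv HL HLip Hh HM.
  assert (H1 := pot_near 1 t x L v Ht ltac:(lra) (or_introl eq_refl) HL Hv HLip).
  assert (H2 := pot_near (-1) t x L v Ht ltac:(lra) (or_intror eq_refl) HL Hv HLip).
  assert (H3 := lat_heat_small t x M h Ht Hx Hh HM).
  replace (-1 * x) with (- x) in H2 by ring. rewrite Rmult_1_l in H1. rewrite gauss_cdf_opp in H2.
  unfold neumann.
  apply Rabs_le_between in H1. apply Rabs_le_between in H2. apply Rabs_le_between in H3.
  apply Rabs_le. lra.
Qed.

(** * Extension of the data to the real line *)

(** The extension is l plus the integral of [w] from 0. On the positive side it differs from [f] by
    a constant, which is 0 by the limit at 0. *)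
Lemma antiderivative_extension (f w : R -> R) (l : R) :
  (forall y, continuous w y) -> (forall y, 0 < y -> is_derive f y (w y)) ->
  filterlim f (at_right 0) (locally l) ->
  exists F : R -> R, F 0 = l /\ (forall y, is_derive F y (w y)) /\ (forall y, 0 < y -> F y = f y).
Proof.
  intros Hw Hf Hl. set (F := fun y => l + RInt w 0 y).
  assert (HF0 : F 0 = l).
  { unfold F. rewrite (RInt_point 0). change zero with 0. ring. }
  assert (HF : forall y, is_derive F y (w y)).
  { intros y. replace (w y) with (0 + w y) by ring.
    apply (is_derive_plus (V := R_NormedModule) (fun _ => l)).
    - apply (is_derive_const (V := R_NormedModule)).
    - apply is_derive_RInt_cont, Hw. }
  exists F. split; [exact HF0 | split; [exact HF|]].
  intros y Hy.
  assert (E : forall z, 0 < z < y -> F z - f z = F y - f y).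
  { intros z Hz. apply (eq_is_derive (V := R_NormedModule) (fun z => F z - f z)); [|apply Hz].
    intros s Hs. change zero with 0. rewrite <- (Rminus_diag (w s)).
    apply (is_derive_minus (V := R_NormedModule)); [apply HF | apply Hf; lra]. }
  apply Rminus_diag_uniq. apply cond_eq. intros eps Heps. rewrite Rminus_0_r.
  assert (He2 : 0 < eps / 2) by lra.
  destruct (Hl (ball l (mkposreal _ He2)) (locally_ball _ _)) as [d1 Hd1].
  assert (Hc : continuous F 0) by (apply (continuous_of_derive F 0 (w 0)), HF).
  apply continuity_pt_filterlim in Hc. rewrite continuity_pt_locally in Hc.
  destruct (Hc (mkposreal _ He2)) as [d2 Hd2]. simpl in Hd2. rewrite HF0 in Hd2.
  assert (Hp1 := cond_pos d1). assert (Hp2 := cond_pos d2).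
  (* A point of (0,y) so close to 0 that both F and f are within eps / 2 of [l]. *)
  set (z := Rmin (y / 2) (Rmin (d1 / 2) (d2 / 2))).
  assert (Hz0 : 0 < z) by (repeat apply Rmin_pos; lra).
  assert (Hz1 : z <= y / 2) by apply Rmin_l.
  assert (Hz2 : z <= d1 / 2) by (apply Rle_trans with (1 := Rmin_r _ _), Rmin_l).
  assert (Hz3 : z <= d2 / 2) by (apply Rle_trans with (1 := Rmin_r _ _), Rmin_r).
  assert (Hb : forall d : posreal, z <= d / 2 -> Rabs (z - 0) < d).
  { intros d Hd. rewrite Rminus_0_r, Rabs_pos_eq by lra. generalize (cond_pos d). lra. }
  assert (H1 := Hd1 z (Hb d1 Hz2) Hz0). assert (H2 := Hd2 z (Hb d2 Hz3)).
  change (Rabs (f z - l) < eps / 2) in H1.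
  rewrite <- (E z) by lra. apply Rabs_def2 in H1. apply Rabs_def2 in H2. apply Rabs_def1; lra.
Qed.

Lemma Derive_n_Derive (f : R -> R) (n : nat) : Derive_n (Derive f) n = Derive_n f (S n).
Proof.
  induction n as [|n IH]; [reflexivity|].
  change (Derive_n (Derive f) (S n)) with (fun x => Derive (Derive_n (Derive f) n) x).
  rewrite IH. reflexivity.
Qed.

(** [v] lists the derivatives, up to order [N], of a single C^N function on the whole line that
    agrees with [f] on the positive half-line; [l] lists the prescribed derivatives at 0. *)
Definition extends (f : R -> R) (l : nat -> R) (N : nat) (v : nat -> R -> R) : Prop :=
  (forall n y, (n <= N)%nat -> 0 < y -> v n y = Derive_n f n y) /\
  (forall n, (n <= N)%nat -> v n 0 = l n) /\
  (forall n y, (n < N)%nat -> is_derive (v n) y (v (S n) y)) /\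
  (forall n y, (n <= N)%nat -> continuous (v n) y).

(** The induction extends f' first and then integrates. At order 0 the function is continued by a
    constant, so on the left the result is the Taylor polynomial with coefficients given by [l]. *)
Lemma extends_exists (N : nat) : forall (f : R -> R) (l : nat -> R),
  (forall n x, 0 < x -> ex_derive_n f n x) ->
  (forall n, filterlim (Derive_n f n) (at_right 0) (locally (l n))) ->
  exists v, extends f l N v.
Proof.
  induction N as [|N IH]; intros f l Hf Hl.
  - set (v := fun y => if Rlt_dec 0 y then f y else l 0%nat).
    exists (fun _ => v). unfold v. split; [|split; [|split]].
    + intros n y Hn Hy. replace n with 0%nat by (inversion Hn; reflexivity).
      destruct (Rlt_dec 0 y); [reflexivity | contradiction].
    + intros n Hn. replace n with 0%nat by (inversion Hn; reflexivity).
      destruct (Rlt_dec 0 0); [lra | reflexivity].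
    + intros n y Hn. inversion Hn.
    + intros n y _. destruct (Rtotal_order y 0) as [Hy | [-> | Hy]].
      * apply (continuous_ext_loc _ (fun _ => l 0%nat)); [|apply continuous_const].
        assert (Hp : 0 < - y) by lra. exists (mkposreal _ Hp). intros z Hz.
        change (Rabs (z - y) < - y) in Hz. apply Rabs_def2 in Hz.
        destruct (Rlt_dec 0 z); [lra | reflexivity].
      * apply continuity_pt_filterlim, continuity_pt_locally. intros eps.
        destruct (Hl 0%nat (ball (l 0%nat) eps) (locally_ball _ _)) as [d Hd].
        exists d. intros z Hz. destruct (Rlt_dec 0 0); [lra|].
        destruct (Rlt_dec 0 z) as [Hz0 | Hz0].
        -- apply (Hd z Hz Hz0).
        -- rewrite Rminus_diag, Rabs_R0. apply cond_pos.
      * apply (continuous_ext_loc _ f).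
        -- exists (mkposreal _ Hy). intros z Hz.
           change (Rabs (z - y) < y) in Hz. apply Rabs_def2 in Hz.
           destruct (Rlt_dec 0 z); [reflexivity | lra].
        -- apply continuous_of_ex_derive, (Hf 1%nat y Hy).
  - destruct (IH (Derive f) (fun n => l (S n))) as [v [H1 [H2 [H3 H4]]]].
    { intros [|n] x Hx; [exact I|]. unfold ex_derive_n. rewrite Derive_n_Derive. apply (Hf (S (S n)) x Hx). }
    { intros n. rewrite Derive_n_Derive. apply Hl. }
    destruct (antiderivative_extension f (v 0%nat) (l 0%nat)) as [F [HF0 [HF HFf]]].
    { intros y. apply H4, le_0_n. }
    { intros y Hy. rewrite H1 by (auto using le_0_n). apply Derive_correct, (Hf 1%nat y Hy). }
    { exact (Hl 0%nat). }
    exists (fun n => match n with O => F | S m => v m end). split; [|split; [|split]].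
    + intros [|n] y Hn Hy; [apply HFf, Hy|]. rewrite H1, Derive_n_Derive by (auto using le_S_n). reflexivity.
    + intros [|n] Hn; [exact HF0 | apply H2, le_S_n, Hn].
    + intros [|n] y Hn; [apply HF | apply H3, Nat.succ_lt_mono, Hn].
    + intros [|n] y Hn; [apply (continuous_of_derive F y (v 0%nat y)), HF | apply H4, le_S_n, Hn].
Qed.

Lemma derive_n_at0_correct (f : R -> C) (n : nat) : smooth_halfline f ->
  filterlim (Derive_n (fun y => Re (f y)) n) (at_right 0) (locally (Re (derive_n_at0 f n))) /\
  filterlim (Derive_n (fun y => Im (f y)) n) (at_right 0) (locally (Im (derive_n_at0 f n))).
Proof.
  intros [_ Hf]. destruct (Hf n) as [l Hl].
  assert (E : derive_n_at0 f n = l).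
  { apply (iota_filterlim_locally (V := C_R_CompleteNormedModule) (F := at_right 0)). exact Hl. }
  rewrite E. split; intros P [eps HP].
  - generalize (Hl _ (locally_ball (T := C_UniformSpace) l eps)). unfold filtermap. apply filter_imp.
    intros x [Hx _]. apply HP, Hx.
  - generalize (Hl _ (locally_ball (T := C_UniformSpace) l eps)). unfold filtermap. apply filter_imp.
    intros x [_ Hx]. apply HP, Hx.
Qed.

Lemma smooth_halfline_extends (f : R -> C) (N : nat) : smooth_halfline f ->
  exists vr vi : nat -> R -> R,
    extends (fun y => Re (f y)) (fun n => Re (derive_n_at0 f n)) N vr /\
    extends (fun y => Im (f y)) (fun n => Im (derive_n_at0 f n)) N vi.
Proof.
  intros Hf.
  destruct (extends_exists N (fun y => Re (f y)) (fun n => Re (derive_n_at0 f n))) as [vr Hr].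
  { intros n x Hx. apply (proj1 Hf n x Hx). }
  { intros n. exact (proj1 (derive_n_at0_correct f n Hf)). }
  destruct (extends_exists N (fun y => Im (f y)) (fun n => Im (derive_n_at0 f n))) as [vi Hi].
  { intros n x Hx. apply (proj1 Hf n x Hx). }
  { intros n. exact (proj2 (derive_n_at0_correct f n Hf)). }
  exists vr, vi. auto.
Qed.

Lemma derive_n_halfline_0 (f : R -> C) (n : nat) : derive_n_halfline f n 0 = derive_n_at0 f n.
Proof. unfold derive_n_halfline. destruct (Rlt_dec 0 0); [lra | reflexivity]. Qed.

Lemma Rabs_Re_Im_le_Cmod (z : C) : Rabs (Re z) <= Cmod z /\ Rabs (Im z) <= Cmod z.
Proof.
  generalize (Rmax_Cmod z). intros H. split.
  - apply Rle_trans with (2 := H), Rmax_l.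
  - apply Rle_trans with (2 := H), Rmax_r.
Qed.

(** The Schwartz bounds with weights 1 and y^2 add up to a bound on (1 + y^2) times the modulus. *)
Lemma schwartz_dominated (f : R -> C) (N : nat) (vr vi : nat -> R -> R) :
  schwartz_halfline f ->
  extends (fun y => Re (f y)) (fun n => Re (derive_n_at0 f n)) N vr ->
  extends (fun y => Im (f y)) (fun n => Im (derive_n_at0 f n)) N vi ->
  forall n, (n <= N)%nat -> dominated (vr n) /\ dominated (vi n).
Proof.
  intros [_ HS] [R1 [R2 [_ R4]]] [I1 [I2 [_ I4]]] n Hn.
  destruct (HS 0%nat n) as [B0 HB0]. destruct (HS 2%nat n) as [B2 HB2].
  assert (E : forall y, 0 <= y -> derive_n_halfline f n y = (vr n y, vi n y)).
  { intros y Hy. destruct (Rle_lt_or_eq_dec 0 y Hy) as [Hy0 | <-].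
    - unfold derive_n_halfline. destruct (Rlt_dec 0 y); [|contradiction].
      rewrite R1, I1 by assumption. reflexivity.
    - rewrite derive_n_halfline_0, R2, I2 by assumption. destruct (derive_n_at0 f n); reflexivity. }
  assert (HD : forall y, 0 <= y -> Rabs (vr n y) <= (B0 + B2) / (1 + y ^ 2) /\ Rabs (vi n y) <= (B0 + B2) / (1 + y ^ 2)).
  { intros y Hy. specialize (HB0 y Hy). specialize (HB2 y Hy).
    rewrite E, Cmod_mult, Cmod_R in HB0, HB2 by exact Hy.
    rewrite pow_O, Rabs_R1, Rmult_1_l in HB0. rewrite (Rabs_pos_eq (y ^ 2)) in HB2 by nra.
    assert (Hp : 0 < 1 + y ^ 2) by nra.
    assert (HC : Cmod (vr n y, vi n y) <= (B0 + B2) / (1 + y ^ 2)).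
    { apply Rmult_le_reg_r with (1 + y ^ 2); [exact Hp|].
      replace ((B0 + B2) / (1 + y ^ 2) * (1 + y ^ 2)) with (B0 + B2) by (field; lra). lra. }
    destruct (Rabs_Re_Im_le_Cmod (vr n y, vi n y)) as [HR HI]. simpl in HR, HI. split; lra. }
  split; (split; [intros y; auto | exists (B0 + B2); intros y Hy; apply HD, Hy]).
Qed.

(** The kernel is real, so the complex solution splits into two real ones. The first two integrals
    are 2 pi times potentials; the third is - 2 pi i times [lat heat1], which the prefactor - i / pi
    turns into - 2. *)
Lemma utm_solution_dirichlet (u0 g0 : R -> C) (vr vi gr gi : R -> R) (x t : R) :
  0 < x -> 0 < t -> dominated vr -> dominated vi ->
  (forall y, continuous gr y) -> (forall y, continuous gi y) ->
  (forall y, 0 < y -> u0 y = (vr y, vi y)) -> (forall y, 0 < y -> g0 y = (gr y, gi y)) ->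
  utm_solution u0 g0 x t = (dirichlet vr gr t x, dirichlet vi gi t x).
Proof.
  intros Hx Ht Hvr Hvi Hgr Hgi Eu Eg.
  set (v := fun y => (vr y, vi y) : C). set (g := fun y => (gr y, gi y) : C).
  assert (Hv : dominated_C v).
  { destruct Hvr as [V1 [C1 V2]], Hvi as [V3 [C2 V4]]. split; [exact V1 | split; [exact V3|]].
    exists (Rmax C1 C2). intros y Hy.
    assert (Hp : 0 < / (1 + y ^ 2)) by (apply Rinv_0_lt_compat; nra). split.
    - apply Rle_trans with (1 := V2 y Hy). apply Rmult_le_compat_r; [lra | apply Rmax_l].
    - apply Rle_trans with (1 := V4 y Hy). apply Rmult_le_compat_r; [lra | apply Rmax_r]. }
  assert (L1 := int_line_heat u0 v x t Ht Hv (fun y Hy => eq_sym (Eu y Hy))).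
  assert (L2 := int_Gamma_heat_0oo u0 v x t Hx Ht Hv (fun y Hy => eq_sym (Eu y Hy))).
  assert (L3 := int_Gamma_heat_segment g0 g x t Hx Ht Hgr Hgi (fun y Hy => eq_sym (Eg y Hy))).
  unfold utm_solution.
  set (l1 := int_line _) in *. set (l2 := int_Gamma _) in L2 |- *. set (l3 := int_Gamma _) in L3 |- *.
  assert (P : forall sg (w : R -> R), dominated w ->
    is_RInt_0oo (fun y => 2 * PI * (heat (x - sg * y) t * w y)) (2 * PI * pot sg t w x)).
  { intros sg w Hw. apply (is_RInt_gen_scal (V := R_NormedModule) _ (2 * PI)), is_RInt_pot; assumption. }
  assert (Q : forall w : R -> R, (forall y, continuous w y) ->
    is_RInt_gen (fun y => 2 * PI * (heat1 x (t - y) * w y)) (at_point 0) (at_point t) (2 * PI * lat heat1 w t x)).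
  { intros w Hw. apply (is_RInt_gen_scal (V := R_NormedModule) _ (2 * PI)). apply is_RInt_gen_at_point.
    apply (is_RInt_cont (fun y => heat1 x (t - y) * w y)). intros y. apply continuous_lat; [|exact Hw].
    apply (continuous_heat_family x Hx). }
  assert (E1 : Re l1 = 2 * PI * pot 1 t vr x /\ Im l1 = 2 * PI * pot 1 t vi x).
  { split.
    - apply (is_RInt_0oo_unique _ _ _ (is_CInt_Re _ _ L1)). generalize (P 1 vr Hvr). apply is_RInt_0oo_ext.
      intros y _. rewrite Rmult_1_l. simpl. rring.
    - apply (is_RInt_0oo_unique _ _ _ (is_CInt_Im _ _ L1)). generalize (P 1 vi Hvi). apply is_RInt_0oo_ext.
      intros y _. rewrite Rmult_1_l. simpl. rring. }
  assert (E2 : Re l2 = 2 * PI * pot (-1) t vr x /\ Im l2 = 2 * PI * pot (-1) t vi x).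
  { split.
    - apply (is_RInt_0oo_unique _ _ _ (is_CInt_Re _ _ L2)). generalize (P (-1) vr Hvr). apply is_RInt_0oo_ext.
      intros y _. replace (x - -1 * y) with (x + y) by ring. simpl. rring.
    - apply (is_RInt_0oo_unique _ _ _ (is_CInt_Im _ _ L2)). generalize (P (-1) vi Hvi). apply is_RInt_0oo_ext.
      intros y _. replace (x - -1 * y) with (x + y) by ring. simpl. rring. }
  assert (U : forall (f : R -> R) (a b : R), is_RInt_gen f (at_point 0) (at_point t) a ->
     is_RInt_gen f (at_point 0) (at_point t) b -> a = b).
  { intros f a b Ha Hb. rewrite <- (is_RInt_gen_unique (V := R_CompleteNormedModule) f a Ha).
    exact (is_RInt_gen_unique (V := R_CompleteNormedModule) f b Hb). }
  (* The factor i in the third integral exchanges real and imaginary parts, and x / (2 s) * heat x s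
     = - heat1 x s gives the signs. *)
  assert (E3 : Re l3 = 2 * PI * lat heat1 gi t x /\ Im l3 = - (2 * PI * lat heat1 gr t x)).
  { split.
    - apply (U _ _ _ (is_CInt_Re _ _ L3)). generalize (Q gi Hgi). apply is_RInt_gen_ext.
      apply filter_forall. intros ab y _. unfold heat1. simpl. rring.
    - apply (U _ _ _ (is_CInt_Im _ _ L3)). generalize (is_RInt_gen_opp (V := R_NormedModule) _ _ (Q gr Hgr)).
      apply is_RInt_gen_ext.
      apply filter_forall. intros ab y _. unfold heat1, opp. simpl. rring. }
  assert (HPI := PI_RGT_0). revert E1 E2 E3. clearbody l1 l2 l3. destruct l1, l2, l3. simpl.
  intros [-> ->] [-> ->] [-> ->]. unfold dirichlet. apply Ceq; simpl; field; lra.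
Qed.

(** * Limits at the corner *)

Lemma Derive_n_chain (w : R -> R) (F : nat -> R -> R) (N : nat) :
  (forall x, 0 < x -> w x = F 0%nat x) ->
  (forall n x, (n < N)%nat -> 0 < x -> is_derive (F n) x (F (S n) x)) ->
  forall n x, (n <= N)%nat -> 0 < x -> Derive_n w n x = F n x.
Proof.
  intros H0 HF n. induction n as [|n IH]; intros x Hn Hx; [apply H0, Hx|].
  simpl. rewrite (Derive_ext_loc _ (F n)).
  - apply is_derive_unique, HF; assumption.
  - exists (mkposreal _ Hx). intros y Hy. change (Rabs (y - x) < x) in Hy. apply Rabs_def2 in Hy.
    apply IH; [apply Nat.lt_le_incl, Hn | lra].
Qed.

(** The limit through the open quadrant only, where the potential formulas hold. *)
Definition corner_limit (w : R -> R -> R) (l : R) : Prop :=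
  forall eps, 0 < eps -> exists d, 0 < d /\
    forall x t, 0 < x < d -> 0 < t < d -> Rabs (w x t - l) < eps.

Lemma corner_limit_of_bound (w : R -> R -> R) (l A : R) :
  (forall x t, 0 < x -> 0 < t <= 1 -> Rabs (w x t - l) <= A * (x + sqrt t)) -> corner_limit w l.
Proof.
  intros H eps Heps. set (B := Rabs A + 1).
  assert (HB : 0 < B) by (unfold B; generalize (Rabs_pos A); lra).
  (* From x < c and t < c^2 one gets x + sqrt t < 2 c = eps / B. *)
  set (c := eps / (2 * B)). assert (Hc : 0 < c) by (apply Rdiv_lt_0_compat; lra).
  assert (Hd : 0 < Rmin 1 (Rmin c (c ^ 2))) by (repeat apply Rmin_pos; try lra; nra).
  exists (Rmin 1 (Rmin c (c ^ 2))). split; [exact Hd|].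
  intros x t Hx Ht.
  assert (D1 := Rmin_l 1 (Rmin c (c ^ 2))).
  assert (D2 := Rle_trans _ _ _ (Rmin_r 1 (Rmin c (c ^ 2))) (Rmin_l _ _)).
  assert (D3 := Rle_trans _ _ _ (Rmin_r 1 (Rmin c (c ^ 2))) (Rmin_r _ _)).
  apply Rle_lt_trans with (1 := H x t ltac:(lra) ltac:(lra)).
  assert (Hs : sqrt t < c).
  { rewrite <- (sqrt_pow2 c) by lra. apply sqrt_lt_1_alt. lra. }
  assert (Hs0 := sqrt_pos t).
  apply Rle_lt_trans with (B * (x + sqrt t)).
  - apply Rmult_le_compat_r; [lra|]. unfold B. generalize (Rle_abs A). lra.
  - apply Rlt_le_trans with (B * (c + c)); [apply Rmult_lt_compat_l; lra|].
    right. unfold c. field. lra.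
Qed.

Lemma lipschitz_of_bounded_derive (v v1 : R -> R) (b L : R) :
  (forall y, is_derive v y (v1 y)) -> (forall y, 0 <= y <= b -> Rabs (v1 y) <= L) ->
  forall y, 0 <= y <= b -> Rabs (v y - v 0) <= L * y.
Proof.
  intros Hd HL y Hy.
  destruct (MVT_gen v 0 y v1) as [c [Hc ->]].
  - intros z _. apply Hd.
  - intros z _. apply continuity_pt_filterlim, (continuous_of_derive v z (v1 z)), Hd.
  - rewrite Rmin_left, Rmax_right in Hc by lra.
    rewrite Rminus_0_r, Rabs_mult, (Rabs_pos_eq y) by lra.
    apply Rmult_le_compat_r; [lra | apply HL; lra].
Qed.

Lemma dominated_bounded (v : R -> R) : dominated v ->
  exists L, 0 <= L /\ forall y, 0 <= y -> Rabs (v y) <= L.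
Proof.
  intros [_ [C HC]].
  assert (HC0 : 0 <= C).
  { generalize (HC 0 (Rle_refl 0)) (Rabs_pos (v 0)).
    replace (C / (1 + 0 ^ 2)) with C by field. lra. }
  exists C. split; [exact HC0|]. intros y Hy. apply Rle_trans with (1 := HC y Hy).
  rewrite <- (Rmult_1_r C) at 2. apply Rmult_le_compat_l; [exact HC0|].
  rewrite <- Rinv_1. apply Rinv_le_contravar; nra.
Qed.

Lemma corner_limit_dirichlet (u u1 g g1 : R -> R) :
  dominated u -> dominated u1 -> (forall y, is_derive u y (u1 y)) ->
  (forall y, is_derive g y (g1 y)) -> (forall y, continuous g1 y) -> u 0 = g 0 ->
  corner_limit (fun x t => dirichlet u g t x) (u 0).
Proof.
  intros Hu Hu1 Hd Hg Hg1 E.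
  destruct (dominated_bounded u1 Hu1) as [L [HL0 HL]].
  destruct (continuous_bounded_segment g1 0 1 ltac:(lra) Hg1) as [M HM].
  assert (HM0 : 0 <= M) by (generalize (HM 0 ltac:(lra)) (Rabs_pos (g1 0)); lra).
  assert (HLu := fun b => lipschitz_of_bounded_derive u u1 b L Hd (fun y Hy => HL y (proj1 Hy))).
  assert (HLg := lipschitz_of_bounded_derive g g1 1 M Hg HM).
  (* The 6 is 2 times the 3 of [heat_moment]. The oscillation of [g] on [0,t] is at most M t, hence
     at most M sqrt t because t <= 1. *)
  apply corner_limit_of_bound with (6 * L + 2 * M). intros x t Hx Ht.
  assert (Hs : 0 < sqrt t) by (apply sqrt_lt_R0; lra).
  assert (Hss : sqrt t * sqrt t = t) by (apply sqrt_sqrt; lra).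
  assert (Hs1 : sqrt t <= 1) by nra.
  apply Rle_trans with (2 * L * (x + 3 * sqrt t) + 2 * (M * t)).
  - apply dirichlet_near; auto; try lra.
    + intros y Hy. apply (HLu y). lra.
    + intros y. apply (continuous_of_derive g y (g1 y)), Hg.
    + nra.
    + intros y Hy. apply Rle_trans with (1 := HLg y ltac:(lra)). apply Rmult_le_compat_l; lra.
  - assert (M * t <= M * sqrt t) by (apply Rmult_le_compat_l; nra).
    assert (0 <= L * x) by nra. assert (0 <= M * x) by nra. lra.
Qed.

Lemma corner_limit_neumann (v v1 h : R -> R) :
  dominated v -> dominated v1 -> (forall y, is_derive v y (v1 y)) -> (forall y, continuous h y) ->
  corner_limit (fun x t => neumann v h t x) (v 0).
Proof.
  intros Hv Hv1 Hd Hh.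
  destruct (dominated_bounded v1 Hv1) as [L [HL0 HL]].
  destruct (continuous_bounded_segment h 0 1 ltac:(lra) Hh) as [M HM].
  assert (HM0 : 0 <= M) by (generalize (HM 0 ltac:(lra)) (Rabs_pos (h 0)); lra).
  assert (HLv := fun b => lipschitz_of_bounded_derive v v1 b L Hd (fun y Hy => HL y (proj1 Hy))).
  apply corner_limit_of_bound with (6 * L + 2 * M). intros x t Hx Ht.
  assert (Hs : 0 < sqrt t) by (apply sqrt_lt_R0; lra).
  apply Rle_trans with (2 * L * (x + 3 * sqrt t) + 2 * M * sqrt t).
  - apply neumann_near; auto; try lra.
    + intros y Hy. apply (HLv y). lra.
    + intros y Hy. apply HM. lra.
  - assert (0 <= L * x) by nra. assert (0 <= M * x) by nra. lra.
Qed.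

(** Orders 4 and 2 are what the third derivative asks for: its formula involves [v 3] and [g 2], and
    the derivative [v 4] supplies the Lipschitz constant of [v 3]. *)
Lemma corner_limits_real (w : R -> R -> R) (v g : nat -> R -> R) :
  (forall n, (n <= 4)%nat -> dominated (v n)) ->
  (forall n y, (n < 4)%nat -> is_derive (v n) y (v (S n) y)) ->
  (forall n y, (n < 2)%nat -> is_derive (g n) y (g (S n) y)) -> (forall y, continuous (g 2%nat) y) ->
  (forall x t, 0 < x -> 0 < t -> w x t = dirichlet (v 0%nat) (g 0%nat) t x) ->
  v 0%nat 0 = g 0%nat 0 ->
  (corner_limit w (v 0%nat 0) /\ corner_limit (fun x t => Derive_n (fun y => w y t) 1 x) (v 1%nat 0)) /\
  (v 2%nat 0 = g 1%nat 0 ->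
   corner_limit (fun x t => Derive_n (fun y => w y t) 2 x) (v 2%nat 0) /\
   corner_limit (fun x t => Derive_n (fun y => w y t) 3 x) (v 3%nat 0)).
Proof.
  intros Hv Hd Hg Hg2 Hw E0.
  assert (Hg1 : forall y, continuous (g 1%nat) y).
  { intros y. apply (continuous_of_derive _ _ _ (Hg 1%nat y ltac:(auto with arith))). }
  assert (Hext : forall (w1 w2 : R -> R -> R) l,
     (forall x t, 0 < x -> 0 < t -> w1 x t = w2 x t) -> corner_limit w2 l -> corner_limit w1 l).
  { intros w1 w2 l H12 H eps Heps. destruct (H eps Heps) as [d [Hd0 Hd1]]. exists d. split; [exact Hd0|].
    intros x t Hx Ht. rewrite H12; [apply Hd1; assumption | apply Hx | apply Ht]. }
  (* The successive data pairs are (u, g), (u', g'), (u'', g'), (u''', g''). The steps from 0 to 1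
     and from 2 to 3 each use one compatibility condition; the step from 1 to 2 uses none. *)
  set (F := fun t n => match n with
     | O => dirichlet (v 0%nat) (g 0%nat) t | S O => neumann (v 1%nat) (g 1%nat) t
     | S (S O) => dirichlet (v 2%nat) (g 1%nat) t | _ => neumann (v 3%nat) (g 2%nat) t end).
  assert (HF0 : forall t x, 0 < t -> 0 < x -> is_derive (F t 0%nat) x (F t 1%nat x)).
  { intros t x Ht Hx. apply (is_derive_dirichlet _ _ _ (g 1%nat)); auto with arith. }
  assert (HF1 : forall t x, 0 < t -> 0 < x -> is_derive (F t 1%nat) x (F t 2%nat x)).
  { intros t x Ht Hx. apply is_derive_neumann; auto with arith. }
  assert (D1 : forall x t, 0 < x -> 0 < t -> Derive_n (fun y => w y t) 1 x = F t 1%nat x).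
  { intros x t Hx Ht. apply (Derive_n_chain _ (F t) 1); auto.
    intros n z Hn Hz. inversion Hn as [|m Hm]; [|inversion Hm]. apply HF0; assumption. }
  split; [split|].
  - apply Hext with (1 := Hw). apply (corner_limit_dirichlet _ (v 1%nat) _ (g 1%nat)); auto with arith.
  - apply Hext with (1 := D1). apply (corner_limit_neumann _ (v 2%nat)); auto with arith.
  - intros E1.
    assert (HF2 : forall t x, 0 < t -> 0 < x -> is_derive (F t 2%nat) x (F t 3%nat x)).
    { intros t x Ht Hx. apply (is_derive_dirichlet _ _ _ (g 2%nat)); auto with arith. }
    assert (D : forall n x t, (n <= 3)%nat -> 0 < x -> 0 < t -> Derive_n (fun y => w y t) n x = F t n x).
    { intros n x t Hn Hx Ht. apply (Derive_n_chain _ (F t) 3); auto.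
      intros m z Hm Hz. destruct m as [|[|[|m]]]; [apply HF0 | apply HF1 | apply HF2 |]; try assumption.
      exfalso. apply (Nat.nlt_0_r m). do 3 apply Nat.succ_lt_mono. exact Hm. }
    split.
    + apply Hext with (1 := fun x t => D 2%nat x t ltac:(auto with arith)).
      apply (corner_limit_dirichlet _ (v 3%nat) _ (g 2%nat)); auto with arith.
    + apply Hext with (1 := fun x t => D 3%nat x t ltac:(auto with arith)).
      apply (corner_limit_neumann _ (v 4%nat)); auto with arith.
Qed.

(** Points on the axes are reached by moving diagonally into the open quadrant, where [U] equals
    [v], at the cost eps / 2 by continuity of the extension at the point. *)
Lemma lim_in_quadrant_of_corner_limit (v : R -> R -> C) (U : R * R -> C) (l : C) :
  continuous_extension v U ->
  corner_limit (fun x t => Re (v x t)) (Re l) -> corner_limit (fun x t => Im (v x t)) (Im l) ->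
  lim_in_quadrant U (0, 0) l.
Proof.
  intros [HUv HU] Hr Hi P [eps HP].
  destruct (Hr (eps / 2)) as [d1 [Hd1 H1]]; [apply (cond_pos (pos_div_2 eps))|].
  destruct (Hi (eps / 2)) as [d2 [Hd2 H2]]; [apply (cond_pos (pos_div_2 eps))|].
  assert (Hd : 0 < Rmin d1 d2 / 2) by (assert (0 < Rmin d1 d2) by (apply Rmin_pos; assumption); lra).
  assert (M1 := Rmin_l d1 d2). assert (M2 := Rmin_r d1 d2).
  exists (mkposreal _ Hd). intros [x t] [Bx Bt] Hq. simpl in Bx, Bt.
  change (Rabs (x - 0) < Rmin d1 d2 / 2) in Bx. change (Rabs (t - 0) < Rmin d1 d2 / 2) in Bt.
  apply Rabs_def2 in Bx. apply Rabs_def2 in Bt. apply HP.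
  destruct (HU (x, t) Hq (ball (M := C_UniformSpace) (U (x, t)) (pos_div_2 eps))) as [d3 H3].
  { apply (locally_ball (T := C_UniformSpace)). }
  assert (Hd3 := cond_pos d3).
  (* Small enough for continuity of [U] at (x, t), and for (x + h, t + h) to stay in the square
     where both corner estimates hold. *)
  set (h := Rmin (d3 / 2) (Rmin d1 d2 / 2)).
  assert (Hh : 0 < h) by (apply Rmin_pos; lra).
  assert (Hh1 : h <= d3 / 2) by apply Rmin_l. assert (Hh2 : h <= Rmin d1 d2 / 2) by apply Rmin_r.
  destruct Hq as [Hx [Ht _]]. simpl in Hx, Ht.
  assert (H3' := H3 (x + h, t + h)).
  destruct H3' as [Cr Ci].
  { split; [change (Rabs (x + h - x) < d3) | change (Rabs (t + h - t) < d3)];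
      [replace (x + h - x) with h by ring | replace (t + h - t) with h by ring];
      rewrite Rabs_pos_eq; lra. }
  { split; [simpl; lra | split; [simpl; lra | intros E0; injection E0; lra]]. }
  rewrite (HUv (x + h) (t + h)) in Cr, Ci by lra.
  change (Rabs (Re (v (x + h) (t + h)) - Re (U (x, t))) < eps / 2) in Cr.
  change (Rabs (Im (v (x + h) (t + h)) - Im (U (x, t))) < eps / 2) in Ci.
  specialize (H1 (x + h) (t + h) ltac:(lra) ltac:(lra)).
  specialize (H2 (x + h) (t + h) ltac:(lra) ltac:(lra)).
  apply Rabs_def2 in Cr. apply Rabs_def2 in Ci. apply Rabs_def2 in H1. apply Rabs_def2 in H2.
  split; [change (Rabs (Re (U (x, t)) - Re l) < eps) | change (Rabs (Im (U (x, t)) - Im l) < eps)];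
    apply Rabs_def1; lra.
Qed.

Theorem theorem1p3 (u0 g0 : R -> C)
  (Hu0 : schwartz_halfline u0) (Hg0 : smooth_halfline g0)
  (U : nat -> R * R -> C)
  (HU : forall k : nat, (k <= 3)%nat ->
          continuous_extension (partial_x k (utm_solution u0 g0)) (U k)) :
  (derive_n_halfline u0 0 0 = derive_n_halfline g0 0 0 ->
     lim_in_quadrant (U 0%nat) (0, 0) (derive_n_halfline u0 0 0) /\
     lim_in_quadrant (U 1%nat) (0, 0) (derive_n_halfline u0 1 0)) /\
  (derive_n_halfline u0 0 0 = derive_n_halfline g0 0 0 ->
   derive_n_halfline u0 2 0 = derive_n_halfline g0 1 0 ->
     lim_in_quadrant (U 2%nat) (0, 0) (derive_n_halfline u0 2 0) /\
     lim_in_quadrant (U 3%nat) (0, 0) (derive_n_halfline u0 3 0)).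
Proof.
  destruct (smooth_halfline_extends u0 4 (proj1 Hu0)) as [vr [vi [Hvr Hvi]]].
  destruct (smooth_halfline_extends g0 2 Hg0) as [gr [gi [Hgr Hgi]]].
  assert (Hdom := schwartz_dominated u0 4 vr vi Hu0 Hvr Hvi).
  destruct Hvr as [R1 [R2 [R3 _]]], Hvi as [I1 [I2 [I3 _]]].
  destruct Hgr as [S1 [S2 [S3 S4]]], Hgi as [J1 [J2 [J3 J4]]].
  assert (Hrep : forall x t, 0 < x -> 0 < t -> utm_solution u0 g0 x t =
     (dirichlet (vr 0%nat) (gr 0%nat) t x, dirichlet (vi 0%nat) (gi 0%nat) t x)).
  { intros x t Hx Ht. apply utm_solution_dirichlet; auto with arith.
    - apply Hdom. auto with arith.
    - apply Hdom. auto with arith.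
    - intros y Hy. rewrite R1, I1 by auto with arith. simpl. destruct (u0 y); reflexivity.
    - intros y Hy. rewrite S1, J1 by auto with arith. simpl. destruct (g0 y); reflexivity. }
  rewrite !derive_n_halfline_0.
  assert (CR := corner_limits_real (fun x t => Re (utm_solution u0 g0 x t)) vr gr
    (fun n Hn => proj1 (Hdom n Hn)) R3 S3 (fun y => S4 2%nat y (le_n 2))
    (fun x t Hx Ht => f_equal Re (Hrep x t Hx Ht))).
  assert (CI := corner_limits_real (fun x t => Im (utm_solution u0 g0 x t)) vi gi
    (fun n Hn => proj2 (Hdom n Hn)) I3 J3 (fun y => J4 2%nat y (le_n 2))
    (fun x t Hx Ht => f_equal Im (Hrep x t Hx Ht))).
  rewrite !R2, !S2 in CR by auto with arith. rewrite !I2, !J2 in CI by auto with arith.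
  split.
  - intros E0. destruct (CR (f_equal Re E0)) as [[A0 A1] _]. destruct (CI (f_equal Im E0)) as [[B0 B1] _].
    split.
    + apply (lim_in_quadrant_of_corner_limit _ _ _ (HU 0%nat ltac:(auto with arith)) A0 B0).
    + apply (lim_in_quadrant_of_corner_limit _ _ _ (HU 1%nat ltac:(auto with arith)) A1 B1).
  - intros E0 E2. destruct (CR (f_equal Re E0)) as [_ A]. destruct (CI (f_equal Im E0)) as [_ B].
    destruct (A (f_equal Re E2)) as [A2 A3]. destruct (B (f_equal Im E2)) as [B2 B3].
    split.
    + apply (lim_in_quadrant_of_corner_limit _ _ _ (HU 2%nat ltac:(auto with arith)) A2 B2).
    + apply (lim_in_quadrant_of_corner_limit _ _ _ (HU 3%nat ltac:(auto with arith)) A3 B3).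
Qed.
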